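(* Let $\Omega, f, u_a, u_b, b$ satisfy the standing assumptions listed in the context, let $U_{ad}=\{u\in L^\infty(\Omega): u_a(x)\le u(x)\le u_b(x)\text{ for a.e. }x\in\Omega\}$, and let $S$ be the control-to-state map that assigns to $u\in U_{ad}$ the unique weak solution $y=S(u)\in H^1_0(\Omega)$ of the Kirchhoff equation $-(u+b\,\|\nabla y\|_{L^2(\Omega)}^2)\,\Delta y=f$ in $\Omega$, $y=0$ on $\partial\Omega$. Then for every $p\in[1,\infty)$, $S$ is continuous from $U_{ad}$, endowed with the $L^2(\Omega)$-topology, into $H^1_0(\Omega)\cap W^{2,p}(\Omega)$.
   Context: Standing assumptions: $1\le N\le 3$ and $\Omega\subset\mathbb{R}^N$ is a bounded domain of class $C^{1,1}$. The right-hand side $f\in L^\infty(\Omega)$ satisfies $f\ge f_0$ a.e. for some real $f_0>0$. The bounds $u_a,u_b\in C(\overline\Omega)$ satisfy $u_b\ge u_a\ge u_0$ for some real $u_0>0$. The coefficient $b\in W^{1,\infty}(\Omega)$ satisfies $b\ge b_0$ a.e. for some real $b_0>0$. Weak solution: for $u\in U_{ad}$, a function $y\in H^1_0(\Omega)$ is a weak solution of the Kirchhoff equation if $\int_\Omega\nabla y\cdot\nabla v\,dx=\int_\Omega \frac{f\,v}{u+b\,\|\nabla y\|_{L^2(\Omega)}^2}\,dx$ for all $v\in H^1_0(\Omega)$. It is known that for every $u\in U_{ad}$ there is exactly one weak solution and that it belongs to $W^{2,p}(\Omega)$ for all $p\in[1,\infty)$, so $S$ is well defined. *)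

(* Defs.v *)
From HB Require Import structures.
From mathcomp Require Import all_boot all_order all_algebra.
From mathcomp Require Import all_classical all_reals all_analysis.
Set Implicit Arguments.
Unset Strict Implicit.
Unset Printing Implicit Defensive.
Import Order.TTheory GRing.Theory Num.Theory.
Import numFieldNormedType.Exports.
Local Open Scope classical_set_scope.
Local Open Scope ring_scope.

(* R^n is realized as 'rV[R]_n; its sigma-algebra is the product one, generated
   by the coordinates, i.e. the Borel sigma-algebra. *)

Definition rV_display : measure_display -> measure_display.
Proof. exact. Qed.

Section rV_measurable.
Context {R : realType} (n : nat).

Definition rV_coord (i : 'I_n) (x : 'rV[R]_n) : R := x 0 i.

Let rV_set0 : g_sigma_preimage rV_coord set0.
Proof. exact: sigma_algebra0. Qed.

Let rV_setC A : g_sigma_preimage rV_coord A -> g_sigma_preimage rV_coord (~` A).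
Proof. exact: sigma_algebraC. Qed.

Let rV_bigcup (F : (set 'rV[R]_n)^nat) :
  (forall i, g_sigma_preimage rV_coord (F i)) ->
  g_sigma_preimage rV_coord (\bigcup_i (F i)).
Proof. exact: sigma_algebra_bigcup. Qed.

HB.instance Definition _ := @isMeasurable.Build
  (rV_display default_measure_display) 'rV[R]_n
  (g_sigma_preimage rV_coord) rV_set0 rV_setC rV_bigcup.

Lemma measurable_rV_coord (i : 'I_n) :
  measurable_fun [set: 'rV[R]_n] (rV_coord i).
Proof.
move=> _ Y mY; rewrite setTI; apply: sub_sigma_algebra => /=.
rewrite -bigcup_seq/=; exists i => /=; first by rewrite mem_index_enum.
by exists Y => //; rewrite setTI.
Qed.

Lemma measurable_fun_rV d (T : measurableType d) (f : T -> 'rV[R]_n) :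
  (forall i, measurable_fun [set: T] (rV_coord i \o f)) ->
  measurable_fun [set: T] f.
Proof.
move=> mf.
have : g_sigma_preimage (fun i => rV_coord i \o f) `<=` measurable.
  apply: smallest_sub; first exact: sigma_algebra_measurable.
  rewrite -bigcup_seq; apply: bigcup_sub => i _.
  by move=> A [B mB <-]; exact: mf.
by rewrite g_sigma_preimage_comp => sub _ A mA; apply: sub; exists A.
Qed.

End rV_measurable.

Section rV_cons.
Context {R : realType} (n : nat).

Definition rV_cons (z : R * 'rV[R]_n) : 'rV[R]_n.+1 :=
  \row_i (if unlift ord0 i is Some j then z.2 0 j else z.1).

Lemma measurable_rV_cons : measurable_fun [set: R * 'rV[R]_n] rV_cons.
Proof.
apply: measurable_fun_rV => i; case: (unliftP ord0 i) => [j|] ->.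
  rewrite (_ : _ \o _ = @rV_coord R n j \o snd); last first.
    by apply/funext => z /=; rewrite /rV_coord mxE liftK.
  by apply: measurableT_comp => //; exact: measurable_rV_coord.
rewrite (_ : _ \o _ = fst)//.
by apply/funext => z /=; rewrite /rV_coord mxE unlift_none.
Qed.

#[local] Hint Resolve measurable_rV_cons : core.

Variable m : {sigma_finite_measure set 'rV[R]_n -> \bar R}.

Definition lebesgue_rV_cons : set 'rV[R]_n.+1 -> \bar R :=
  pushforward (@lebesgue_measure R \x m)%E rV_cons.

Let lebesgue_rV_cons0 : lebesgue_rV_cons set0 = 0%E.
Proof. exact: measure0. Qed.

Let lebesgue_rV_cons_ge0 A : (0 <= lebesgue_rV_cons A)%E.
Proof. exact: measure_ge0. Qed.

Let lebesgue_rV_cons_sigma_additive : semi_sigma_additive lebesgue_rV_cons.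
Proof. exact: measure_semi_sigma_additive. Qed.

HB.instance Definition _ := isMeasure.Build _ _ _ lebesgue_rV_cons
  lebesgue_rV_cons0 lebesgue_rV_cons_ge0 lebesgue_rV_cons_sigma_additive.

Let lebesgue_rV_cons_sigma_finite : sigma_finite setT lebesgue_rV_cons.
Proof.
have /sigma_finiteP[F [TF ndF Foo]] := sigma_finiteT (@lebesgue_measure R).
have /sigma_finiteP[G [TG ndG Goo]] := sigma_finiteT m.
pose uncons (x : 'rV[R]_n.+1) : R * 'rV[R]_n :=
  (rV_coord ord0 x, \row_i rV_coord (lift ord0 i) x).
have consK : cancel rV_cons uncons.
  move=> [a v]; rewrite /uncons /rV_coord mxE unlift_none; congr pair.
  by apply/rowP => i; rewrite !mxE liftK.
have muncons : measurable_fun [set: 'rV[R]_n.+1] uncons.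
  apply: measurable_fun_pair; first exact: measurable_rV_coord.
  apply: measurable_fun_rV => i.
  rewrite (_ : _ \o _ = @rV_coord R n.+1 (lift ord0 i)).
    exact: measurable_rV_coord.
  by apply/funext => x /=; rewrite /rV_coord mxE.
exists (fun k => uncons @^-1` (F k `*` G k)).
  rewrite -preimage_bigcup -(preimage_setT uncons); congr (_ @^-1` _).
  apply/esym; rewrite -subTset => -[a v] _.
  have [k _ Fka] : (\bigcup_k F k) a by rewrite -TF.
  have [l _ Glv] : (\bigcup_k G k) v by rewrite -TG.
  exists (maxn k l) => //; split => /=.
    by move: a Fka; exact/subsetPset/ndF/leq_maxl.
  by move: v Glv; exact/subsetPset/ndG/leq_maxr.
move=> k; have [mF Fk] := Foo k; have [mG Gk] := Goo k; split.
  by rewrite -[X in measurable X]setTI; apply: muncons => //; exact: measurableX.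
rewrite /lebesgue_rV_cons /pushforward -comp_preimage.
rewrite (_ : uncons \o rV_cons = id); last exact/funext.
by rewrite preimage_id product_measure1E// lte_mul_pinfty// ge0_fin_numE.
Qed.

HB.instance Definition _ := Measure_isSigmaFinite.Build _ _ _ lebesgue_rV_cons
  lebesgue_rV_cons_sigma_finite.

End rV_cons.

Fixpoint lebesgue_rV (R : realType) (n : nat) :
    {sigma_finite_measure set 'rV[R]_n -> \bar R} :=
  match n with
  | 0 => dirac (0 : 'rV[R]_0)
  | n'.+1 => lebesgue_rV_cons (lebesgue_rV R n')
  end.

(* Functions on Omega are represented by functions on R^N, of which only the
   restriction to Omega is used. *)

Section sobolev.
Context {R : realType} {N : nat}.
Implicit Types (Omega : set 'rV[R]_N) (y v g phi : 'rV[R]_N -> R).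

Definition partial (i : 'I_N) phi : 'rV[R]_N -> R :=
  fun x => 'D_(delta_mx 0 i) phi x.

Definition smooth phi := forall s : seq 'I_N,
  continuous (foldr partial phi s) /\
  forall i x, derivable (foldr partial phi s) x (delta_mx 0 i).

Definition test_fun Omega phi :=
  [/\ smooth phi, compact (closure [set x | phi x != 0]) &
      closure [set x | phi x != 0] `<=` Omega].

Definition mlen (a : 'I_N -> nat) : nat := (\sum_(i < N) a i)%N.

Definition munit (i : 'I_N) : 'I_N -> nat := fun j => (j == i : nat).

Definition mderive (a : 'I_N -> nat) phi : 'rV[R]_N -> R :=
  foldr (fun i => iter (a i) (partial i)) phi (enum 'I_N).

Definition loc_integrable Omega g :=
  measurable_fun Omega g /\
  forall K, K `<=` Omega -> compact K ->
    (\int[lebesgue_rV R N]_(x in K) `|g x|%:E < +oo)%E.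

Definition is_wderive Omega (a : 'I_N -> nat) y g :=
  loc_integrable Omega g /\
  forall phi, test_fun Omega phi ->
    \int[lebesgue_rV R N]_(x in Omega) (y x * mderive a phi x) =
    (-1) ^+ mlen a * \int[lebesgue_rV R N]_(x in Omega) (g x * phi x).

(* a representative of the weak derivative D^a y (0 if there is none) *)
Definition wderive Omega (a : 'I_N -> nat) y : 'rV[R]_N -> R :=
  xget (fun=> 0) [set g | is_wderive Omega a y g].

Definition Lp_norm Omega (p : \bar R) y : \bar R :=
  ('N[lebesgue_rV R N]_p [EFin \o (y \_ Omega)%R])%E.

Definition Lp Omega (p : \bar R) y :=
  measurable_fun Omega y /\ (Lp_norm Omega p y < +oo)%E.

Definition sobolev Omega (k : nat) (p : \bar R) y :=
  Lp Omega p y /\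
  forall a, (mlen a <= k)%N -> exists2 g, is_wderive Omega a y g & Lp Omega p g.

(* The sum of the L^p norms of the derivatives, one of the usual equivalent
   norms; it makes sense for p = +oo as well. *)
Definition sobolev_norm Omega (k : nat) (p : \bar R) y : \bar R :=
  (\sum_(a : {ffun 'I_N -> 'I_k.+1} | (mlen (fun i => a i) <= k)%N)
     Lp_norm Omega p (wderive Omega (fun i => a i) y))%E.

Definition H10 Omega y :=
  sobolev Omega 1 2%:E y /\
  forall e : R, 0 < e -> exists2 phi, test_fun Omega phi &
    (sobolev_norm Omega 1 2%:E (y \- phi)%R < e%:E)%E.

Definition grad_dot Omega y v : 'rV[R]_N -> R := fun x =>
  \sum_(i < N) wderive Omega (munit i) y x * wderive Omega (munit i) v x.

(* the square of the L^2(Omega) norm of the gradient *)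
Definition grad_sqnorm Omega y : R :=
  \int[lebesgue_rV R N]_(x in Omega) grad_dot Omega y y x.

End sobolev.

(* phi : R^m -> R has everywhere defined, Lipschitz first partial derivatives *)
Definition C11 (R : realType) (m : nat) (phi : 'rV[R]_m -> R) :=
  forall i : 'I_m, (forall x, derivable phi x (delta_mx 0 i)) /\
    exists L : R, forall x x', `|partial i phi x - partial i phi x'| <= L * `|x - x'|.

(* Around each boundary point x, in orthonormal coordinates w centered at x,
   Omega is the part above the graph of a C^{1,1} function of the coordinates
   other than the k-th one. *)
Definition C11_boundary (R : realType) (N : nat) (Omega : set 'rV[R]_N) :=
  forall x, (closure Omega `\` interior Omega) x ->
    exists (r : R) (Q : 'M[R]_N) (k : 'I_N) (phi : 'rV[R]_N.-1 -> R),
      [/\ 0 < r, Q *m Q^T = 1%:M, C11 phi &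
          forall z, `|z - x| < r ->
            let w := (z - x) *m Q in Omega z <-> phi (col' k w) < w 0 k].

Definition bounded_C11_domain (R : realType) (N : nat) (Omega : set 'rV[R]_N) :=
  [/\ open Omega, connected Omega, Omega !=set0, bounded_set Omega &
      C11_boundary Omega].

Section kirchhoff.
Context {R : realType} {N : nat}.
Implicit Types (Omega : set 'rV[R]_N) (f ua ub b u y : 'rV[R]_N -> R).

Definition ae_in Omega (P : set 'rV[R]_N) :=
  {ae lebesgue_rV R N, forall x, Omega x -> P x}.

Definition admissible_data Omega f ua ub b :=
  [/\ Lp Omega +oo%E f /\
        (exists2 f0 : R, 0 < f0 & ae_in Omega [set x | f0 <= f x]),
      {within closure Omega, continuous ua},
      {within closure Omega, continuous ub},
      exists2 u0 : R, 0 < u0 &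
        forall x, closure Omega x -> u0 <= ua x <= ub x &
      sobolev Omega 1 +oo%E b /\
        (exists2 b0 : R, 0 < b0 & ae_in Omega [set x | b0 <= b x])].

Definition Uad Omega ua ub u :=
  Lp Omega +oo%E u /\ ae_in Omega [set x | ua x <= u x <= ub x].

Definition weak_solution Omega f b u y :=
  H10 Omega y /\
  forall v, H10 Omega v ->
    \int[lebesgue_rV R N]_(x in Omega) grad_dot Omega y v x =
    \int[lebesgue_rV R N]_(x in Omega)
      (f x * v x / (u x + b x * grad_sqnorm Omega y)).

(* The known well-posedness and regularity result which makes the
   control-to-state map well defined; it is qualitative, without any estimate:
   on Omega, each problem with admissible data and control has exactly one weak
   solution (up to equality a.e.), and it is in W^{2,p} for all finite p. *)
Definition kirchhoff_wellposed Omega :=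
  forall f ua ub b, admissible_data Omega f ua ub b ->
  forall u, Uad Omega ua ub u ->
    exists y,
      [/\ weak_solution Omega f b u y,
          forall y', weak_solution Omega f b u y' ->
            ae_in Omega [set x | y' x = y x] &
          forall p : R, 1 <= p -> sobolev Omega 2 p%:E y].

Definition control_to_state Omega f ua ub b
    (S : ('rV[R]_N -> R) -> 'rV[R]_N -> R) :=
  forall u, Uad Omega ua ub u -> weak_solution Omega f b u (S u).

End kirchhoff.

(* Main.v *)
(** With g(u,s) = f / (u + b s), the state y = S(u) is the solution of the linear
    Poisson problem - Delta y = g(u,s) for s = ||grad y||^2. Applied to u = b = 1,
    the well-posedness of the Kirchhoff equation makes the Poisson operator T
    (g bounded, w = T g in H^1_0 and in every W^{2,p}) well defined.

    No W^{2,p} estimate is assumed; it comes from a closed graph argument. By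
    Poincare's inequality T is continuous from L^2 to L^2. Fix a derivative
    D^a, |a| <= 2, and 1 < p < oo. The unit ball B of L^oo with the L^1 distance
    is complete; for a dense sequence z_j of L^p the sets {g in B : the distance
    from D^a T g to z_j is at most e/2}, which are closed because D^a T is
    continuous in the weak sense, cover B. By Baire one of them contains a ball,
    and since every small h in B is a difference of two elements of that ball
    (truncate g_0 + h), ||D^a T h||_p <= e as soon as ||h||_1 is small.

    It remains to see that g(u,s) depends continuously on u in L^2, i.e. that
    s(u) = ||grad S(u)||^2 does. It is bounded, and if s' is a cluster value of
    s(u') as u' -> u, then T g(u,s') has squared gradient norm s' and hence is
    S(u) by uniqueness, so that s' = s(u). *)
From HB Require Import structures.
Require Import Defs.
From mathcomp Require Import all_boot all_order all_algebra.
From mathcomp Require Import all_classical all_reals all_analysis.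
From mathcomp Require Import measurable_realfun ess_sup_inf.
From mathcomp Require Import ring lra.
Set Implicit Arguments.
Unset Strict Implicit.
Unset Printing Implicit Defensive.
Import Order.TTheory GRing.Theory Num.Theory.
Import numFieldNormedType.Exports.
Import HBNNSimple.
Local Open Scope classical_set_scope.
Local Open Scope ring_scope.

(** * The spaces L^p on a subset of a measure space *)

(** Well-posedness covers bounded right-hand sides only and comes without constants, so T is not yet
    defined on all of L^p. A closed graph theorem on the Banach space L^oo would bound D^a T g by
    the L^oo norm of g, but g(u',s') need not approach g(u,s) in that norm when u' -> u in L^2. The
    unit ball of L^oo with the L^1 distance (a Saks space) reconciles the two: it is complete, T is
    defined on it, and after scaling the right-hand sides do converge in it. The price is that it is
    not a vector space: the ball found by Baire's theorem cannot be translated to 0, whence the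
    truncation. The distance of D^a T g to z_j is expressed through integrals against test functions
    phi, which are dense in the dual exponent. There D^a can be moved onto phi, so that the L^2
    continuity of T suffices. This duality requires p > 1; the exponent p of the theorem is reached
    from p + 1 by Hoelder's inequality, which also settles p = 1. *)

Lemma cvg_powR0 (R : realType) (p : R) (u : nat -> R) : 0 < p ->
  (forall n, 0 <= u n) -> u n @[n --> \oo] --> 0 ->
  (u n) `^ p @[n --> \oo] --> 0.
Proof.
move=> p0 u0 /cvgr0Pnorm_le cu; apply/cvgr0Pnorm_le => e e0.
have := cu (e `^ p^-1) (powR_gt0 _ e0); apply: filterS => n.
rewrite (ger0_norm (u0 n)) ger0_norm ?powR_ge0// => un.
have -> : e = (e `^ p^-1) `^ p by rewrite -powRrM mulVf ?gt_eqF// powRr1// ltW.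
by rewrite ge0_ler_powR ?nnegrE ?powR_ge0 ?u0// ltW.
Qed.

Section Lp_space.
Context d (T : measurableType d) (R : realType).
Variables (mu : {measure set T -> \bar R}) (D : set T).
Hypothesis mD : measurable D.
Implicit Types (f g h : T -> R) (p q : R).

(** For [lebesgue_rV] and [D = Omega] this is convertible to [Lp Omega], so that the lemmas below
    apply to [Lp] directly. *)
Definition Lpfun (p : \bar R) f :=
  measurable_fun D f /\ ('N[mu]_p[EFin \o (f \_ D)%R] < +oo)%E.

(** [fine] turns an infinite norm into 0, hence the hypotheses [Lpfun] in the estimates of [Lpn]. *)
Definition Lpn p f : R := fine ('N[mu]_p%:E[EFin \o (f \_ D)%R]).

Lemma Lpn_ge0 p f : 0 <= Lpn p f.
Proof. exact/fine_ge0/Lnorm_ge0. Qed.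

Lemma measurable_powR_norm p f :
  measurable_fun D f -> measurable_fun D (fun x => `|f x| `^ p).
Proof.
move=> mf; apply: (@measurableT_comp _ _ _ _ _ _ (@powR R ^~ p)).
  exact: measurable_powR.
exact: measurableT_comp.
Qed.

Lemma Lnorm_restrict p f : 0 < p -> ('N[mu]_p%:E[EFin \o (f \_ D)%R] =
  (\int[mu]_(x in D) (`|f x| `^ p)%:E) `^ p^-1)%E.
Proof.
move=> p0; rewrite unlock /Lnorm; congr (_ `^ _)%E.
rewrite [RHS]integral_mkcond; apply: eq_integral => x _ /=.
by rewrite /patch; case: ifP => // _; rewrite normr0 powR0// gt_eqF.
Qed.

Lemma LpfunP p f : 0 < p -> Lpfun p%:E f <->
  measurable_fun D f /\ mu.-integrable D (fun x => (`|f x| `^ p)%:E).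
Proof.
move=> p0; have pV0 : p^-1 != 0 by rewrite invr_neq0// gt_eqF.
split=> -[mf H]; split => //; last first.
  rewrite Lnorm_restrict// poweR_lty//.
  have /integrableP[_] := H.
  by under eq_integral do rewrite gee0_abs ?lee_fin ?powR_ge0//.
apply/integrableP; split.
  exact/measurable_EFinP/measurable_powR_norm.
under eq_integral do rewrite gee0_abs ?lee_fin ?powR_ge0//.
by move: H; rewrite Lnorm_restrict// => /(lty_poweRy pV0).
Qed.

Lemma Lpn_fineK p f : Lpfun p%:E f ->
  ('N[mu]_p%:E[EFin \o (f \_ D)%R] = (Lpn p f)%:E)%E.
Proof. by move=> [_ fp]; rewrite /Lpn fineK ?ge0_fin_numE ?Lnorm_ge0. Qed.

Lemma Lpn_powR p f : 0 < p -> Lpfun p%:E f ->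
  Lpn p f `^ p = \int[mu]_(x in D) (`|f x| `^ p).
Proof.
move=> p0 /[dup] fp /(LpfunP _ p0)[mf If].
rewrite /Rintegral; have Ifin := integrable_fin_num mD If.
have := Lpn_fineK fp; rewrite Lnorm_restrict//.
rewrite -[X in (X `^ _)%E]fineK// poweR_EFin => -[<-].
rewrite -powRrM mulVf ?gt_eqF// powRr1// fine_ge0//.
by apply: integral_ge0 => x _; rewrite lee_fin powR_ge0.
Qed.

Lemma Lpn_le p f g : 0 < p -> measurable_fun D f -> Lpfun p%:E g ->
  {ae mu, forall x, D x -> `|f x| <= `|g x|} ->
  Lpfun p%:E f /\ Lpn p f <= Lpn p g.
Proof.
move=> p0 mf [mg gp] fg.
have H : ('N[mu]_p%:E[EFin \o (f \_ D)%R] <=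
          'N[mu]_p%:E[EFin \o (g \_ D)%R])%E.
  rewrite !Lnorm_restrict//; apply: gt0_ler_poweR; first by rewrite invr_ge0 ltW.
  - by rewrite in_itv/= leey andbT; apply: integral_ge0 => x _; rewrite lee_fin powR_ge0.
  - by rewrite in_itv/= leey andbT; apply: integral_ge0 => x _; rewrite lee_fin powR_ge0.
  - apply: ae_ge0_le_integral => //.
    + exact/measurable_EFinP/measurable_powR_norm.
    + exact/measurable_EFinP/measurable_powR_norm.
    + apply: filterS fg => x fg Dx.
      by rewrite lee_fin ge0_ler_powR ?nnegrE ?normr_ge0 ?fg// ltW.
have fp : Lpfun p%:E f by split => //; exact: le_lt_trans gp.
by split => //; rewrite -lee_fin -!Lpn_fineK.
Qed.

Lemma Lpn_ae p f g : 0 < p -> measurable_fun D g -> Lpfun p%:E f ->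
  {ae mu, forall x, D x -> f x = g x} -> Lpfun p%:E g /\ Lpn p g = Lpn p f.
Proof.
move=> p0 mg fp fg.
have [gp gf] : Lpfun p%:E g /\ Lpn p g <= Lpn p f.
  by apply: Lpn_le => //; apply: filterS fg => x fg /fg ->.
split => //; apply/eqP; rewrite eq_le gf/=.
have fg' : {ae mu, forall x, D x -> `|f x| <= `|g x|}.
  by apply: filterS fg => x fg /fg ->.
by have [] := Lpn_le p0 (proj1 fp) gp fg'.
Qed.

Lemma LpfunD p f g : 1 <= p -> Lpfun p%:E f -> Lpfun p%:E g ->
  Lpfun p%:E (f \+ g) /\ Lpn p (f \+ g) <= Lpn p f + Lpn p g.
Proof.
move=> p1 fp gp; have [[mf _] [mg _]] := (fp, gp).
have fgp : ('N[mu]_p%:E[EFin \o ((f \+ g) \_ D)%R] <=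
    (Lpn p f)%:E + (Lpn p g)%:E)%E.
  rewrite -!Lpn_fineK//.
  have -> : ((f \+ g) \_ D = (f \_ D) \+ (g \_ D))%R.
    by apply/funext => x/=; rewrite /patch; case: ifP; rewrite ?addr0.
  by apply: minkowski_EFin => //; apply/(measurable_restrictT _ mD).
have fgl : Lpfun p%:E (f \+ g).
  by split; [exact: measurable_funD|exact: le_lt_trans fgp (ltry _)].
by split => //; rewrite -lee_fin EFinD -(Lpn_fineK fgl).
Qed.

Lemma LpfunZ p a f : 0 < p -> Lpfun p%:E f ->
  Lpfun p%:E (fun x => a * f x) /\ Lpn p (fun x => a * f x) = `|a| * Lpn p f.
Proof.
move=> p0 /[dup] fp /(LpfunP _ p0) [mf If].
have E : (fun x => (`|a * f x| `^ p)%:E) =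
         (fun x => (`|a| `^ p)%:E * (`|f x| `^ p)%:E)%E.
  by apply/funext => x; rewrite normrM powRM// EFinM.
have afp : Lpfun p%:E (fun x => a * f x).
  apply/LpfunP => //; split; first exact: measurable_funM.
  by rewrite E; exact: integrableZl.
split => //.
rewrite -[LHS]powRr1 ?Lpn_ge0// -[RHS]powRr1 ?mulr_ge0 ?Lpn_ge0//.
rewrite -(@mulfV _ p) ?gt_eqF// !powRrM; congr (_ `^ _).
rewrite powRM ?Lpn_ge0// !Lpn_powR//.
rewrite -RintegralZl//.
by apply: eq_Rintegral => x _; rewrite normrM powRM.
Qed.

Lemma LpfunN p f : 0 < p -> Lpfun p%:E f ->
  Lpfun p%:E (\- f) /\ Lpn p (\- f) = Lpn p f.
Proof.
move=> p0 /(LpfunZ (-1) p0); have -> : (fun x => -1 * f x) = \- f.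
  by apply/funext => x /=; rewrite mulN1r.
by rewrite normrN1 mul1r.
Qed.

Lemma LpfunB p f g : 1 <= p -> Lpfun p%:E f -> Lpfun p%:E g ->
  Lpfun p%:E (f \- g) /\ Lpn p (f \- g) <= Lpn p f + Lpn p g.
Proof.
move=> p1 fp /LpfunN[]; first by rewrite (lt_le_trans _ p1).
by move=> gp <-; exact: LpfunD.
Qed.

Lemma Lpn_tri p f g : 1 <= p -> Lpfun p%:E f -> Lpfun p%:E g ->
  Lpn p f <= Lpn p g + Lpn p (f \- g).
Proof.
move=> p1 fp gp; have [fgp _] := LpfunB p1 fp gp.
have [_] := LpfunD p1 gp fgp; congr (Lpn p _ <= _).
by apply/funext => x /=; rewrite subrKC.
Qed.

Lemma LpnC p f g : Lpn p (f \- g) = Lpn p (g \- f).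
Proof.
rewrite /Lpn -oppe_Lnorm; congr fine; apply: eq_Lnorm => x /=.
by rewrite /patch; case: ifP => _ /=; [rewrite opprB|exact: (congr1 EFin (oppr0 _))].
Qed.

Lemma Lpfun0 p : 0 < p -> Lpfun p%:E (cst 0) /\ Lpn p (cst 0) = 0.
Proof.
move=> p0; have E : ('N[mu]_p%:E[EFin \o (cst 0%R \_ D)%R] = 0)%E.
  rewrite -(@Lnorm0 _ _ _ mu p%:E); last by rewrite eqe gt_eqF.
  by apply: eq_Lnorm => x /=; rewrite /patch; case: ifP.
by split; [split => //; rewrite E|rewrite /Lpn E].
Qed.

Lemma Lpn_eq0 p f : 0 < p -> Lpfun p%:E f -> Lpn p f = 0 ->
  {ae mu, forall x, D x -> f x = 0}.
Proof.
move=> p0 fp f0; have := Lpn_fineK fp; rewrite f0 => fN.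
have mf : measurable_fun setT (EFin \o (f \_ D)%R).
  by apply/measurable_EFinP/(measurable_restrictT _ mD); case: fp.
have p0' : (0 < p%:E)%E by rewrite lte_fin.
have := Lnorm_eq0_eq0 mf p0' fN.
apply: filterS => x /(_ I)/= [] + Dx.
by rewrite /patch mem_set.
Qed.

Lemma Lp1_integrable f : Lpfun 1%:E f <-> mu.-integrable D (EFin \o f).
Proof.
split.
  move=> /LpfunP[]// mf If; apply: le_integrable If => //.
    exact/measurable_EFinP.
  by move=> x Dx /=; rewrite lee_fin powRr1// normr_id.
move=> If; have mf : measurable_fun D f.
  by have /integrableP[/measurable_EFinP] := If.
apply/LpfunP => //; split => //.
apply: le_integrable If => //.
  exact/measurable_EFinP/measurable_powR_norm.
by move=> x Dx /=; rewrite lee_fin powRr1// normr_id.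
Qed.

Lemma Lpn1E f : Lpfun 1%:E f -> Lpn 1 f = \int[mu]_(x in D) `|f x|.
Proof.
move=> f1; rewrite -[LHS]powRr1 ?Lpn_ge0// Lpn_powR//.
by apply: eq_Rintegral => x _; rewrite powRr1.
Qed.

Lemma Lpfun_hoelder p q f g : 0 < p -> 0 < q -> p^-1 + q^-1 = 1 ->
  Lpfun p%:E f -> Lpfun q%:E g ->
  mu.-integrable D (EFin \o (fun x => f x * g x)) /\
  `|\int[mu]_(x in D) (f x * g x)| <= Lpn p f * Lpn q g.
Proof.
move=> p0 q0 pq fp gq; have [[mf _] [mg _]] := (fp, gq).
have := @hoelder _ _ _ mu (f \_ D)%R (g \_ D)%R p q.
move=> /(_ ((measurable_restrictT _ mD).1 mf) ((measurable_restrictT _ mD).1 mg)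
  p0 q0 pq).
have -> : ((f \_ D) \* (g \_ D) = (f \* g) \_ D)%R.
  by apply/funext => x/=; rewrite /patch; case: ifP; rewrite ?mul0r.
rewrite (Lpn_fineK fp) (Lpn_fineK gq) -EFinM => H.
have fg1 : Lpfun 1%:E (f \* g).
  by split; [exact: measurable_funM|exact: le_lt_trans H (ltry _)].
have fgi := (Lp1_integrable (f \* g)).1 fg1; split => //.
rewrite (Lpn_fineK fg1) lee_fin in H.
apply: le_trans H; rewrite Lpn1E//; exact: le_normr_Rintegral.
Qed.

Lemma ae_eq_Rintegral f g : measurable_fun D f -> measurable_fun D g ->
  {ae mu, forall x, D x -> f x = g x} ->
  \int[mu]_(x in D) f x = \int[mu]_(x in D) g x.
Proof.
move=> mf mg fg; rewrite /Rintegral; congr fine; apply: ae_eq_integral => //.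
- exact/measurable_EFinP.
- exact/measurable_EFinP.
- by apply: filterS fg => x fg /fg ->.
Qed.

Lemma Lpn_dominated_cvg p (F : nat -> T -> R) f h : 1 <= p ->
  (forall n, measurable_fun D (F n)) -> measurable_fun D f -> Lpfun p%:E h ->
  {ae mu, forall x, D x -> F n x @[n --> \oo] --> f x} ->
  (forall n x, D x -> `|F n x| <= `|h x|) ->
  [/\ Lpfun p%:E f, forall n, Lpfun p%:E (F n) &
   Lpn p (F n \- f) @[n --> \oo] --> 0].
Proof.
move=> p1 mF mf hp Ff Fh; have p0 : 0 < p by rewrite (lt_le_trans _ p1).
have [mh Ih] := (LpfunP _ p0).1 hp.
have fh : {ae mu, forall x, D x -> `|f x| <= `|h x|}.
  apply: filterS Ff => x /[swap] Dx /(_ Dx) Ff.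
  apply: (closed_cvg (fun y : R => is_true (`|y| <= `|h x|)) _ _ _ Ff).
    apply: (@preimage_closed _ _ (@Num.norm R R) [set y | y <= `|h x|]).
      by move=> y _; exact: norm_continuous.
    exact: closed_le.
  by apply: nearW => n; exact: Fh.
have fp : Lpfun p%:E f by have [] := Lpn_le p0 mf hp fh.
have Fp n : Lpfun p%:E (F n).
  by have [] := Lpn_le p0 (mF n) hp (aeW _ (Fh n)).
split => //.
have Fmf n : Lpfun p%:E (F n \- f) by have [] := LpfunB p1 (Fp n) fp.
(* The limit inherits the bound |h| almost everywhere, so |F n - f| <= 2 |h|. *)
pose h2 x := (`|2 * h x| `^ p).
have [h2p _] := LpfunZ 2 p0 hp; have [mh2 Ih2] := (LpfunP _ p0).1 h2p.
have cF : {ae mu, forall x, D x ->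
    (`|F n x - f x| `^ p)%:E @[n --> \oo] --> (cst 0%E x : \bar R)}.
  apply: filterS Ff => x /[swap] Dx /(_ Dx) Ff.
  apply: cvg_EFin; first exact: nearW.
  apply: cvg_powR0 => //; rewrite -[X in _ --> X](normr0 R).
  apply: cvg_norm; rewrite -(subrr (f x)); exact: cvgB Ff (cvg_cst _).
have dF : {ae mu, forall x n, D x ->
    (`|(`|F n x - f x| `^ p)%:E| <= (h2 x)%:E)%E}.
  apply: filterS fh => x fh n Dx.
  rewrite gee0_abs ?lee_fin ?powR_ge0// /h2.
  apply: ge0_ler_powR; rewrite ?nnegrE//; first exact: ltW.
  rewrite (le_trans (ler_normB _ _))// normrM ger0_norm// mulr_natl mulr2n.
  by rewrite lerD ?Fh ?fh.
have [_ _ H] := dominated_convergence mD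
  (fun n => (measurable_EFinP _ _).2 (measurable_powR_norm p (proj1 (Fmf n))))
  (@measurable_cst _ _ _ _ _ _) cF Ih2 dF.
rewrite integral_cst// mul0e in H.
have {}H : (Lpn p (F n \- f)) `^ p @[n --> \oo] --> 0.
  under eq_fun do rewrite Lpn_powR//.
  exact: (fine_cvg H).
have {}H : ((Lpn p (F n \- f)) `^ p) `^ p^-1 @[n --> \oo] --> 0.
  by apply: cvg_powR0; rewrite ?invr_gt0// => n; exact: powR_ge0.
by under eq_fun do rewrite -[Lpn _ _]powRr1 ?Lpn_ge0// -(@mulfV _ p) ?gt_eqF// powRrM.
Qed.

End Lp_space.

(** * Density in L^p from a generating pi-system *)

Section Lp_density.
Context d (T : measurableType d) (R : realType).
Variables (mu : {measure set T -> \bar R}) (D : set T).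
Hypotheses (mD : measurable D) (Dfin : (mu D < +oo)%E).
Implicit Types (f g h : T -> R) (p q : R).

Local Notation Lpfun := (Lpfun mu D).
Local Notation Lpn := (Lpn mu D).

Lemma Lpfun_cst p c : 0 < p -> Lpfun p%:E (cst c).
Proof.
move=> p0; apply/LpfunP => //; split; first exact: measurable_cst.
apply: (@measurable_bounded_integrable _ _ _ _ (cst (`|c| `^ p))) => //.
by exists (`|c| `^ p); split => // M cM x _ /=; rewrite ger0_norm ?powR_ge0// ltW.
Qed.

Lemma Lpfun_bounded p f M : 0 < p -> measurable_fun D f ->
  {ae mu, forall x, D x -> `|f x| <= M} -> Lpfun p%:E f.
Proof.
move=> p0 mf fM; have [] := @Lpn_le _ _ _ mu D mD p f (cst M) p0 mf (Lpfun_cst M p0).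
  by apply: filterS fM => x /[apply] /le_trans; apply; rewrite ler_norm.
by [].
Qed.

Definition Lpcl p (V : set (T -> R)) f := Lpfun p%:E f /\
  forall e, 0 < e -> exists2 v, V v & Lpn p (f \- v) < e.

Section closure.
Variables (p : R) (V : set (T -> R)).
Hypotheses (p1 : 1 <= p) (VLp : forall v, V v -> Lpfun p%:E v).
Hypothesis VD : forall v w, V v -> V w -> V (v \+ w).
Hypothesis VZ : forall (q : rat) v, V v -> V (fun x => ratr q * v x).

Let p0 : 0 < p. Proof. exact: lt_le_trans p1. Qed.

Lemma LpclD f g : Lpcl p V f -> Lpcl p V g -> Lpcl p V (f \+ g).
Proof.
move=> [fp fV] [gp gV]; split; first by have [] := LpfunD mD p1 fp gp.
move=> e e0; have e20 : 0 < e / 2 by rewrite divr_gt0.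
have [v Vv fv] := fV _ e20; have [w Vw gw] := gV _ e20.
exists (v \+ w); first exact: VD.
have [fvp _] := LpfunB mD p1 fp (VLp Vv); have [gwp _] := LpfunB mD p1 gp (VLp Vw).
have [_] := LpfunD mD p1 fvp gwp.
rewrite (_ : (f \- v) \+ (g \- w) = (f \+ g) \- (v \+ w)); last first.
  by apply/funext => x /=; rewrite opprD addrACA.
by move=> /le_lt_trans; apply; rewrite (splitr e) ltrD.
Qed.

(** [V] is stable under rational factors only, so that countable classes qualify. The factor [a] is
    replaced by a rational [q] with |a - q| < c, where [c] makes |a - q| times the norm of [f] at
    most e / 2. *)
Lemma LpclZ a f : Lpcl p V f -> Lpcl p V (fun x => a * f x).
Proof.
move=> [fp fV]; split; first by have [] := LpfunZ mD a p0 fp.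
move=> e e0; have e20 : 0 < e / 2 by rewrite divr_gt0.
pose c := e / 2 / (Lpn p f + 1).
have f1 : 0 < Lpn p f + 1 by rewrite ltr_wpDl// Lpn_ge0.
have c0 : 0 < c by rewrite divr_gt0.
have [q qin] : exists q : rat, ratr q \in `](a - c), (a + c)[%R.
  apply: rat_in_itvoo; rewrite ltrD2l (lt_trans _ c0)// oppr_lt0//.
have qa : `|a - ratr q| < c.
  by move: qin; rewrite in_itv/= -ltr_distlC distrC.
have [v Vv fv] : exists2 v, V v & Lpn p (f \- v) < e / 2 / (`|ratr q : R| + 1).
  by apply: fV; rewrite divr_gt0// ltr_wpDl.
have [fvp _] := LpfunB mD p1 fp (VLp Vv).
exists (fun x => ratr q * v x); first exact: VZ.
have [aqf aqfE] := LpfunZ mD (a - ratr q) p0 fp.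
have [qfv qfvE] := LpfunZ mD (ratr q) p0 fvp.
have [_] := LpfunD mD p1 aqf qfv; rewrite aqfE qfvE.
rewrite (_ : _ \+ _ = (fun x => a * f x) \- (fun x => ratr q * v x)); last first.
  by apply/funext => x /=; rewrite mulrBl mulrBr addrA subrK.
move=> /le_lt_trans; apply; rewrite (splitr e) ler_ltD//.
  rewrite (le_trans (ler_wpM2r (Lpn_ge0 _ _ _ _) (ltW qa)))// /c.
  by rewrite mulrAC ler_pdivrMr// ler_pM2l// lerDl.
rewrite (le_lt_trans (ler_wpM2l (normr_ge0 _) (ltW fv)))//.
rewrite [ltLHS]mulrA ltr_pdivrMr ?ltr_wpDl// mulrC ltr_pM2l//.
by rewrite ltrDl.
Qed.

Lemma Lpcl_closed f : Lpfun p%:E f ->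
  (forall e, 0 < e -> exists2 g, Lpcl p V g & Lpn p (f \- g) < e) -> Lpcl p V f.
Proof.
move=> fp fV; split => // e e0; have e20 : 0 < e / 2 by rewrite divr_gt0.
have [g [gp gV] fg] := fV _ e20; have [v Vv gv] := gV _ e20.
exists v => //; have [fgp _] := LpfunB mD p1 fp gp.
have [gvp _] := LpfunB mD p1 gp (VLp Vv).
have [_] := LpfunD mD p1 fgp gvp.
rewrite (_ : _ \+ _ = f \- v); last by apply/funext => x /=; rewrite addrA subrK.
by move=> /le_lt_trans; apply; rewrite (splitr e) ltrD.
Qed.

Lemma Lpcl_dominated (F : nat -> T -> R) f h :
  measurable_fun D f -> Lpfun p%:E h ->
  (forall x, D x -> F n x @[n --> \oo] --> f x) ->
  (forall n x, D x -> `|F n x| <= `|h x|) ->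
  (forall n, Lpcl p V (F n)) -> Lpcl p V f.
Proof.
move=> mf hp Ff Fh FV.
have mF n : measurable_fun D (F n) by have [[]] := FV n.
have [fp Fp cF] := Lpn_dominated_cvg mD p1 mF mf hp (aeW _ Ff) Fh.
apply: Lpcl_closed => // e e0.
have /cvgr0Pnorm_lt/(_ e e0)[N _ /(_ N (leqnn N))] := cF.
rewrite ger0_norm ?Lpn_ge0// => FN; exists (F N) => //.
by rewrite LpnC.
Qed.

Lemma Lpcl_cst0 : V !=set0 -> Lpcl p V (cst 0).
Proof.
move=> [v Vv]; have : Lpcl p V (fun x => 0 * v x).
  apply: LpclZ; split; first exact: VLp.
  move=> e e0; exists v => //; rewrite (_ : v \- v = cst 0).
    by have [_ ->] := Lpfun0 mu D p0.
  by apply/funext => x /=; rewrite subrr.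
by congr Lpcl; apply/funext => x; rewrite mul0r.
Qed.

Lemma Lpcl_sum (I : Type) (r : seq I) (F : I -> T -> R) : V !=set0 ->
  (forall i, Lpcl p V (F i)) -> Lpcl p V (fun x => \sum_(i <- r) F i x).
Proof.
move=> V0 FV; elim: r => [|i r IHr].
  by under eq_fun do rewrite big_nil; exact: Lpcl_cst0.
by under eq_fun do rewrite big_cons; exact: LpclD.
Qed.

Variable G : set (set T).
Hypothesis GE : @measurable _ T = <<s G >>.
Hypothesis GI : setI_closed G.
Hypothesis VT : Lpcl p V (cst 1).
Hypothesis VG : forall A, G A -> Lpcl p V \1_A.

Let V0 : V !=set0.
Proof. by have [_ /(_ 1 ltr01)[v Vv _]] := VT; exists v. Qed.

(** Dynkin's pi-lambda theorem: the sets whose indicator lies in the closure form a lambda-system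
    containing [G]. Countable disjoint unions are handled by dominated convergence of the partial
    sums of the indicators. *)
Lemma Lpcl_indic A : measurable A -> Lpcl p V (\1_A : T -> R).
Proof.
rewrite GE; apply: (dynkin_induction (P := [set A | Lpcl p V (\1_A)])) => //=.
- by rewrite indicT.
- move=> S mS VS; have := LpclD VT (LpclZ (-1) VS); congr Lpcl.
  apply/funext => x /=; rewrite !indicE in_setC.
  by case: (x \in S); rewrite ?mulr1 ?mulr0 ?subrr ?addr0.
- move=> F mF tF FV.
  have sumE n x k : F k x -> (k < n)%N -> \sum_(i < n) (\1_(F i) x : R) = 1.
    move=> Fkx kn; rewrite (bigD1 (Ordinal kn))//= indicE mem_set//.
    rewrite big1 ?addr0// => i ik; rewrite indicE memNset// => Fix.
    have ki := tF k i I I (ex_intro _ x (conj Fkx Fix)).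
    by move/eqP: ik; apply; exact: val_inj.
  have sum0 n x : ~ (\bigcup_k F k) x -> \sum_(i < n) (\1_(F i) x : R) = 0.
    move=> Fx; rewrite big1// => i _; rewrite indicE memNset// => Fix.
    by apply: Fx; exists i.
  apply: (Lpcl_dominated (F := fun n x => \sum_(i < n) \1_(F i) x) (h := cst 1)).
  + apply: measurable_funTS; apply: measurable_indic.
    exact: bigcup_measurable.
  + exact: Lpfun_cst.
  + move=> x Dx; rewrite indicE.
    have [[k _ Fkx]|Fx] := pselect ((\bigcup_k F k) x); last first.
      by rewrite memNset//; apply: cvg_near_cst; apply: nearW => n; exact: sum0.
    rewrite mem_set; last by exists k.
    by apply: cvg_near_cst; exists k.+1 => // n /= kn; exact: sumE Fkx kn.
  + move=> n x Dx; rewrite /cst normr1.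
    have [[k _ Fkx]|Fx] := pselect ((\bigcup_k F k) x); last first.
      by rewrite sum0// normr0.
    have [kn|nk] := ltnP k n; first by rewrite (sumE _ _ _ Fkx kn) normr1.
    rewrite big1 ?normr0// => i _; rewrite indicE memNset// => Fix.
    have ki := tF k i I I (ex_intro _ x (conj Fkx Fix)).
    by have := ltn_ord i; rewrite -ki ltnNge nk.
  + by move=> n; exact: Lpcl_sum.
Qed.

(** Simple functions increase to [f], so [f] itself is the dominating function. *)
Lemma Lpcl_ge0 f : Lpfun p%:E f -> (forall x, D x -> 0 <= f x) -> Lpcl p V f.
Proof.
move=> fp f0; have [mf _] := fp.
have mf' : measurable_fun D (EFin \o f) by exact/measurable_EFinP.
pose F := nnsfun_approx mD mf'.
have f0' x : D x -> (0 <= (EFin \o f) x)%E by move=> Dx; rewrite lee_fin f0.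
have cF x : D x -> F n x @[n --> \oo] --> f x.
  by move=> Dx; apply: (fine_cvg (cvg_nnsfun_approx mD mf' f0' Dx)).
apply: (Lpcl_dominated (F := F) (h := f)) => //.
- move=> n x Dx; rewrite !ger0_norm ?f0//.
  rewrite -(cvg_lim _ (cF x Dx))//; apply: nondecreasing_cvgn_le.
    by move=> a b ab; have /lefP := nd_nnsfun_approx mD mf' ab; apply.
  by apply/cvg_ex; exists (f x); exact: cF.
- move=> n.
  have -> : (F n : T -> R) = fun x => \sum_(i < size (finmap.enum_fset (fset_set (range (F n)))))
     (finmap.enum_fset (fset_set (range (F n))))`_i * \1_(F n @^-1` [set (finmap.enum_fset (fset_set (range (F n))))`_i]) x.
    by apply/funext => x; exact: fimfunEord.
  apply: Lpcl_sum => // i; apply: LpclZ; apply: Lpcl_indic.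
  by rewrite -[X in measurable X]setTI; exact: measurable_funP.
Qed.

Lemma Lp_dense f : Lpfun p%:E f -> Lpcl p V f.
Proof.
move=> fp; have [mf _] := fp.
have nfp : Lpfun p%:E (fun x => `|f x|).
  have [] := @Lpn_le _ _ _ mu D mD p (fun x => `|f x|) f p0 _ fp _ => //.
    exact: measurableT_comp.
  by apply: aeW => x _; rewrite normr_id.
(* Used for [g = f] and [g = \- f], which give the positive and the negative part of [f]. *)
have H g : Lpfun p%:E g -> (forall x, `|g x| = `|f x|) ->
    Lpcl p V (fun x => 2^-1 * (`|f x| + g x)).
  move=> gp gf; apply: LpclZ; apply: Lpcl_ge0.
    by have [] := LpfunD mD p1 nfp gp.
  by move=> x _; rewrite /= -gf -lerBlDl sub0r lerNl -normrN ler_norm.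
have [nfp' _] := LpfunN mD p0 fp.
have := LpclD (H f fp (fun=> erefl)) (LpclZ (-1) (H (\- f) nfp' (fun=> normrN _))).
congr Lpcl; apply/funext => x /=; by lra.
Qed.

End closure.

End Lp_density.

(** * A closed graph theorem on the unit ball of L^oo *)

Section Lp_separable.
Context d (T : measurableType d) (R : realType).
Variables (mu : {measure set T -> \bar R}) (D : set T).
Hypotheses (mD : measurable D) (Dfin : (mu D < +oo)%E).

Local Notation Lpfun := (Lpfun mu D).
Local Notation Lpn := (Lpn mu D).

(** The sequence enumerates the finite rational combinations of indicators of the sets [box c], a
    countable family that meets the conditions of [Lp_dense]. *)
Lemma Lp_separable (C : countType) (box : C -> set T) (p : R) : 1 <= p ->
  @measurable _ T = <<s range box >> -> setI_closed (range box) ->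
  (exists c, D `<=` box c) ->
  exists z : nat -> T -> R, (forall j, Lpfun p%:E (z j)) /\
    forall f, Lpfun p%:E f -> forall e, 0 < e -> exists j, Lpn p (f \- z j) < e.
Proof.
move=> p1 boxE boxI [cD DcD]; have p0 : 0 < p by exact: lt_le_trans p1.
have mbox c : measurable (box c).
  by rewrite boxE; apply: sub_sigma_algebra; exists c.
pose Z (s : seq (rat * C)) x : R := \sum_(k <- s) ratr k.1 * \1_(box k.2) x.
have indp A : measurable A -> Lpfun p%:E (\1_A : T -> R).
  move=> mA; apply: (@Lpfun_bounded _ _ _ mu D mD Dfin p _ 1) => //.
  by apply: aeW => x _; rewrite indicE; case: (_ \in _); rewrite ?normr0 ?normr1.
have Zp s : Lpfun p%:E (Z s).
  elim: s => [|k s IHs].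
    rewrite (_ : Z [::] = cst 0); first exact: Lpfun_cst.
    by apply/funext => x; rewrite /Z big_nil.
  rewrite (_ : Z (k :: s) = (fun x => ratr k.1 * \1_(box k.2) x) \+ Z s); last first.
    by apply/funext => x; rewrite /Z big_cons.
  have [kp _] := LpfunZ mD (ratr k.1) p0 (indp _ (mbox k.2)).
  by have [] := LpfunD mD p1 kp IHs.
have VD v w : range Z v -> range Z w -> range Z (v \+ w).
  move=> [s _ <-] [t _ <-]; exists (s ++ t) => //.
  by apply/funext => x; rewrite /Z big_cat.
have VZ (q : rat) v : range Z v -> range Z (fun x => ratr q * v x).
  move=> [s _ <-]; exists [seq (q * k.1, k.2) | k <- s] => //.
  apply/funext => x; rewrite /Z big_map mulr_sumr; apply: eq_bigr => k _ /=.
  by rewrite rmorphM mulrA.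
have Z1 c : Z [:: (1, c)] = \1_(box c).
  by apply/funext => x; rewrite /Z big_seq1 rmorph1 mul1r.
have VG A : range box A -> Lpcl mu D p (range Z) \1_A.
  move=> [c _ <-]; split; first exact: indp.
  move=> e e0; exists (\1_(box c)); first by exists [:: (1, c)].
  rewrite (_ : _ \- _ = cst 0); first by have [_ ->] := Lpfun0 mu D p0.
  by apply/funext => x /=; rewrite subrr.
(* On [D] the constant 1 is the indicator of a box containing [D]. *)
have VT : Lpcl mu D p (range Z) (cst 1).
  have [ip iV] := VG _ (ex_intro2 _ _ cD I erefl).
  split; first exact: Lpfun_cst.
  move=> e e0; have [v Vv vi] := iV e e0; exists v => //.
  have vp : Lpfun p%:E v by case: Vv => s _ <-.
  have [ivp _] := LpfunB mD p1 ip vp; have [cvp _] := LpfunB mD p1 (Lpfun_cst mD Dfin 1 p0) vp.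
  have H : {ae mu, forall x, D x -> (\1_(box cD) \- v) x = (cst 1 \- v) x}.
    by apply: aeW => x Dx /=; rewrite indicE mem_set//; exact: DcD.
  by have [_ ->] := Lpn_ae mD p0 (proj1 cvp) ivp H.
have dZ := Lp_dense mD Dfin p1 _ VD VZ boxE boxI VT VG.
(* Integers that encode no list are sent to the empty combination. *)
exists (fun j => Z (odflt [::] (unpickle j))); split => // f fp e e0.
have [|_ /(_ e e0)[_ [s _ <-] fs]] := dZ _ f fp; first by move=> _ [s _ <-].
by exists (pickle s); rewrite pickleK.
Qed.

End Lp_separable.

(** * Converse of Hoelder's inequality *)

Section Lp_duality.
Context d (T : measurableType d) (R : realType).
Variables (mu : {measure set T -> \bar R}) (D : set T).
Hypothesis mD : measurable D.

Local Notation Lpfun := (Lpfun mu D).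
Local Notation Lpn := (Lpn mu D).

(** The extremal function w = v |v|^(p-2) satisfies int v w = ||v||_p^p and ||w||_q = ||v||_p^(p-1).
    It is approximated by elements of [Phi], and the resulting inequality is divided by
    ||v||_p^(p-1). *)
Lemma Lpn_dual (Phi : set (T -> R)) (p q e : R) (v : T -> R) :
  1 < p -> 0 < q -> p^-1 + q^-1 = 1 -> 0 <= e ->
  (forall phi, Phi phi -> Lpfun q%:E phi) ->
  (forall w, Lpfun q%:E w -> forall r, 0 < r ->
     exists2 phi, Phi phi & Lpn q (w \- phi) < r) ->
  Lpfun p%:E v ->
  (forall phi, Phi phi -> `|\int[mu]_(x in D) (v x * phi x)| <= e * Lpn q phi) ->
  Lpn p v <= e.
Proof.
move=> p1 q0 pq e0 Phiq dPhi vp Hv.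
have p0 : 0 < p by rewrite (lt_trans _ p1).
have qE : q^-1 = (p - 1) / p by rewrite mulrBl mulfV ?gt_eqF// mul1r -pq addrAC subrr add0r.
have pq1 : (p - 1) * q = p.
  have -> : p - 1 = q^-1 * p by rewrite qE divfK ?gt_eqF.
  by rewrite mulrAC mulVf ?gt_eqF// mul1r.
have q1 : 1 <= q.
  rewrite -invf_le1// qE ler_pdivrMr// mul1r lerBlDr lerDl//.
have [mv Iv] := (LpfunP mu D v p0).1 vp.
pose w x := v x * `|v x| `^ (p - 1 - 1).
have wE x : `|w x| = `|v x| `^ (p - 1).
  by rewrite /w normrM [X in _ * X]ger0_norm ?powR_ge0// mulr_powRB1 ?subr_gt0.
have vwE x : v x * w x = `|v x| `^ p.
  rewrite /w mulrA -expr2 -real_normK ?num_real// expr2 -mulrA.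
  by rewrite mulr_powRB1 ?subr_gt0// mulr_powRB1.
have wqE x : `|w x| `^ q = `|v x| `^ p by rewrite wE -powRrM pq1.
have mw : measurable_fun D w.
  by apply: measurable_funM => //; exact: measurable_powR_norm.
have wq : Lpfun q%:E w.
  by apply/LpfunP => //; split => //; under eq_fun do rewrite wqE.
have wn : Lpn q w = Lpn p v `^ (p - 1).
  have : Lpn q w `^ q = Lpn p v `^ p.
    by rewrite (Lpn_powR mD q0 wq) (Lpn_powR mD p0 vp); apply: eq_Rintegral => x _.
  move=> /(congr1 (fun t => t `^ q^-1)).
  rewrite -!powRrM mulfV ?gt_eqF// powRr1 ?Lpn_ge0// => ->.
  by rewrite qE mulrC divfK ?gt_eqF.
have key : Lpn p v `^ p <= e * Lpn p v `^ (p - 1).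
  apply/ler_addgt0Pr => r r0.
  (* Replacing [w] by [phi] costs e r' on the right and ||v||_p r' on the left, together at most
     [r]. *)
  pose r' := r / (e + Lpn p v + 1).
  have ep1 : 0 < e + Lpn p v + 1 by rewrite ltr_wpDl// addr_ge0// Lpn_ge0.
  have r'0 : 0 < r' by rewrite divr_gt0.
  have [phi Pphi wphi] := dPhi w wq r' r'0.
  have phiq := Phiq _ Pphi.
  have [wphiq _] := LpfunB mD q1 wq phiq.
  have [i1 h1] := Lpfun_hoelder mD p0 q0 pq vp wphiq.
  have [i2 _] := Lpfun_hoelder mD p0 q0 pq vp phiq.
  have -> : Lpn p v `^ p = \int[mu]_(x in D) (v x * phi x + v x * (w \- phi) x).
    rewrite Lpn_powR//; apply: eq_Rintegral => x _.
    by rewrite -mulrDr /= subrKC vwE.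
  rewrite RintegralD//.
  rewrite (le_trans (ler_norm _))// (le_trans (ler_normD _ _))//.
  rewrite (le_trans (lerD (Hv _ Pphi) h1))//.
  have phile : Lpn q phi <= Lpn p v `^ (p - 1) + r'.
    rewrite (le_trans (Lpn_tri mD q1 phiq wq))// wn lerD2l LpnC// ltW//.
  rewrite (@le_trans _ _ (e * (Lpn p v `^ (p - 1) + r') + Lpn p v * r'))//.
    by rewrite lerD// ler_wpM2l ?Lpn_ge0// ltW.
  rewrite mulrDr -addrA lerD2l -mulrDl.
  rewrite /r' mulrA ler_pdivrMr// mulrC ler_wpM2l ?(ltW r0)// lerDl//.
have [v0|v0] := eqVneq (Lpn p v) 0; first by rewrite v0.
have vgt0 : 0 < Lpn p v by rewrite lt0r v0 Lpn_ge0.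
move: key; rewrite -[in leLHS](mulr_powRB1 (ltW vgt0) p0) ler_pM2r//.
exact: powR_gt0.
Qed.

End Lp_duality.

(** * Baire's theorem in the unit ball of L^oo *)

Section Baire_ball.
Context d (T : measurableType d) (R : realType).
Variables (mu : {measure set T -> \bar R}) (D : set T).
Hypotheses (mD : measurable D) (Dfin : (mu D < +oo)%E).

Local Notation Lpfun := (Lpfun mu D).
Local Notation Lpn := (Lpn mu D).

Definition unit_ball (g : T -> R) :=
  measurable_fun D g /\ forall x, D x -> `|g x| <= 1.

Lemma unit_ball_Lpfun (p : R) g : 0 < p -> unit_ball g -> Lpfun p%:E g.
Proof. by move=> p0 [mg g1]; apply: (Lpfun_bounded mD Dfin p0 mg (aeW _ g1)). Qed.

(* The unit ball of L^oo, with the distance of L^1, is a complete metric space. *)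
Lemma unit_ball_complete (g : nat -> T -> R) (r : nat -> R) :
  (forall n, unit_ball (g n)) ->
  (forall n, Lpn 1 (g n.+1 \- g n) <= r n - r n.+1) -> (forall n, 0 <= r n) ->
  exists2 h, unit_ball h & forall n, Lpn 1 (h \- g n) <= r n.
Proof.
move=> gX gr r0; have g1 n := @unit_ball_Lpfun 1 _ ltr01 (gX n).
have dg1 n := (LpfunB mD (lexx 1) (g1 n.+1) (g1 n)).1.
pose u n x := `|g n.+1 x - g n x|.
have mu_ n : measurable_fun D (u n).
  by apply: measurableT_comp => //; have [] := dg1 n.
have uE n : (\int[mu]_(x in D) (u n x)%:E = (Lpn 1 (g n.+1 \- g n))%:E)%E.
  rewrite Lpn1E// /Rintegral fineK//.
  have /(Lp1_integrable _ mD) /integrable_abse I1 := dg1 n.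
  exact: integrable_fin_num I1.
(* Integrating term by term, every partial sum is bounded by the telescoping sum of [r n - r n.+1],
   hence by [r 0]. *)
have Isum : (\int[mu]_(x in D) (\sum_(0 <= n <oo) (u n x)%:E) < +oo)%E.
  rewrite integral_nneseries//; last 2 first.
  - by move=> n; exact/measurable_EFinP.
  - by move=> n x _; rewrite lee_fin normr_ge0.
  apply: (@le_lt_trans _ _ (r 0%N)%:E); last exact: ltry.
  apply: lime_le.
    by apply: is_cvg_nneseries => n _ _; apply: integral_ge0 => x _; rewrite lee_fin normr_ge0.
  apply: nearW => n.
  rewrite (_ : (\sum_(0 <= k < n) _)%E = (\sum_(0 <= k < n) Lpn 1 (g k.+1 \- g k))%:E); last first.
    by rewrite -sumEFin; apply: eq_bigr => k _; rewrite uE.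
  rewrite lee_fin; apply: (@le_trans _ _ (\sum_(0 <= k < n) (r k - r k.+1))).
    by apply: ler_sum => k _; exact: gr.
  have -> : \sum_(0 <= k < n) (r k - r k.+1) = r 0%N - r n.
    elim: n => [|n IHn]; first by rewrite big_nil subrr.
    by rewrite big_nat_recr//= IHn addrA subrK.
  by rewrite lerBlDr lerDl.
have cg : {ae mu, forall x, D x -> cvgn (fun n => g n x)}.
  have : mu.-integrable D (fun x => \sum_(0 <= n <oo) (u n x)%:E)%E.
    apply/integrableP; split.
      apply: ge0_emeasurable_sum => n.
        by move=> x _ _; rewrite lee_fin normr_ge0.
      by move=> _; exact/measurable_EFinP.
    under eq_integral => x _.
      rewrite gee0_abs; last by apply: nneseries_ge0 => n _ _; rewrite lee_fin normr_ge0.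
      over.
    exact: Isum.
  move=> /(integrable_ae mD); apply: filterS => x /[apply] fx.
  have : cvgn (series (fun n => u n x)).
    apply: nnseries_is_cvg => [n|]; first exact: normr_ge0.
    by rewrite ltey_eq fx.
  move=> /(@normed_cvg _ R^o (telescope (fun n => g n x))).
  rewrite telescopeK => cs.
  rewrite (_ : (fun n => g n x) =
    [sequence g n x - g 0%N x]_n + cst (g 0%N x)); last first.
    by apply/funext => n /=; rewrite -[RHS]/(g n x - g 0%N x + g 0%N x) subrK.
  by apply: is_cvgD => //; exact: is_cvg_cst.
(* The upper limit is measurable and equals the limit wherever the latter exists. *)
pose h0 x := limn_sup (fun n => g n x : R^o).
have mh0 : measurable_fun D h0.
  apply: measurable_fun_limn_sup.
  - by move=> x Dx; exists 1 => _ [n _ <-]; have [_ /(_ x Dx)/ler_normlP[]] := gX n.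
  - move=> x Dx; exists (-1) => _ [n _ <-].
    by have [_ /(_ x Dx)/ler_normlP[]] := gX n; rewrite lerNl.
  - by move=> n; have [] := gX n.
(* The truncation ensures the bound 1 at every point of [D], as [unit_ball] demands, also where the
   sequence has no limit. *)
pose h x := Num.max (-1) (Num.min 1 (h0 x)).
have mh : measurable_fun D h.
  apply: measurable_maxr; first exact: measurable_cst.
  by apply: measurable_minr => //; exact: measurable_cst.
have hX : unit_ball h.
  split => // x Dx; rewrite ler_norml /h le_max lexx/= ge_max.
  by rewrite ge_min lexx/= andbT; lra.
have gh : {ae mu, forall x, D x -> g n x @[n --> \oo] --> h x}.
  apply: filterS cg => x /[swap] Dx /(_ Dx) cx.
  suff -> : h x = limn (fun n => g n x) by [].
  rewrite /h /h0 cvg_limn_supE//.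
  have : `|limn (fun n => g n x)| <= 1.
    have cn : `|g n x| @[n --> \oo] --> `|limn (fun n => g n x)| by exact: cvg_norm.
    apply: (closed_cvg (fun y : R => is_true (y <= 1)) _ _ _ cn).
      exact: closed_le.
    by apply: nearW => n; have [_ ->] := gX n.
  rewrite ler_norml => /andP[l1 l2].
  by rewrite (min_idPr _)// (max_idPr _).
have [_ _ cgh] := Lpn_dominated_cvg mD (lexx 1) (fun n => proj1 (gX n)) mh
  (Lpfun_cst mD Dfin 1 ltr01) gh (fun n x Dx => le_trans (proj2 (gX n) x Dx) (ler_norm _)).
have h1 := unit_ball_Lpfun ltr01 hX.
exists h => // n.
have gn m : Lpn 1 (g (n + m)%N \- g n) <= r n - r (n + m)%N.
  elim: m => [|m IHm].
    rewrite addn0 subrr (_ : _ \- _ = cst 0) ?(Lpfun0 mu D ltr01).2//.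
    by apply/funext => x /=; rewrite subrr.
  rewrite addnS; have [_] := LpfunD mD (lexx 1) (dg1 (n + m)%N) (LpfunB mD (lexx 1) (g1 (n + m)%N) (g1 n)).1.
  rewrite (_ : _ \+ _ = g (n + m).+1 \- g n); last first.
    by apply/funext => x /=; rewrite addrA subrK.
  move=> /le_trans; apply; have := lerD (gr (n + m)%N) IHm.
  by move=> /le_trans; apply; lra.
apply/ler_addgt0Pr => e e0.
have /cvgr0Pnorm_lt/(_ e e0)[K _ /(_ (n + K)%N (leq_addl _ _))] := cgh.
rewrite ger0_norm ?Lpn_ge0// => HK.
have [_] := LpfunD mD (lexx 1) (LpfunB mD (lexx 1) h1 (g1 (n + K)%N)).1
  (LpfunB mD (lexx 1) (g1 (n + K)%N) (g1 n)).1.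
rewrite (_ : _ \+ _ = h \- g n); last by apply/funext => x /=; rewrite addrA subrK.
move=> /le_trans; apply; rewrite addrC lerD//; last by rewrite LpnC ltW.
by rewrite (le_trans (gn K))// lerBlDr lerDl.
Qed.

(** The usual nested balls: if no [F j] contained a ball, one could shrink successively to closed
    balls, the one built at step [j] missing [F j]. The limit of the centres would lie in all of
    them and so in no [F j]. *)
Lemma unit_ball_Baire (F : nat -> set (T -> R)) :
  (forall g, unit_ball g -> exists j, F j g) ->
  (forall j g, unit_ball g -> (forall r, 0 < r -> exists g',
      [/\ unit_ball g', F j g' & Lpn 1 (g' \- g) < r]) -> F j g) ->
  exists j g0 r, [/\ unit_ball g0, 0 < r & forall g, unit_ball g ->
      Lpn 1 (g \- g0) < r -> F j g].
Proof.
move=> Fcover Fclosed; apply: contrapT => nF.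
pose S := {gr : (T -> R) * R | unit_ball gr.1 /\ 0 < gr.2}.
(* The centre moves by at most half the radius and the radius is at least halved, so the moves are
   bounded by [r n - r n.+1], as [unit_ball_complete] requires. *)
have step (j : nat) (s : S) : {s' : S |
    [/\ Lpn 1 ((sval s').1 \- (sval s).1) <= (sval s).2 / 2,
      (sval s').2 <= (sval s).2 / 2 &
      forall g, unit_ball g -> Lpn 1 (g \- (sval s').1) <= (sval s').2 -> ~ F j g]}.
  apply: cid; case: s => -[g r] [/= gX r0].
  have r20 : 0 < r / 2 by rewrite divr_gt0.
  have [g' [g'X gg' nFg']] : exists g', [/\ unit_ball g',
      Lpn 1 (g' \- g) < r / 2 & ~ F j g'].
    apply: contrapT => H; apply: nF; exists j, g, (r / 2); split => // g' g'X gg'.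
    by apply: contrapT => nFg'; apply: H; exists g'.
  have [t t0 Ht] : exists2 t, 0 < t & forall g'', unit_ball g'' ->
      Lpn 1 (g'' \- g') < t -> ~ F j g''.
    apply: contrapT => H; apply: nFg'; apply: Fclosed => // t t0.
    apply: contrapT => H'; apply: H; exists t => // g'' g''X gg'' Fg''.
    by apply: H'; exists g''.
  (* Half of [t], because [Ht] concerns an open ball and the construction uses closed ones. *)
  have m0 : 0 < Num.min (t / 2) (r / 2) by rewrite lt_min r20 andbT divr_gt0.
  exists (exist _ (g', Num.min (t / 2) (r / 2)) (conj g'X m0)); split => /=.
  - exact: ltW.
  - by rewrite ge_min lexx orbT.
  - move=> g'' g''X; rewrite le_min => /andP[g''t _]; apply: Ht => //.
    by rewrite (le_lt_trans g''t)// ltr_pdivrMr// mulr_natr mulr2n ltrDl.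
have X0 : unit_ball (cst 0).
  by split => [|x _]; [exact: measurable_cst|rewrite normr0].
pose s0 : S := exist _ (cst 0, 1) (conj X0 ltr01).
pose s := fix s n : S := if n is m.+1 then sval (step m (s m)) else s0.
have sX n : unit_ball (sval (s n)).1 by case: (svalP (s n)).
have [h hX hg] : exists2 h, unit_ball h &
    forall n, Lpn 1 (h \- (sval (s n)).1) <= (sval (s n)).2.
  apply: (unit_ball_complete sX) => n.
    have [sg sr _] := svalP (step n (s n)).
    by rewrite /= (le_trans sg)// lerBrDr (le_trans (lerD (lexx _) sr))// -splitr.
  by apply: ltW; case: (svalP (s n)).
have [j Fjh] := Fcover h hX.
have [_ _ /(_ h hX)] := svalP (step j (s j)).
(* The ball that avoids [F j] carries the index [j.+1]. *)
by apply => //; exact: (hg j.+1).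
Qed.

End Baire_ball.

(* Writes a small [b] of the unit ball as a difference [c - (c - b)] of two
   elements of the ball which are close to [a]. *)
Lemma clamp_shift (R : realDomainType) (a b : R) : `|a| <= 1 -> `|b| <= 1 ->
  let c := Num.min 1 (Num.max (-1) (a + b)) in
  [/\ `|c| <= 1, `|c - b| <= 1, `|c - a| <= `|b| & `|c - b - a| <= `|b|].
Proof.
rewrite /= !ler_norml => /andP[a1 a2] /andP[b1 b2].
have [ab|ab] := leP (-1) (a + b); last first.
  have b0 : b < 0 by lra.
  rewrite (@min_r _ _ 1 (-1)); last by lra.
  by rewrite (ltr0_norm b0); split; lra.
have [ab'|ab'] := leP 1 (a + b).
  have b0 : 0 <= b by lra.
  by rewrite (ger0_norm b0); split; lra.
have := ler_norm b; have := ler_norm (- b); rewrite normrN => nb1 nb2.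
by split; lra.
Qed.

(** * The closed graph argument *)

Section Saks.
Context d (T : measurableType d) (R : realType).
Variables (mu : {measure set T -> \bar R}) (D : set T).
Hypotheses (mD : measurable D) (Dfin : (mu D < +oo)%E).

Local Notation Lpfun := (Lpfun mu D).
Local Notation Lpn := (Lpn mu D).
Local Notation unit_ball := (unit_ball D).

(** [L] is required to be additive only inside the ball and after pairing with [Phi]: it will be a
    weak derivative of a chosen solution, which is determined only almost everywhere. The last
    hypothesis is the weak continuity that replaces the closed graph. *)
Lemma closed_graph_unit_ball (L : (T -> R) -> T -> R) (Phi : set (T -> R))
    (p q : R) (z : nat -> T -> R) : 1 < p -> 0 < q -> p^-1 + q^-1 = 1 ->
  (forall j, Lpfun p%:E (z j)) ->
  (forall f, Lpfun p%:E f -> forall e, 0 < e -> exists j, Lpn p (f \- z j) < e) ->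
  (forall phi, Phi phi -> Lpfun q%:E phi) ->
  (forall w, Lpfun q%:E w -> forall r, 0 < r ->
     exists2 phi, Phi phi & Lpn q (w \- phi) < r) ->
  (forall g, unit_ball g -> Lpfun p%:E (L g)) ->
  (forall g1 g2, unit_ball g1 -> unit_ball g2 -> unit_ball (g1 \- g2) ->
     forall phi, Phi phi -> \int[mu]_(x in D) (L (g1 \- g2) x * phi x) =
       \int[mu]_(x in D) (L g1 x * phi x) - \int[mu]_(x in D) (L g2 x * phi x)) ->
  (forall phi, Phi phi -> forall g, unit_ball g -> forall e, 0 < e ->
     exists2 r, 0 < r & forall g', unit_ball g' -> Lpn 1 (g' \- g) < r ->
       `|\int[mu]_(x in D) (L g' x * phi x) - \int[mu]_(x in D) (L g x * phi x)| <= e) ->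
  forall e, 0 < e -> exists2 r, 0 < r &
    forall h, unit_ball h -> Lpn 1 h < r -> Lpn p (L h) <= e.
Proof.
move=> p1 q0 pq zp zdense Phiq dPhi LLp Llin Lcont e e0.
have p0 : 0 < p by exact: lt_trans p1.
have e20 : 0 < e / 2 by rewrite divr_gt0.
pose I g phi := \int[mu]_(x in D) (L g x * phi x).
pose J j phi := \int[mu]_(x in D) (z j x * phi x).
(* [L g] is within [e / 2] of [z j], expressed by duality so that [F j] is closed *)
pose F j : set (T -> R) := [set g | forall phi, Phi phi ->
  `|I g phi - J j phi| <= e / 2 * Lpn q phi].
have [||j [g0 [r [g0X r0 Hr]]]] := @unit_ball_Baire _ _ _ mu D mD Dfin F.
- move=> g gX; have [j gj] := zdense _ (LLp g gX) _ e20.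
  exists j => phi Pphi; rewrite /I /J.
  have [i1 _] := Lpfun_hoelder mD p0 q0 pq (LLp g gX) (Phiq _ Pphi).
  have [i2 _] := Lpfun_hoelder mD p0 q0 pq (zp j) (Phiq _ Pphi).
  rewrite -RintegralB//; under eq_Rintegral do rewrite -mulrBl.
  have [Lz _] := LpfunB mD (ltW p1) (LLp g gX) (zp j).
  have [_ /le_trans] := Lpfun_hoelder mD p0 q0 pq Lz (Phiq _ Pphi); apply.
  by rewrite ler_wpM2r ?Lpn_ge0// ltW.
(* Closedness: for a fixed [phi], weak continuity transfers the inequality from nearby [g'] to
   [g]. *)
- move=> j g gX H phi Pphi; apply/ler_addgt0Pr => t t0.
  have [r r0 Hr] := Lcont phi Pphi g gX t t0.
  have [g' [g'X Fg' gg']] := H r r0.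
  rewrite (_ : I g phi - J j phi = (I g' phi - J j phi) - (I g' phi - I g phi)); last first.
    by lra.
  by rewrite (le_trans (ler_normB _ _))// lerD//; [exact: Fg'|exact: Hr].
exists r => // h hX hr.
have [mg0 g01] := g0X; have [mh h1] := hX.
pose g1 x := Num.min 1 (Num.max (-1) (g0 x + h x)).
pose g2 x := g1 x - h x.
have mg1 : measurable_fun D g1.
  apply: measurable_minr; first exact: measurable_cst.
  by apply: measurable_maxr; [exact: measurable_cst|exact: measurable_funD].
have bnd x : D x -> [/\ `|g1 x| <= 1, `|g2 x| <= 1, `|g1 x - g0 x| <= `|h x| &
    `|g2 x - g0 x| <= `|h x|].
  by move=> Dx; exact: clamp_shift (g01 x Dx) (h1 x Dx).
have g1X : unit_ball g1 by split => // x /bnd[].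
have g2X : unit_ball g2.
  by split => [|x /bnd[]//]; exact: measurable_funB.
have h1p := unit_ball_Lpfun mD Dfin ltr01 hX.
have g1r : Lpn 1 (g1 \- g0) < r.
  apply: le_lt_trans hr; apply: (proj2 (Lpn_le mD ltr01 _ h1p _)).
    exact: measurable_funB.
  by apply: aeW => x /bnd[].
have g2r : Lpn 1 (g2 \- g0) < r.
  apply: le_lt_trans hr; apply: (proj2 (Lpn_le mD ltr01 _ h1p _)).
    by apply: measurable_funB => //; exact: measurable_funB.
  by apply: aeW => x /bnd[].
have hE : h = g1 \- g2 by apply/funext => x /=; rewrite /g2 opprB addrC subrK.
apply: (Lpn_dual mD p1 q0 pq (ltW e0) Phiq dPhi (LLp h hX)) => phi Pphi.
rewrite {1}hE Llin -?hE//.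
(* [L g1] and [L g2] are both within e / 2 of the same [z j], so their difference is within [e] of
   0. *)
have := lerD (Hr g1 g1X g1r phi Pphi) (Hr g2 g2X g2r phi Pphi).
rewrite -mulrDl -splitr; apply: le_trans.
rewrite -/(I g1 phi) -/(I g2 phi).
rewrite (_ : I g1 phi - I g2 phi = (I g1 phi - J j phi) - (I g2 phi - J j phi)).
  exact: ler_normB.
by lra.
Qed.

End Saks.

(** * Borel sets and smooth functions on R^N *)

Section rV_borel.
Context {R : realType} {N : nat}.
Implicit Types (U : set 'rV[R]_N) (c : {ffun 'I_N -> rat * rat}).

Definition rbox c : set 'rV[R]_N :=
  [set x | forall i, ratr (c i).1 < x 0 i < ratr (c i).2].

Lemma rbox_measurable c : measurable (rbox c).
Proof.
have -> : rbox c = \bigcap_(i in [set: 'I_N])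
    (@rV_coord R N i @^-1` `]ratr (c i).1, ratr (c i).2[%classic).
  apply/seteqP; split => x /= H i; first by move=> _; rewrite /= in_itv/=; exact: H.
  by have := H i I; rewrite /= in_itv.
apply: fin_bigcap_measurable => // i _.
by rewrite -[X in measurable X]setTI; exact: measurable_rV_coord.
Qed.

Lemma rbox_setI_closed : setI_closed (range rbox).
Proof.
move=> _ _ [c1 _ <-] [c2 _ <-].
exists [ffun i => (Num.max (c1 i).1 (c2 i).1, Num.min (c1 i).2 (c2 i).2)] => //.
apply/seteqP; split => x /=.
  move=> H; split => i; have := H i; rewrite ffunE/= maxr_rat minr_rat;
    rewrite gt_max lt_min => /andP[/andP[? ?] /andP[? ?]]; exact/andP.
move=> [H1 H2] i; have /andP[a1 a2] := H1 i; have /andP[b1 b2] := H2 i.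
by rewrite ffunE/= maxr_rat minr_rat gt_max lt_min a1 a2 b1 b2.
Qed.

Definition cbox c : set 'rV[R]_N :=
  [set x | forall i, ratr (c i).1 <= x 0 i <= ratr (c i).2].

(** The closed box has to fit into [U] because the bump function of the open box has its support in
    the closed one. *)
Lemma rbox_nbhs U x : open U -> U x -> exists2 c, rbox c x & cbox c `<=` U.
Proof.
move=> oU Ux; have /nbhs_ballP[e /= e0 eU] : nbhs x U by exact: open_nbhs_nbhs.
have H i : exists q : rat * rat,
    [/\ x 0 i - e < ratr q.1, ratr q.1 < x 0 i, x 0 i < ratr q.2 & ratr q.2 < x 0 i + e].
  have [|q1 ] := @rat_in_itvoo R (x 0 i - e) (x 0 i).
    by rewrite ltrBlDr ltrDl.
  rewrite in_itv/= => /andP[a1 a2].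
  have [|q2] := @rat_in_itvoo R (x 0 i) (x 0 i + e); first by rewrite ltrDl.
  by rewrite in_itv/= => /andP[b1 b2]; exists (q1, q2).
pose c := [ffun i => projT1 (cid (H i))].
have cE i : [/\ x 0 i - e < ratr (c i).1, ratr (c i).1 < x 0 i,
    x 0 i < ratr (c i).2 & ratr (c i).2 < x 0 i + e].
  by rewrite ffunE; case: cid.
exists c; first by move=> i; have [_ -> ->] := cE i.
move=> y yc; apply: eU; split => // k i; rewrite (ord1 k).
have [a1 _ _ b2] := cE i; have /andP[y1 y2] := yc i.
by rewrite /ball/= ltr_norml; apply/andP; split; lra.
Qed.

Lemma open_bigcup_rbox U : open U -> U = \bigcup_(c in [set c | rbox c `<=` U]) rbox c.
Proof.
move=> oU; apply/seteqP; split => [x Ux|x [c cU]]; last exact: cU.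
have [c cx cU] := rbox_nbhs oU Ux; exists c => //= y yc; apply: cU => i.
by have /andP[/ltW -> /ltW ->] := yc i.
Qed.

(** An open set is a countable union of boxes. The sigma-algebra is arbitrary since the lemma serves
    both for [measurable] and for the one generated by the boxes. *)
Lemma measurable_open U (G : set (set 'rV[R]_N)) : sigma_algebra setT G ->
  (forall c, G (rbox c)) -> open U -> G U.
Proof.
move=> sG Gb oU; rewrite (open_bigcup_rbox oU).
have [G0 GC Gcup] := sG.
(* The union is reindexed by integers; codes of no box, or of a box not inside [U], contribute the
   empty set. *)
pose F (n : nat) : set 'rV[R]_N := if @unpickle {ffun 'I_N -> rat * rat} n is Some c then
  (if `[< rbox c `<=` U >] then rbox c else set0) else set0.
have -> : \bigcup_(c in [set c | rbox c `<=` U]) rbox c = \bigcup_n F n.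
  apply/seteqP; split => x.
    move=> [c /= cU xc]; exists (pickle c) => //.
    by rewrite /F pickleK; case: asboolP.
  move=> [n _]; rewrite /F; case: unpickle => // c.
  by case: asboolP => // cU xc; exists c.
apply: Gcup => n; rewrite /F; case: unpickle => // c.
by case: ifP.
Qed.

Lemma rV_open_measurable U : open U -> measurable U.
Proof.
apply: measurable_open; first exact: sigma_algebra_measurable.
exact: rbox_measurable.
Qed.

Lemma rV_continuous_measurable (f : 'rV[R]_N -> R) :
  continuous f -> measurable_fun [set: 'rV[R]_N] f.
Proof.
move=> /continuousP cf; apply: (measurability _ (RGenOpens.measurableE R)).
move=> _ [_ [a [b ->] <-]]; rewrite setTI.
by apply: rV_open_measurable; exact/cf/interval_open.
Qed.

(** Coordinates are measurable for the sigma-algebra of the boxes: they pull open intervals back to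
    open sets. *)
Lemma rV_measurable_generated : @measurable _ 'rV[R]_N = <<s range rbox>>.
Proof.
apply/seteqP; split; last first.
  apply: smallest_sub; first exact: sigma_algebra_measurable.
  by move=> _ [c _ <-]; exact: rbox_measurable.
apply: smallest_sub; first exact: smallest_sigma_algebra.
rewrite -bigcup_seq; apply: bigcup_sub => i _.
have mi : measurable_fun [set: g_sigma_algebraType (range rbox)]
    (@rV_coord R N i : g_sigma_algebraType (range rbox) -> R).
  apply: (measurability _ (RGenOpens.measurableE R)).
  move=> _ [_ [a [b ->] <-]]; rewrite setTI.
  apply: measurable_open.
  - exact: (smallest_sigma_algebra setT (range rbox)).
  - by move=> c; apply: sub_sigma_algebra; exists c.
  - have /continuousP := @coord_continuous R 1 N 0 i.
    by apply; exact: interval_open.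
by move=> A [Y mY <-]; exact: mi.
Qed.

End rV_borel.

Section rV_cube.
Context {R : realType}.

Definition rV_cube N (M : R) : set 'rV[R]_N := [set x | forall i, `|x 0 i| <= M].

Lemma rV_cube_measurable N M : measurable (@rV_cube N M).
Proof.
have -> : @rV_cube N M = \bigcap_(i in [set: 'I_N])
    (@rV_coord R N i @^-1` `[- M, M]%classic).
  apply/seteqP; split => x /= H i; first by move=> _; rewrite /= in_itv/= -ler_norml; exact: H.
  by have := H i I; rewrite /= in_itv/= -ler_norml.
apply: fin_bigcap_measurable => // i _.
by rewrite -[X in measurable X]setTI; exact: measurable_rV_coord.
Qed.

(** Induction along the definition of [lebesgue_rV]: through [rV_cons] the cube is an interval times
    a cube of lower dimension. *)
Lemma rV_cube_finite N (M : R) : (lebesgue_rV R N (rV_cube M) < +oo)%E.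
Proof.
elim: N => [|N IHN].
  by rewrite /= diracE ltry.
rewrite /= /lebesgue_rV_cons /pushforward.
rewrite (_ : _ @^-1` _ = `[- M, M]%classic `*` @rV_cube N M); last first.
  apply/seteqP; split => -[t v] /=.
    move=> H; split.
      by have := H ord0; rewrite /rV_cons mxE unlift_none /= in_itv/= -ler_norml.
    by move=> i; have := H (lift ord0 i); rewrite /rV_cons mxE liftK.
  move=> [tM vM] i; rewrite /rV_cons mxE; case: unliftP => [j _|_]; first exact: vM.
  by rewrite /= in_itv/= -ler_norml in tM.
rewrite product_measure1E; [|by []|exact: rV_cube_measurable].
apply: lte_mul_pinfty => //.
have H : (lebesgue_measure (`[- M, M]%classic%R : set R) < +oo)%E.
  by rewrite lebesgue_measure_itv/=; case: ifP => // _; rewrite -EFinD ltry.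
by rewrite ge0_fin_numE.
Qed.

Lemma rV_coord_le_norm N (x : 'rV[R]_N) i : `|x 0 i| <= `|x|.
Proof.
rewrite [leRHS]mx_normrE.
exact: (le_bigmax _ (fun ij : 'I_1 * 'I_N => `|x ij.1 ij.2|) (0, i)).
Qed.

Lemma bounded_subset_cube N (U : set 'rV[R]_N) : bounded_set U ->
  exists M, U `<=` rV_cube M.
Proof.
move=> [M [_ HM]]; exists (M + 1) => x Ux i.
have M1 : M < M + 1 by rewrite ltrDl.
exact: le_trans (rV_coord_le_norm x i) (HM _ M1 x Ux).
Qed.

End rV_cube.

(** * Smooth functions and the flat bump *)

Section smooth_functions.
Context {R : realType}.

(** Brings directional derivatives down to one real variable, where the chain rule and the
    fundamental theorem of calculus are applied. *)
Lemma is_derive_slice (V : normedModType R) (f : V -> R) (x v : V) (df : R) :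
  is_derive x v f df <-> is_derive (0 : R) (1 : R) (fun t : R => f (t *: v + x)) df.
Proof.
have E : (fun h : R => h^-1 *: ((f \o shift x) (h *: v) - f x)) =
    (fun h : R => h^-1 *: (((fun t : R => f (t *: v + x)) \o shift 0) (h *: 1) -
       (fun t : R => f (t *: v + x)) 0)).
  by apply/funext => h /=; rewrite scale0r add0r addr0 [_%:A]mulr1.
split=> -[H1 H2]; apply: DeriveDef.
- by rewrite /derivable -E.
- by rewrite -H2 /derive E.
- by rewrite /derivable E.
- by rewrite -H2 /derive -E.
Qed.

Lemma is_derive_comp (V : normedModType R) (h : R -> R) (f : V -> R) (x v : V)
    (dh df : R) : is_derive (f x) (1 : R) h dh -> is_derive x v f df ->
  is_derive x v (h \o f) (dh * df).
Proof.
move=> hd /is_derive_slice fd; apply/is_derive_slice.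
have hd' : is_derive ((fun t : R => f (t *: v + x)) 0) (1 : R) h dh.
  by rewrite /= scale0r add0r.
have := @is_derive1_comp _ h (fun t : R => f (t *: v + x)) 0 dh df hd' fd.
by [].
Qed.

(* [bump 0] is the usual flat function [exp (- 1 / t)]; the powers of [1 / t]
   make the family closed under differentiation. *)
Definition bump (k : nat) (t : R) : R :=
  if 0 < t then t^-1 ^+ k * expR (- t^-1) else 0.

Lemma bump_ge0 k t : 0 <= bump k t.
Proof.
rewrite /bump; case: ifP => // t0; rewrite mulr_ge0 ?expR_ge0//.
by rewrite exprn_ge0// invr_ge0 ltW.
Qed.

Lemma bump_gt0 k t : (0 < bump k t) = (0 < t).
Proof.
rewrite /bump; case: ifPn => t0; last by rewrite ltxx.
by rewrite mulr_gt0 ?expR_gt0// exprn_gt0// invr_gt0.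
Qed.

(** With m = k + 2, exp(1/t) is the m-th power of exp(1/(m t)), which is at least 1/(m t). The
    exponent m leaves a factor t^2, one more than needed for a zero derivative at 0. *)
Lemma bump_le_sqr k t : bump k t <= (k.+2%:R ^+ k.+2) * t ^+ 2.
Proof.
rewrite /bump; case: ifPn => [t0|_]; last by rewrite mulr_ge0 ?sqr_ge0.
have kt : k.+2%:R * t > 0 by rewrite mulr_gt0.
have : (k.+2%:R * t)^-1 ^+ k.+2 <= expR t^-1.
  have -> : t^-1 = k.+2%:R * (k.+2%:R * t)^-1 by rewrite invfM mulrA mulfV ?mul1r.
  rewrite expRM_natl lerXn2r ?nnegrE ?expR_ge0 ?invr_ge0 ?(ltW kt)//.
  by rewrite (le_trans _ (expR_ge1Dx _))// lerDr.
rewrite expRN exprVn => H.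
have : (expR t^-1)^-1 <= (k.+2%:R * t) ^+ k.+2.
  by rewrite invf_ple ?posrE ?expR_gt0 ?exprn_gt0.
move=> /(ler_wpM2l (x := t^-1 ^+ k)) => /(_ _) /le_trans; apply.
  by rewrite exprn_ge0// invr_ge0 ltW.
rewrite exprMn mulrCA ler_wpM2l ?exprn_ge0//.
by rewrite -(addn2 k) exprD mulrA -exprMn mulVf ?gt_eqF// expr1n mul1r.
Qed.

Lemma is_derive_bump k (t : R) :
  is_derive t (1 : R) (bump k) (bump k.+2 t - k%:R * bump k.+1 t).
Proof.
have [t0|t0|t0] := ltgtP t 0.
- have H : {near t, (cst 0 : R -> R) =1 bump k}.
    have : nbhs t [set x : R | x < 0] by apply: open_nbhs_nbhs; split => //; exact: open_lt.
    by apply: filterS => x /= x0; rewrite /bump ltNge ltW.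
  apply: (near_eq_is_derive H).
  apply: is_derive_eq; rewrite /bump !(ltNge 0) ltW//=; by rewrite mulr0 subrr.
- have H : {near t, (((@GRing.inv R) ^+ k) * (expR \o (- (@GRing.inv R))) : R -> R) =1 bump k}.
    have : nbhs t [set x : R | 0 < x] by apply: open_nbhs_nbhs; split => //; exact: open_gt.
    by apply: filterS => x /= x0; rewrite /bump x0 -[LHS]/((GRing.inv ^+ k) x * _) fctE.
  apply: (near_eq_is_derive H).
  have iV : is_derive t (1 : R) (@GRing.inv R) (- t ^- 2 *: 1).
    have tn : (fun y : R => y) t != 0 by rewrite gt_eqF.
    have dt : derivable (fun y : R => y) t (1 : R) by exact: derivable_id.
    apply: DeriveDef; first exact: (derivableV tn dt).
    by rewrite (deriveV tn dt) derive_id.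
  apply: is_derive_eq.
  rewrite /bump t0 /= fctE.
  have tn0 : t != 0 by rewrite gt_eqF.
  rewrite !scaler1; case: k {H} => [|k]; rewrite /GRing.scale/= ?expr0 ?exprS.
    by field.
  by field.
- subst t.
  (* By the quadratic bound the difference quotient at 0 is at most a constant times |h|. *)
  have C : ((fun h : R => h^-1 *: ((bump k \o shift 0) (h *: 1) - bump k 0))
      @ 0^' --> (0 : R)).
    apply/cvgr0Pnorm_le => e e0; near=> h.
    rewrite /= addr0 [_%:A]mulr1 {2}/bump ltxx subr0 normrZ (ger0_norm (bump_ge0 _ _)).
    apply: (@le_trans _ _ (`|h^-1| * (k.+2%:R ^+ k.+2 * h ^+ 2))).
      by rewrite ler_wpM2l// bump_le_sqr.
    rewrite -[h ^+ 2]real_normK ?num_real// normfV mulrCA expr2 mulKf//; last first.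
      by rewrite normr_eq0; near: h; exact: nbhs_dnbhs_neq.
    rewrite mulrC -ler_pdivlMr ?exprn_gt0//.
    by near: h; apply: dnbhs0_le; rewrite divr_gt0// exprn_gt0.
  apply: DeriveDef; first by apply/cvg_ex; exists 0.
  by rewrite /derive (cvg_lim _ C)// /bump ltxx mulr0 subrr.
Unshelve. all: by end_near.
Qed.

Context {N : nat}.
Implicit Types (phi psi : 'rV[R]_N -> R).

Lemma is_derive_coord (i j : 'I_N) (x : 'rV[R]_N) :
  is_derive x (delta_mx 0 j : 'rV[R]_N) (fun y : 'rV[R]_N => y 0 i) (i == j)%:R.
Proof.
apply/is_derive_slice.
rewrite (_ : (fun t : R => _) = (fun t : R => t * (i == j)%:R + x 0 i)); last first.
  by apply/funext => t; rewrite !mxE eqxx.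
rewrite (_ : (fun t : R => _) = ((i == j)%:R \*: @id R) + cst (x 0 i)); last first.
  by apply/funext => t /=; rewrite fctE /= mulrC.
by apply: is_derive_eq; rewrite addr0 [_ *: _]mulr1.
Qed.

Lemma smoothP phi : smooth phi <-> continuous phi /\
  forall i, (forall x, derivable phi x (delta_mx 0 i)) /\ smooth (partial i phi).
Proof.
split=> [sphi|[cphi dphi] s].
  split; first by have [] := sphi [::].
  move=> i; split; first by have [_ /(_ i)] := sphi [::].
  by move=> s; have := sphi (rcons s i); rewrite foldr_rcons.
case/lastP: s => [|s i]; last first.
  by rewrite foldr_rcons; have [_ /(_ s)] := dphi i.
by split => // i x; have [] := dphi i.
Qed.

(** A coinduction principle: if a class of continuous functions contains the partial derivatives of
    its members, it contains all the iterated ones that [smooth] asks for. *)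
Lemma smooth_coind (K : set ('rV[R]_N -> R)) :
  (forall phi, K phi -> continuous phi /\ forall i,
    exists2 psi, K psi & forall x, is_derive x (delta_mx 0 i : 'rV[R]_N) phi (psi x)) ->
  forall phi, K phi -> smooth phi.
Proof.
move=> HK phi Kphi s.
have pK psi i : K psi -> K (partial i psi) /\
    forall x, derivable psi x (delta_mx 0 i).
  move=> /HK[_ /(_ i)[chi Kchi dchi]]; split.
    rewrite (_ : partial i psi = chi)//.
    by apply/funext => x; have [_] := dchi x.
  by move=> x; have [] := dchi x.
have Ks : K (foldr partial phi s).
  by elim: s => [//|i s IHs] /=; have [] := pK _ i IHs.
split; first by have [] := HK _ Ks.
by move=> i x; have [_] := pK _ i Ks; exact.
Qed.

(* A class of functions closed under partial derivatives, so that smoothness of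
   its members follows from [smooth_coind]. *)
Inductive smooth_gen : ('rV[R]_N -> R) -> Prop :=
| SG_base phi of smooth phi : smooth_gen phi
| SG_cst c : smooth_gen (cst c)
| SG_coord i : smooth_gen (fun x => x 0 i)
| SG_bump k phi of smooth_gen phi : smooth_gen (bump k \o phi)
| SG_add phi psi of smooth_gen phi & smooth_gen psi : smooth_gen (phi + psi)
| SG_mul phi psi of smooth_gen phi & smooth_gen psi : smooth_gen (phi * psi)
| SG_exp phi of smooth_gen phi : smooth_gen (expR \o phi).

Lemma smooth_gen_smooth phi : smooth_gen phi -> smooth phi.
Proof.
apply: (smooth_coind (K := smooth_gen)) => {}phi; elim => {phi}.
- move=> phi /smoothP[cphi dphi]; split => // i.
  have [di si] := dphi i; exists (partial i phi); first exact: SG_base.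
  by move=> x; apply: derivableP.
- move=> c; split; first exact: cst_continuous.
  by move=> i; exists (cst 0) => [|x]; [exact: SG_cst|exact: is_derive_cst].
- move=> i; split; first exact: coord_continuous.
  move=> j; exists (cst (i == j)%:R); first exact: SG_cst.
  by move=> x; exact: is_derive_coord.
- move=> k phi gphi [cphi dphi]; split.
    move=> x; apply: continuous_comp; first exact: cphi.
    apply/differentiable_continuous/derivable1_diffP.
    by have [] := is_derive_bump k (phi x).
  move=> i; have [psi gpsi dpsi] := dphi i.
  exists (((bump k.+2 \o phi) + (cst (- k%:R) * (bump k.+1 \o phi))) * psi).
    apply: SG_mul => //; apply: SG_add; first exact: SG_bump.
    by apply: SG_mul; [exact: SG_cst|exact: SG_bump].
  move=> x; rewrite !fctE mulNr; apply: is_derive_comp => //.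
  exact: is_derive_bump.
- move=> phi psi gphi [cphi dphi] gpsi [cpsi dpsi]; split.
    by move=> x; apply: continuousD; [exact: cphi|exact: cpsi].
  move=> i; have [phi' g1 d1] := dphi i; have [psi' g2 d2] := dpsi i.
  exists (phi' + psi'); first exact: SG_add.
  by move=> x; rewrite fctE; exact: is_deriveD.
- move=> phi psi gphi [cphi dphi] gpsi [cpsi dpsi]; split.
    by move=> x; apply: continuousM; [exact: cphi|exact: cpsi].
  move=> i; have [phi' g1 d1] := dphi i; have [psi' g2 d2] := dpsi i.
  exists (phi * psi' + psi * phi').
    by apply: SG_add; exact: SG_mul.
  by move=> x; rewrite !fctE; exact: is_deriveM.
- move=> phi gphi [cphi dphi]; split.
    by move=> x; apply: continuous_comp; [exact: cphi|exact: continuous_expR].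
  move=> i; have [psi g d] := dphi i.
  exists ((expR \o phi) * psi).
    by apply: SG_mul => //; exact: SG_exp.
  by move=> x; rewrite fctE; apply: is_derive_comp => //; exact: is_derive_expR.
Qed.

Lemma smoothD phi psi : smooth phi -> smooth psi -> smooth (phi \+ psi).
Proof. by move=> ? ?; apply: smooth_gen_smooth; apply: SG_add; exact: SG_base. Qed.

Lemma smoothM phi psi : smooth phi -> smooth psi -> smooth (phi \* psi).
Proof. by move=> ? ?; apply: smooth_gen_smooth; apply: SG_mul; exact: SG_base. Qed.

Lemma smooth_cst (c : R) : @smooth R N (cst c).
Proof. exact/smooth_gen_smooth/SG_cst. Qed.

Lemma smooth_coord (i : 'I_N) : @smooth R N (fun x => x 0 i).
Proof. exact/smooth_gen_smooth/SG_coord. Qed.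

Lemma smooth_partial i phi : smooth phi -> smooth (partial i phi).
Proof. by move=> /smoothP[_ /(_ i)[]]. Qed.

Lemma smooth_is_derive i phi x : smooth phi ->
  is_derive x (delta_mx 0 i : 'rV[R]_N) phi (partial i phi x).
Proof. by move=> /smoothP[_ /(_ i)[d _]]; exact: derivableP. Qed.

Lemma partialM i phi psi : smooth phi -> smooth psi ->
  partial i (phi \* psi) = (phi \* partial i psi) \+ (psi \* partial i phi).
Proof.
move=> sphi spsi; apply/funext => x.
have [_ //] := is_deriveM (smooth_is_derive i x sphi) (smooth_is_derive i x spsi).
Qed.

End smooth_functions.

Lemma integrable_bounded_support d (T : measurableType d) (R : realType)
    (mu : {measure set T -> \bar R}) (A : set T) (g : T -> R) (C : R) :
  measurable A -> (mu A < +oo)%E -> measurable_fun setT g ->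
  (forall x, `|g x| <= C) -> (forall x, ~ A x -> g x = 0) ->
  mu.-integrable setT (EFin \o g).
Proof.
move=> mA Afin mg gC gA.
have gE : g = g \_ A.
  apply/funext => x; rewrite /patch; have [xA|xA] := pselect (A x).
    by rewrite mem_set.
  by rewrite memNset// gA.
rewrite gE -restrict_EFin; apply/(integrable_mkcond _ mA).
apply: measurable_bounded_integrable => //; first exact: measurable_funTS.
exists C; split; first exact: num_real.
by move=> M CM x _ /=; rewrite (le_trans (gC x))// ltW.
Qed.

(** * Vanishing integrals of partial derivatives *)

Section integral_partial.
Context {R : realType}.

(** Stated coordinate by coordinate, so that it passes to the slices of [phi] along [rV_cons]. *)
Definition box_support N (M : R) (phi : 'rV[R]_N -> R) :=
  forall x : 'rV[R]_N, (exists i, M < `|x 0 i|) -> phi x = 0.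

Local Notation cube N M := (@rV_cube R N M).

Lemma box_support_out N (M : R) (phi : 'rV[R]_N -> R) x :
  box_support M phi -> ~ cube N M x -> phi x = 0.
Proof.
move=> bphi /existsNP[i /negP]; rewrite -ltNge => Mx.
by apply: bphi; exists i.
Qed.

Lemma rV_cube_bounded N (M : R) (phi : 'rV[R]_N -> R) : continuous phi ->
  exists2 C, 0 <= C & forall x, rV_cube M x -> `|phi x| <= C.
Proof.
move=> cphi.
have cc : compact (cube N M).
  have -> : cube N M = [set v : 'rV[R]_N | forall i, (`[- M, M]%classic : set R) (v ord0 i)].
    by apply/seteqP; split => x /= H i; have := H i; rewrite /= in_itv/= -ler_norml.
  by apply: (@rV_compact R N (fun=> `[- M, M]%classic)) => i; exact: segment_compact.
have [C [_ HC]] : bounded_set (phi @` cube N M).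
  apply: compact_bounded; apply: continuous_compact => //.
  exact: continuous_subspaceT.
exists (Num.max 0 (C + 1)) => [|x cx]; first by rewrite le_max lexx.
rewrite le_max; apply/orP; right; have C1 : C < C + 1 by rewrite ltrDl.
by apply: (HC (C + 1) C1 (phi x)); exists x.
Qed.

Lemma box_support_bounded N (M : R) (phi : 'rV[R]_N -> R) :
  continuous phi -> box_support M phi -> exists C, forall x, `|phi x| <= C.
Proof.
move=> cphi bphi; have [C C0 HC] := rV_cube_bounded M cphi.
exists C => x; have [cx|ncx] := pselect (cube N M x); first exact: HC.
by rewrite (box_support_out bphi ncx) normr0.
Qed.

Lemma box_support_partial N (M : R) (phi : 'rV[R]_N -> R) i :
  box_support M phi -> box_support M (partial i phi).
Proof.
move=> bphi x [j Mxj]; rewrite /partial.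
have H : {near x, phi =1 cst 0}.
  have : nbhs x [set y : 'rV[R]_N | M < `|y 0 j|].
    apply: open_nbhs_nbhs; split => //.
    apply: (@open_comp _ _ (fun y : 'rV[R]_N => `|y 0 j|) [set t | M < t]).
      move=> y _; apply: (@continuous_comp _ _ _ (fun y : 'rV[R]_N => y 0 j)).
        exact: coord_continuous.
      exact: norm_continuous.
    exact: open_gt.
  by apply: filterS => y Mj; apply: bphi; exists j.
rewrite (near_eq_derive _ H) derive_cst//.
Qed.

Lemma rV_cons_continuous N t : continuous (fun v : 'rV[R]_N => rV_cons (t, v)).
Proof.
move=> v A /nbhs_ballP[e /= e0 eA]; apply/nbhs_ballP; exists e => // w [_ vw].
apply: eA; split => // k i; rewrite /rV_cons !mxE.
by case: unliftP => [j _|_] /=; [exact: vw|exact: ballxx].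
Qed.

Lemma rV_cons_split N t s (v w : 'rV[R]_N) :
  rV_cons (s + t, w + v) = rV_cons (s, w) + rV_cons (t, v).
Proof. by apply/rowP => i; rewrite !mxE; case: unliftP => //= j _; rewrite mxE. Qed.

Lemma rV_cons_scale_head N (s : R) :
  rV_cons (s, 0 : 'rV[R]_N) = s *: delta_mx 0 ord0.
Proof.
apply/rowP => i; rewrite !mxE eqxx; case: unliftP => [j ->|->]/=.
  by rewrite mxE ?andbF mulr0.
by rewrite mulr1.
Qed.

Lemma rV_cons_scale_tail N (s : R) (j : 'I_N) :
  rV_cons (0, s *: delta_mx 0 j : 'rV[R]_N) = s *: delta_mx 0 (lift ord0 j).
Proof.
apply/rowP => i; rewrite !mxE eqxx; case: unliftP => [k ->|->]/=.
  by rewrite !mxE eqxx (inj_eq lift_inj).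
by rewrite ?(negbTE (neq_lift _ _)) mulr0.
Qed.

Lemma integral_derive1_eq0 (h h' : R -> R) (M : R) :
  continuous h' -> (forall t, is_derive t (1 : R) h (h' t)) ->
  (forall t, M < `|t| -> h t = 0) -> (forall t, M < `|t| -> h' t = 0) ->
  (\int[lebesgue_measure]_t (h' t)%:E = 0)%E.
Proof.
move=> ch' dh h0 h'0.
(* Larger than [M] and positive even if [M] is negative. *)
pose a : R := `|M| + 1.
have Ma : M < `|a|.
  by rewrite /a ger0_norm ?addr_ge0// ltr_pwDr// ler_norm.
have -> : (\int[lebesgue_measure]_t (h' t)%:E =
    \int[lebesgue_measure]_(t in `[(- a)%R, a]) (h' t)%:E)%E.
  rewrite [RHS]integral_mkcond; apply: eq_integral => t _.
  rewrite /patch mem_setE in_itv/= -ler_norml; case: ifPn => //.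
  rewrite -ltNge => at_.
  rewrite h'0// (le_lt_trans _ at_)// /a (le_trans (ler_norm M))// lerDl//.
have dc t : {for t, continuous h}.
  by apply/differentiable_continuous/derivable1_diffP; have [] := dh t.
rewrite (@continuous_FTC2 _ h' h).
- by rewrite !h0 ?subee// normrN.
- by rewrite /a; have := normr_ge0 M; lra.
- exact: continuous_subspaceT.
- split; first by move=> t _; have [] := dh t.
  + exact: cvg_at_right_filter (dc _).
  + exact: cvg_at_left_filter (dc _).
- by move=> t _; rewrite derive1E; have [_] := dh t.
Qed.

(** Fubini on R x R^N. If [i] is a tail coordinate, the inner integral over R^N vanishes by
    induction applied to the slice; if it is the head, the inner integral over R vanishes by the
    fundamental theorem of calculus. *)
Lemma integral_partial_eq0 N (M : R) (phi : 'rV[R]_N -> R) (i : 'I_N) :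
  (forall x, derivable phi x (delta_mx 0 i)) ->
  continuous (partial i phi) -> box_support M phi ->
  (\int[lebesgue_rV R N]_x (partial i phi x)%:E = 0)%E.
Proof.
elim: N phi i => [|N IHN] phi i dphi cphi' bphi; first by have := ltn_ord i.
pose g := partial i phi.
have bg : box_support M g by exact: box_support_partial.
have [C gC] := box_support_bounded cphi' bg.
have mg : measurable_fun setT g by exact: rV_continuous_measurable.
have mcons : measurable_fun setT (@rV_cons R N) .
  by have := @measurable_rV_cons R N.
have mgc : measurable_fun [set: (measurableTypeR R * 'rV[R]_N)%type]
    (g \o @rV_cons R N : measurableTypeR R * 'rV[R]_N -> R).
  exact: measurableT_comp mg mcons.
pose P : {measure set (measurableTypeR R * 'rV[R]_N)%type -> \bar R} := (@lebesgue_measure R \x lebesgue_rV R N)%E.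
have Ig : P.-integrable setT (EFin \o (g \o @rV_cons R N)).
  have mA : measurable (@rV_cons R N @^-1` cube N.+1 M).
    by rewrite -[X in measurable X]setTI; apply: mcons => //; exact: rV_cube_measurable.
  have Afin : (P (@rV_cons R N @^-1` cube N.+1 M) < +oo)%E.
    exact: (@rV_cube_finite R N.+1 M).
  apply: (@integrable_bounded_support _ _ _ P _ _ C mA Afin mgc) => x.
    exact: gC.
  exact: box_support_out.
have -> : (\int[lebesgue_rV R N.+1]_x (partial i phi x)%:E =
    \int[P]_z (g (rV_cons z))%:E)%E.
  have := @integral_pushforward _ _ (measurableTypeR R * 'rV[R]_N)%type 'rV[R]_N.+1 R
    (@rV_cons R N) mcons P setT (EFin \o g).
  by rewrite preimage_setT => -> //; exact/measurable_EFinP.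
have dslice t v : is_derive (rV_cons (t, v)) (delta_mx 0 i : 'rV[R]_N.+1) phi (g (rV_cons (t, v))).
  exact: derivableP.
case: (unliftP ord0 i) => [j|] ij.
- rewrite -(integral12_prod_meas1 Ig) (eq_integral (cst 0%E)) ?integral0// => t _.
  pose psi v := phi (rV_cons (t, v)).
  have dpsi v : is_derive v (delta_mx 0 j : 'rV[R]_N) psi (g (rV_cons (t, v))).
    apply/is_derive_slice; have /is_derive_slice := dslice t v.
    congr (is_derive _ _ _ _); apply/funext => s; rewrite /psi ij.
    by rewrite -rV_cons_scale_tail -rV_cons_split add0r.
  have pE : partial j psi = fun v => g (rV_cons (t, v)).
    by apply/funext => v; have [_] := dpsi v.
  rewrite /fubini_F /= -(IHN psi j).
  + by apply: eq_integral => v _; rewrite pE.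
  + by move=> v; have [] := dpsi v.
  + rewrite pE => v; apply: (@continuous_comp _ _ _ (fun v => rV_cons (t, v)) g).
      exact: rV_cons_continuous.
    exact: cphi'.
  + move=> v [k Mk]; apply: bphi; exists (lift ord0 k).
    by rewrite /rV_cons mxE liftK.
- rewrite -(integral21_prod_meas1 Ig) (eq_integral (cst 0%E)) ?integral0// => v _.
  rewrite /fubini_G /=.
  have cE (t s : R) : rV_cons (s + t, v) = s *: delta_mx 0 i + rV_cons (t, v).
    by rewrite ij -rV_cons_scale_head -rV_cons_split add0r.
  apply: (@integral_derive1_eq0 (fun t => phi (rV_cons (t, v))) _ M).
  + move=> t; apply: (@continuous_comp _ _ _ (fun t => rV_cons (t, v)) g); last exact: cphi'.
    rewrite (_ : (fun t => _) = (fun t => t *: delta_mx 0 i + rV_cons (0, v))); last first.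
      by apply/funext => s; rewrite -cE addr0.
    apply: continuousD; last exact: cst_continuous.
    exact: scalel_continuous.
  + move=> t; apply/is_derive_slice; have /is_derive_slice := dslice t v.
    congr (is_derive _ _ _ _); apply/funext => s.
    by rewrite -cE [_%:A]mulr1.
  + move=> t Mt; apply: bphi; exists ord0.
    by rewrite /rV_cons mxE unlift_none.
  + move=> t Mt; apply: bg; exists ord0.
    by rewrite /rV_cons mxE unlift_none.
Qed.

End integral_partial.

(** * Test functions: density and the fundamental lemma *)

Section test_functions.
Context {R : realType} {N : nat}.
Variable Omega : set 'rV[R]_N.
Implicit Types (phi psi : 'rV[R]_N -> R).

Lemma test_fun_sub phi psi : smooth psi -> test_fun Omega phi ->
  [set x | psi x != 0] `<=` closure [set x | phi x != 0] -> test_fun Omega psi.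
Proof.
move=> spsi [_ cphi sO] sub.
have sub' : closure [set x | psi x != 0] `<=` closure [set x | phi x != 0].
  have /closure_id -> := @closed_closure _ [set x | phi x != 0].
  exact: closureS.
split => //; last exact: subset_trans sO.
apply: subclosed_compact sub' => //; exact: closed_closure.
Qed.

Lemma test_fun_smooth phi : test_fun Omega phi -> smooth phi.
Proof. by case. Qed.

Lemma test_fun_continuous phi : test_fun Omega phi -> continuous phi.
Proof. by case=> /smoothP[]. Qed.

Lemma test_funM phi psi : smooth phi -> test_fun Omega psi ->
  test_fun Omega (phi \* psi).
Proof.
move=> sphi tpsi; apply: (test_fun_sub _ tpsi).
  by apply: smoothM; [exact: sphi|exact: test_fun_smooth tpsi].
move=> x /= H; apply: subset_closure => /=.
by apply: contraNneq H => ->; rewrite mulr0.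
Qed.

Lemma test_funZ c phi : test_fun Omega phi -> test_fun Omega (fun x => c * phi x).
Proof. by move=> /(test_funM (smooth_cst c)). Qed.

Lemma test_funD phi psi : test_fun Omega phi -> test_fun Omega psi ->
  test_fun Omega (phi \+ psi).
Proof.
move=> [sphi cphi phiO] [spsi cpsi psiO].
have sub : [set x | (phi \+ psi) x != 0] `<=` [set x | phi x != 0] `|` [set x | psi x != 0].
  move=> x /= H; apply: contrapT => /not_orP[/negP/negPn/eqP p0 /negP/negPn/eqP q0].
  by move: H; rewrite p0 q0 addr0 eqxx.
have sub' := closureS sub; rewrite closureU in sub'.
split; first exact: smoothD.
  by apply: subclosed_compact sub'; [exact: closed_closure|exact: compactU].
by move=> x /sub'[/phiO|/psiO].
Qed.

Lemma test_fun0 : test_fun Omega (cst 0).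
Proof.
have E : [set x : 'rV[R]_N | (cst 0 : 'rV[R]_N -> R) x != 0] = set0.
  by rewrite -subset0 => x /=; rewrite eqxx.
split; first exact: smooth_cst.
  by rewrite E closure0; exact: compact0.
by rewrite E closure0.
Qed.

Lemma partial_out phi i x : ~ closure [set x | phi x != 0] x -> partial i phi x = 0.
Proof.
move=> nx; rewrite /partial.
have H : {near x, phi =1 cst 0}.
  have : nbhs x (~` closure [set x | phi x != 0]).
    apply: open_nbhs_nbhs; split => //; apply: closed_openC; exact: closed_closure.
  apply: filterS => y ny; apply/eqP; apply: contrapT => /negP py.
  by apply: ny; exact: subset_closure.
by rewrite (near_eq_derive _ H) derive_cst.
Qed.

Lemma test_fun_partial phi i : test_fun Omega phi -> test_fun Omega (partial i phi).
Proof.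
move=> tphi; apply: (test_fun_sub _ tphi).
  by apply: smooth_partial; exact: test_fun_smooth tphi.
move=> x /= px; apply: contrapT => /(@partial_out _ i) p0.
by rewrite p0 eqxx in px.
Qed.

Lemma test_fun_mderive a phi : test_fun Omega phi -> test_fun Omega (mderive a phi).
Proof.
move=> tphi; rewrite /mderive; elim: (enum _) => [//|i s IHs] /=.
by elim: (a i) => [//|n IHn] /=; exact: test_fun_partial.
Qed.

Lemma test_fun_out phi x : test_fun Omega phi -> ~ Omega x -> phi x = 0.
Proof.
move=> [_ _ sO] nx; apply/eqP; apply: contrapT => /negP px; apply: nx.
by apply: sO; exact: subset_closure.
Qed.

Lemma test_fun_box_support phi : test_fun Omega phi ->
  exists M, box_support M phi.
Proof.
move=> [_ /compact_bounded[M [_ HM]] _]; exists (M + 1) => x [i Mx].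
apply/eqP; apply: contrapT => /negP px.
have M1 : M < M + 1 by rewrite ltrDl.
have cx : closure [set x | phi x != 0] x by exact: subset_closure.
have := HM (M + 1) M1 x cx.
by move=> /(le_trans (rV_coord_le_norm x i)); rewrite leNgt Mx.
Qed.

Hypothesis oO : open Omega.

Lemma test_fun_integral_partial phi i : test_fun Omega phi ->
  \int[lebesgue_rV R N]_(x in Omega) (partial i phi x) = 0.
Proof.
move=> tphi; rewrite /Rintegral integral_mkcond.
have [M bM] := test_fun_box_support tphi.
rewrite -[RHS]/(fine 0%E) -(@integral_partial_eq0 R N M phi i) //.
- congr fine; apply: eq_integral => x _; rewrite /patch.
  have [Ox|nOx] := pselect (Omega x); first by rewrite mem_set.
  by rewrite memNset// (test_fun_out (test_fun_partial i tphi) nOx).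
- by move=> x; have /smoothP[_ /(_ i)[]] := test_fun_smooth tphi.
- exact: test_fun_continuous (test_fun_partial i tphi).
Qed.

Hypothesis bO : bounded_set Omega.

Lemma continuous_bounded_domain phi : continuous phi ->
  exists2 C, 0 <= C & forall x, Omega x -> `|phi x| <= C.
Proof.
move=> cphi; have [M OM] := bounded_subset_cube bO.
have [C C0 HC] := rV_cube_bounded M cphi.
by exists C => // x /OM; exact: HC.
Qed.

Lemma domain_measurable : measurable Omega.
Proof. exact: rV_open_measurable. Qed.

Lemma domain_finite : (lebesgue_rV R N Omega < +oo)%E.
Proof.
have [M OM] := bounded_subset_cube bO; apply: le_lt_trans (rV_cube_finite N M).
by apply: le_measure OM; rewrite inE; [exact: domain_measurable|exact: rV_cube_measurable].
Qed.

Lemma continuous_Lp phi p : 0 < p -> continuous phi -> Lp Omega p%:E phi.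
Proof.
move=> p0 cphi; have [C C0 HC] := continuous_bounded_domain cphi.
apply: (Lpfun_bounded domain_measurable domain_finite p0 _ (aeW _ HC)).
by apply: measurable_funTS; exact: rV_continuous_measurable.
Qed.

(** A smooth function that is positive exactly on [rbox c]. *)
Definition boxbump (c : {ffun 'I_N -> rat * rat}) (x : 'rV[R]_N) : R :=
  \prod_i (bump 0 (x 0 i - ratr (c i).1) * bump 0 (ratr (c i).2 - x 0 i)).

Lemma boxbump_ge0 c x : 0 <= boxbump c x.
Proof. by apply: prodr_ge0 => i _; rewrite mulr_ge0// bump_ge0. Qed.

Lemma boxbump_gt0 c x : rbox c x -> 0 < boxbump c x.
Proof.
move=> cx; apply: prodr_gt0 => i _; have /andP[a b] := cx i.
by rewrite mulr_gt0// bump_gt0 subr_gt0.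
Qed.

Lemma boxbump_out c x : ~ rbox c x -> boxbump c x = 0.
Proof.
move=> /existsNP[i /negP]; rewrite negb_and -!leNgt => H.
rewrite /boxbump (bigD1 i)//=; case/orP: H => H.
  by rewrite {1}/bump subr_gt0 ltNge H !mul0r.
by rewrite {2}/bump subr_gt0 ltNge H mulr0 mul0r.
Qed.

Lemma boxbump_smooth c : smooth (boxbump c).
Proof.
rewrite /boxbump; elim: (index_enum _) => [|i s IHs].
  rewrite (_ : (fun x => _) = cst 1); first exact: smooth_cst.
  by apply/funext => x; rewrite big_nil.
rewrite (_ : (fun x => _) =
    (((bump 0 \o ((fun x : 'rV[R]_N => x 0 i) + cst (- ratr (c i).1))) *
     (bump 0 \o (cst (ratr (c i).2) + cst (-1) * (fun x : 'rV[R]_N => x 0 i)))) \*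
     (fun x => \prod_(j <- s) (bump 0 (x 0 j - ratr (c j).1) * bump 0 (ratr (c j).2 - x 0 j))))).
  apply: smoothM; last exact: IHs.
  apply: smooth_gen_smooth; apply: SG_mul; apply: SG_bump.
    by apply: SG_add; [exact: SG_coord|exact: SG_cst].
  by apply: SG_add; [exact: SG_cst|apply: SG_mul; [exact: SG_cst|exact: SG_coord]].
apply/funext => x; rewrite big_cons !fctE/=.
by congr (_ * bump 0 _ * _); rewrite mulN1r.
Qed.

Lemma boxbump_test c : cbox c `<=` Omega -> test_fun Omega (boxbump c).
Proof.
move=> cO.
have clc : closed (cbox c : set 'rV[R]_N).
  have -> : cbox c = \bigcap_(i in [set: 'I_N])
      ((fun y : 'rV[R]_N => y 0 i) @^-1` `[ratr (c i).1, ratr (c i).2]%classic).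
    apply/seteqP; split => x /= H i; first by move=> _; rewrite /= in_itv/=; exact: H.
    by have := H i I; rewrite /= in_itv.
  apply: closed_bigI => i _.
  apply: preimage_closed; first by move=> y _; exact: coord_continuous.
  exact: interval_closed.
have sub : closure [set x | boxbump c x != 0] `<=` cbox c.
  move/closure_id : clc => ->; apply: closureS => x /= bx i.
  have : rbox c x by apply: contrapT => /boxbump_out; move/eqP: bx.
  by move=> /(_ i)/andP[/ltW -> /ltW ->].
split; [exact: boxbump_smooth| |exact: subset_trans cO].
apply: subclosed_compact sub; first exact: closed_closure.
apply: bounded_closed_compact => //.
have [M [Mr HM]] := bO; exists M; split => // M' MM' x /cO.
exact: HM.
Qed.

(** The sum runs over the first [n] codes of boxes whose closed box lies in [Omega]. These test
    functions increase with [n] and are eventually positive at each point of [Omega], so they serve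
    as cut-offs. *)
Definition exhaust (n : nat) (x : 'rV[R]_N) : R := \sum_(k < n)
  if unpickle k is Some c then (if `[< cbox c `<=` Omega >] then boxbump c x else 0) else 0.

Lemma exhaust_test n : test_fun Omega (exhaust n).
Proof.
elim: n => [|n IHn].
  rewrite (_ : exhaust 0 = cst 0); first exact: test_fun0.
  by apply/funext => x; rewrite /exhaust big_ord0.
pose t x := if unpickle n is Some c then (if `[< cbox c `<=` Omega >] then boxbump c x else 0) else 0.
rewrite (_ : exhaust n.+1 = exhaust n \+ t); last first.
  by apply/funext => x; rewrite /exhaust big_ord_recr.
apply: test_funD => //; rewrite /t; case: unpickle => [c|]; last exact: test_fun0.
by case: asboolP => [cO|_]; [exact: boxbump_test|exact: test_fun0].
Qed.

Lemma exhaust_le m n x : (m <= n)%N -> exhaust m x <= exhaust n x.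
Proof.
move=> /subnKC <-; elim: (n - m)%N => [|k IHk]; first by rewrite addn0.
rewrite addnS; apply: le_trans IHk _.
rewrite /exhaust big_ord_recr/= lerDl; case: unpickle => // c.
by case: ifP => // _; exact: boxbump_ge0.
Qed.

Lemma exhaust_ge0 n x : 0 <= exhaust n x.
Proof. by rewrite (le_trans _ (exhaust_le x (leq0n n)))// /exhaust big_ord0. Qed.

Lemma exhaust_gt0 x : Omega x -> exists n, 0 < exhaust n x.
Proof.
move=> Ox; have [c cx cO] := rbox_nbhs oO Ox.
exists (pickle c).+1; rewrite /exhaust big_ord_recr/= ltr_wpDl//.
  exact: (exhaust_ge0 (pickle c)).
by rewrite pickleK asboolT//; exact: boxbump_gt0.
Qed.

(* [exhaust n] vanishes outside a compact subset of [Omega], so these functions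
   are test functions; they increase to the indicator of [0 < psi] on [Omega]. *)
Definition indic_approx psi n : 'rV[R]_N -> R :=
  cst 1 - (expR \o (cst (- n%:R) * (psi * exhaust n))).

Lemma indic_approxE psi n x :
  indic_approx psi n x = 1 - expR (- (n%:R * (psi x * exhaust n x))).
Proof. by rewrite /indic_approx !fctE mulNr. Qed.

Lemma indic_approx_test psi n : smooth psi -> test_fun Omega (indic_approx psi n).
Proof.
move=> spsi; apply: (test_fun_sub _ (exhaust_test n)).
  rewrite /indic_approx; apply: smooth_gen_smooth.
  rewrite (_ : cst 1 - _ = cst 1 + cst (-1) * (expR \o (cst (- n%:R) * (psi * exhaust n)))).
    apply: SG_add; first exact: SG_cst.
    apply: SG_mul; first exact: SG_cst.
    apply: SG_exp; apply: SG_mul; first exact: SG_cst.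
    apply: SG_mul; apply: SG_base; first exact: spsi.
    exact: test_fun_smooth (exhaust_test n).
  by apply/funext => x; rewrite !fctE mulN1r.
move=> x /= H; apply: subset_closure => /=; apply: contraNneq H => e0.
by rewrite indic_approxE e0 !mulr0 oppr0 expR0 subrr.
Qed.

Lemma indic_approx_le1 psi n x : (forall x, 0 <= psi x) -> `|indic_approx psi n x| <= 1.
Proof.
move=> psi0; rewrite indic_approxE.
have t0 : 0 <= n%:R * (psi x * exhaust n x) by rewrite !mulr_ge0// exhaust_ge0.
have e1 : expR (- (n%:R * (psi x * exhaust n x))) <= 1 by rewrite -[leRHS]expR0 ler_expR oppr_le0.
have e0 := expR_ge0 (- (n%:R * (psi x * exhaust n x))).
by rewrite ler_norml; apply/andP; split; lra.
Qed.

Lemma indic_approx_cvg psi x : (forall x, 0 <= psi x) -> Omega x ->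
  indic_approx psi n x @[n --> \oo] --> (\1_[set x | 0 < psi x] x : R).
Proof.
move=> psi0 Ox; rewrite indicE; have := psi0 x; rewrite le0r => /orP[/eqP p0|p0].
  rewrite memNset/=; last by rewrite p0 ltxx.
  rewrite (_ : (fun n => _) = cst 0); first exact: cvg_cst.
  by apply/funext => n; rewrite indic_approxE p0 mul0r mulr0 oppr0 expR0 subrr.
rewrite mem_set//=; have [m em] := exhaust_gt0 Ox.
pose s := psi x * exhaust m x; have s0 : 0 < s by rewrite mulr_gt0.
apply/cvgrPdist_le => e e0; near=> n.
rewrite indic_approxE opprB addrC subrK ger0_norm ?expR_ge0//.
(* From exp(n s) >= 1 + n s >= 1 / e it follows that exp(- n s) <= e. *)
have ns : (e * s)^-1 <= n%:R by near: n; exact: nbhs_infty_ger.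
have mn : (m <= n)%N by near: n; exact: nbhs_infty_ge.
apply: (@le_trans _ _ (expR (- (n%:R * s)))).
  by rewrite ler_expR lerN2 ler_wpM2l// ler_wpM2l ?exhaust_le// ltW.
rewrite expRN -[leRHS]invrK lef_pV2 ?posrE ?expR_gt0 ?invr_gt0//.
apply: le_trans (expR_ge1Dx _); rewrite ler_wpDl//.
by rewrite -ler_pdivrMr// -invfM.
Unshelve. all: by end_near. Qed.

Lemma box_approx (c : {ffun 'I_N -> rat * rat}) x : Omega x ->
  indic_approx (boxbump c) n x @[n --> \oo] --> (\1_(rbox c) x : R).
Proof.
move=> Ox; rewrite (_ : rbox c = [set x | 0 < boxbump c x]).
  by apply: indic_approx_cvg => // y; exact: boxbump_ge0.
apply/seteqP; split => y /=; first exact: boxbump_gt0.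
by move=> b0; apply: contrapT => /boxbump_out be; rewrite be ltxx in b0.
Qed.

Lemma one_approx x : Omega x -> indic_approx (cst 1) n x @[n --> \oo] --> (1 : R).
Proof.
move=> Ox; have := @indic_approx_cvg (cst 1) x (fun=> ler01) Ox.
by rewrite indicE mem_set//=.
Qed.

Lemma test_fun_Lp phi p : 0 < p -> test_fun Omega phi -> Lp Omega p%:E phi.
Proof. by move=> p0 /test_fun_continuous; exact: continuous_Lp. Qed.

Local Notation mu := (lebesgue_rV R N).
Let mO : measurable Omega := domain_measurable.
Let fO := domain_finite.

(** By [Lp_dense] only the constant 1 and the indicators of boxes have to be approximated, and on
    [Omega] both are bounded pointwise limits of test functions. *)
Lemma test_fun_dense p f : 1 <= p -> Lp Omega p%:E f ->
  forall e, 0 < e -> exists2 phi, test_fun Omega phi & Lpn mu Omega p (f \- phi) < e.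
Proof.
move=> p1 fp; have p0 : 0 < p by exact: lt_le_trans p1.
have tL phi : test_fun Omega phi -> Lpfun mu Omega p%:E phi by exact: test_fun_Lp.
have tcl phi : test_fun Omega phi -> Lpcl mu Omega p (test_fun Omega) phi.
  move=> tphi; split; first exact: tL.
  move=> e e0; exists phi => //; rewrite (_ : phi \- phi = cst 0).
    by have [_ ->] := Lpfun0 mu Omega p0.
  by apply/funext => x /=; rewrite subrr.
have one : Lpfun mu Omega p%:E (cst 1) by exact: Lpfun_cst.
have app (F : nat -> 'rV[R]_N -> R) (g : 'rV[R]_N -> R) : measurable_fun Omega g ->
    (forall n, test_fun Omega (F n)) -> (forall n x, `|F n x| <= 1) ->
    (forall x, Omega x -> F n x @[n --> \oo] --> g x) ->
    Lpcl mu Omega p (test_fun Omega) g.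
  move=> mg tF F1 cF; apply: (Lpcl_dominated mO p1 tL mg one cF).
    by move=> n x _; rewrite normr1.
  by move=> n; exact: tcl.
have VT : Lpcl mu Omega p (test_fun Omega) (cst 1).
  apply: (app (indic_approx (cst 1))).
  - exact: measurable_cst.
  - by move=> n; apply: indic_approx_test; exact: smooth_cst.
  - by move=> n x; apply: indic_approx_le1 => ?; exact: ler01.
  - exact: one_approx.
have VG A : range rbox A -> Lpcl mu Omega p (test_fun Omega) \1_A.
  move=> [c _ <-]; apply: (app (indic_approx (boxbump c))).
  - by apply: measurable_funTS; apply: measurable_indic; exact: rbox_measurable.
  - by move=> n; apply: indic_approx_test; exact: boxbump_smooth.
  - by move=> n x; apply: indic_approx_le1; exact: boxbump_ge0.
  - by move=> x; exact: box_approx.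
have VD v w : test_fun Omega v -> test_fun Omega w -> test_fun Omega (v \+ w).
  exact: test_funD.
have VZ (q : rat) v : test_fun Omega v -> test_fun Omega (fun x => ratr q * v x).
  exact: test_funZ.
by have [_] := Lp_dense mO fO p1 tL VD VZ rV_measurable_generated rbox_setI_closed VT VG fp.
Qed.

(** The fundamental lemma of the calculus of variations. Dominated convergence, with dominating
    function |v|, carries the orthogonality over to indicators of boxes, and Dynkin's theorem to all
    Borel sets. *)
Lemma integral_test_eq0 v : mu.-integrable Omega (EFin \o v) ->
  (forall phi, test_fun Omega phi -> \int[mu]_(x in Omega) (v x * phi x) = 0) ->
  {ae mu, forall x, Omega x -> v x = 0}.
Proof.
move=> iv Hv; have mv : measurable_fun Omega v.
  by have /integrableP[/measurable_EFinP] := iv.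
have vfin A : measurable A -> mu.-integrable Omega (fun x => (v x * \1_A x)%:E).
  move=> mA; apply: (le_integrable mO _ _ iv).
    apply/measurable_EFinP; apply: measurable_funM; first exact: mv.
    by apply: measurable_funTS; exact: measurable_indic.
  move=> x Ox /=; rewrite lee_fin normrM indicE; case: (_ \in _);
    by rewrite ?normr1 ?normr0 ?mulr1 ?mulr0.
have app (F : nat -> 'rV[R]_N -> R) (g : 'rV[R]_N -> R) : measurable_fun Omega g ->
    (forall n, measurable_fun Omega (F n)) -> (forall n x, Omega x -> `|F n x| <= 1) ->
    (forall x, Omega x -> F n x @[n --> \oo] --> g x) ->
    (forall n, (\int[mu]_(x in Omega) (v x * F n x)%:E = 0)%E) ->
    (\int[mu]_(x in Omega) (v x * g x)%:E = 0)%E.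
  move=> mg mF F1 cF F0.
  have h1 n : measurable_fun Omega (fun x => (v x * F n x)%:E).
    by apply/measurable_EFinP; apply: measurable_funM; [exact: mv|exact: mF].
  have h2 : measurable_fun Omega (fun x => (v x * g x)%:E).
    by apply/measurable_EFinP; apply: measurable_funM; [exact: mv|exact: mg].
  have h3 : {ae mu, forall x, Omega x ->
      (v x * F n x)%:E @[n --> \oo] --> (v x * g x)%:E}.
    apply: aeW => x Ox; apply: cvg_EFin; first exact: nearW.
    by apply: cvgM; [exact: cvg_cst|exact: cF].
  have h4 : {ae mu, forall x n, Omega x -> (`|(v x * F n x)%:E| <= (abse \o (EFin \o v)) x)%E}.
    by apply: aeW => x n Ox; rewrite lee_fin normrM ler_piMr// F1.
  have [_ _] := dominated_convergence mO h1 h2 h3 (integrable_abse iv) h4.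
  under eq_fun do rewrite F0.
  by move=> /(cvg_unique (@ereal_hausdorff R) (cvg_cst _)) <-.
have tz phi : test_fun Omega phi -> (\int[mu]_(x in Omega) (v x * phi x)%:E = 0)%E.
  move=> tphi; have [C C0 HC] := continuous_bounded_domain (test_fun_continuous tphi).
  have iphi : mu.-integrable Omega (fun x => (v x * phi x)%:E).
    have : mu.-integrable Omega (fun x => C%:E * (v x)%:E)%E by exact: integrableZl.
    apply: le_integrable => //.
      apply/measurable_EFinP; apply: measurable_funM => //.
      by apply: measurable_funTS; apply: rV_continuous_measurable; exact: test_fun_continuous tphi.
    move=> x Ox /=; rewrite lee_fin normrM [leRHS]normrM mulrC ler_wpM2r//.
    by rewrite (le_trans (HC x Ox))// ler_norm.
  by rewrite -[LHS]fineK ?integrable_fin_num//; have := Hv phi tphi; rewrite /Rintegral => ->.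
have tm phi : test_fun Omega phi -> measurable_fun Omega phi.
  move=> tphi; apply: measurable_funTS; apply: rV_continuous_measurable.
  exact: test_fun_continuous tphi.
have one : (\int[mu]_(x in Omega) (v x * 1)%:E = 0)%E.
  apply: (app (indic_approx (cst 1)) (cst 1)).
  - exact: measurable_cst.
  - by move=> n; apply: tm; apply: indic_approx_test; exact: smooth_cst.
  - by move=> n x _; apply: indic_approx_le1 => ?; exact: ler01.
  - exact: one_approx.
  - by move=> n; apply: tz; apply: indic_approx_test; exact: smooth_cst.
have H (A : set 'rV[R]_N) : measurable A -> (\int[mu]_(x in Omega) (v x * \1_A x)%:E = 0)%E.
  rewrite rV_measurable_generated; apply: (dynkin_induction
    (P := [set A | (\int[mu]_(x in Omega) (v x * \1_A x)%:E = 0)%E])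
    rV_measurable_generated rbox_setI_closed) => /=.
  - by rewrite indicT.
  - move=> _ [c _ <-] /=; apply: (app (indic_approx (boxbump c))).
    + by apply: measurable_funTS; apply: measurable_indic; exact: rbox_measurable.
    + by move=> n; apply: tm; apply: indic_approx_test; exact: boxbump_smooth.
    + by move=> n x _; apply: indic_approx_le1; exact: boxbump_ge0.
    + by move=> x; exact: box_approx.
    + by move=> n; apply: tz; apply: indic_approx_test; exact: boxbump_smooth.
  - move=> {}A mA A0.
    transitivity (\int[mu]_(x in Omega) ((v x * 1)%:E - (v x * \1_A x)%:E))%E.
      apply: eq_integral => x _; rewrite -EFinB -mulrBr !indicE in_setC.
      by case: (_ \in _); rewrite ?subrr ?subr0.
    rewrite integralB//.
    + by rewrite one A0 subee.
    + by under eq_fun do rewrite mulr1.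
    + exact: vfin.
  - move=> F mF tF F0.
    pose G n x : R := \sum_(k < n) \1_(F k) x.
    have G0 n x : ~ (\bigcup_k F k) x -> G n x = 0.
      move=> Fx; rewrite /G big1// => i _; rewrite indicE memNset// => Fix.
      by apply: Fx; exists i.
    have Gk n x k : F k x -> G n x = (k < n)%N%:R.
      move=> Fkx; have Fi i : i != k -> \1_(F i) x = 0 :> R.
        move=> ik; rewrite indicE memNset// => Fix; move/eqP: ik; apply.
        by apply: tF => //; exists x.
      have [kn|nk] := ltnP k n; rewrite /G.
        rewrite (bigD1 (Ordinal kn))//= indicE mem_set// big1 ?addr0// => i ik.
        exact: Fi.
      rewrite big1// => i _; apply: Fi; apply: contraTneq (ltn_ord i) => ->.
      by rewrite -leqNgt.
    apply: (app G).
    + by apply: measurable_funTS; apply: measurable_indic; exact: bigcup_measurable.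
    + move=> n; rewrite /G; apply: measurable_sum => k.
      by apply: measurable_funTS; exact: measurable_indic.
    + move=> n x _; have [[k _ Fkx]|Fx] := pselect ((\bigcup_k F k) x).
        by rewrite (Gk _ _ _ Fkx); case: (k < n)%N; rewrite ?normr1 ?normr0.
      by rewrite G0// normr0.
    + move=> x Ox; rewrite indicE; have [[k _ Fkx]|Fx] := pselect ((\bigcup_k F k) x).
        rewrite mem_set; last by exists k.
        by apply: cvg_near_cst; exists k.+1 => // n /= kn; rewrite (Gk _ _ _ Fkx) kn.
      by rewrite memNset//; apply: cvg_near_cst; apply: nearW => n; exact: G0.
    + move=> n; rewrite /G.
      under eq_integral do rewrite mulr_sumr -sumEFin.
      by rewrite integral_sum//= => [|k]; [rewrite big1// => k _; exact: F0|exact: vfin].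
have : ae_eq mu Omega (EFin \o v) (cst 0%E).
  apply: integral_ae_eq => // E EO mE.
  have := H E mE; rewrite integral0 => <-.
  rewrite integral_mkcond [RHS]integral_mkcond; apply: eq_integral => x _.
  rewrite /patch indicE; have [Ex|nEx] := boolP (x \in E).
    by rewrite mem_set ?mulr1//; apply: EO; rewrite inE in Ex.
  by rewrite mulr0; case: ifP.
by apply: filterS => x /= /[apply] -[].
Qed.

End test_functions.

(** * Weak derivatives and Sobolev spaces *)

(** Hoelder's inequality for |f|^p and 1 with the exponent q / p and its conjugate. The constant is
    mu(D)^(1/p - 1/q). *)
Lemma Lpn_embed d (T : measurableType d) (R : realType)
    (mu : {measure set T -> \bar R}) (D : set T) (p q : R) :
  measurable D -> (mu D < +oo)%E -> 1 <= p -> p < q ->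
  exists2 C, 0 <= C & forall f, Lpfun mu D q%:E f ->
    Lpfun mu D p%:E f /\ Lpn mu D p f <= C * Lpn mu D q f.
Proof.
move=> mD Dfin p1 pq.
have p0 : 0 < p by exact: lt_le_trans p1.
have q0 : 0 < q by exact: lt_trans pq.
pose r := q / p; pose r' := (1 - r^-1)^-1.
have r1 : 1 < r by rewrite /r ltr_pdivlMr// mul1r.
have r0 : 0 < r by exact: lt_trans r1.
have r'0 : 0 < r' by rewrite invr_gt0 subr_gt0 invf_lt1.
have rr' : r^-1 + r'^-1 = 1 by rewrite invrK subrKC.
have one := Lpfun_cst mD Dfin (1 : R) r'0.
pose c := Lpn mu D r' (cst 1).
have c0 : 0 <= c by exact: Lpn_ge0.
exists (c `^ p^-1); first exact: powR_ge0.
move=> f /[dup] fq /(LpfunP mu D _ q0)[mf If].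
pose F x := `|f x| `^ p.
have FE x : `|F x| `^ r = `|f x| `^ q.
  by rewrite ger0_norm ?powR_ge0// -powRrM /r mulrC divfK// gt_eqF.
have Fr : Lpfun mu D r%:E F.
  apply/LpfunP => //; split; first exact: measurable_powR_norm.
  by under eq_fun do rewrite FE.
have FrE : Lpn mu D r F = Lpn mu D q f `^ p.
  have : Lpn mu D r F `^ r = Lpn mu D q f `^ q.
    rewrite (Lpn_powR mD r0 Fr) (Lpn_powR mD q0 fq).
    by apply: eq_Rintegral => x _; rewrite FE.
  move=> /(congr1 (fun t => t `^ r^-1)).
  rewrite -!powRrM mulfV ?gt_eqF// powRr1 ?Lpn_ge0// => ->.
  by rewrite /r invf_div mulrC divfK// gt_eqF.
have [iF hF] := Lpfun_hoelder mD r0 r'0 rr' Fr one.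
have fp : Lpfun mu D p%:E f.
  apply/LpfunP => //; split => //.
  by move: iF; under eq_fun do rewrite /= mulr1.
split => //.
have : Lpn mu D p f `^ p <= Lpn mu D q f `^ p * c.
  rewrite (Lpn_powR mD p0 fp) -FrE; apply: le_trans hF.
  by rewrite (le_trans _ (ler_norm _))//; under [leRHS]eq_Rintegral do rewrite mulr1.
have pV0 : 0 <= p^-1 by rewrite invr_ge0 ltW.
move=> /(ge0_ler_powR pV0) H; have {H} := H (powR_ge0 _ _).
rewrite nnegrE mulr_ge0 ?powR_ge0// => /(_ isT).
by rewrite powRM ?powR_ge0// -!powRrM mulfV ?gt_eqF// !powRr1 ?Lpn_ge0// mulrC.
Qed.

Section weak_derivatives.
Context {R : realType} {N : nat}.
Variable Omega : set 'rV[R]_N.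
Hypotheses (oO : open Omega) (bO : bounded_set Omega).
Implicit Types (y z g h phi psi : 'rV[R]_N -> R) (a : 'I_N -> nat).

Local Notation mu := (lebesgue_rV R N).
Let mO : measurable Omega := domain_measurable oO.
Let fO : (mu Omega < +oo)%E := domain_finite oO bO.
Local Notation wd := (wderive Omega).
Local Notation nrm := (Lpn mu Omega).

Lemma Lp_Lp1 p g : 1 <= p -> Lp Omega p%:E g -> Lp Omega 1%:E g.
Proof.
rewrite le_eqVlt => /predU1P[<-//|p1] gp.
by have [C _ /(_ g gp)[]] := Lpn_embed mO fO (lexx 1) p1.
Qed.

Lemma compact_measurable (K : set 'rV[R]_N) : compact K -> measurable K.
Proof.
move=> cK; rewrite -[K]setCK; apply: measurableC; apply: rV_open_measurable.
apply: closed_openC; apply: compact_closed cK; exact: norm_hausdorff.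
Qed.

Lemma loc_integrableP g : loc_integrable Omega g <-> measurable_fun Omega g /\
  forall K, K `<=` Omega -> compact K -> mu.-integrable K (EFin \o g).
Proof.
split=> -[mg Hg]; split => // K KO cK.
  apply/integrableP; split; last exact: Hg.
  apply/measurable_EFinP; apply: measurable_funS mg => //.
by have /integrableP[] := Hg K KO cK.
Qed.

Lemma Lp_loc_integrable p g : 1 <= p -> Lp Omega p%:E g -> loc_integrable Omega g.
Proof.
move=> p1 /(Lp_Lp1 p1) /(Lp1_integrable mu mO) ig; apply/loc_integrableP; split.
  by have /integrableP[/measurable_EFinP] := ig.
move=> K KO cK; apply: integrableS ig => //; exact: compact_measurable.
Qed.

Lemma loc_integrable_lin (c d : R) g h : loc_integrable Omega g ->
  loc_integrable Omega h -> loc_integrable Omega (fun x => c * g x + d * h x).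
Proof.
move=> /loc_integrableP[mg ig] /loc_integrableP[mh ih]; apply/loc_integrableP; split.
  by apply: measurable_funD; apply: measurable_funM.
move=> K KO cK; have mK := compact_measurable cK.
have : mu.-integrable K ((fun x => c%:E * (g x)%:E) \+ (fun x => d%:E * (h x)%:E))%E.
  by apply: integrableD => //; apply: integrableZl => //; [exact: ig|exact: ih].
by apply: eq_integrable => // x _; rewrite /= EFinD !EFinM.
Qed.

Lemma loc_integrable_test g phi : loc_integrable Omega g -> test_fun Omega phi ->
  mu.-integrable Omega (EFin \o (fun x => g x * phi x)).
Proof.
move=> /loc_integrableP[mg ig] tphi; have [_ cK KO] := tphi.
set K := closure _ in cK KO; have mK := compact_measurable cK.
have mphi : measurable_fun setT phi.
  exact: rV_continuous_measurable (test_fun_continuous tphi).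
have [C C0 HC] := continuous_bounded_domain bO (test_fun_continuous tphi).
have iK : mu.-integrable K (EFin \o (fun x => g x * phi x)).
  apply: (le_integrable mK _ _ (integrableZl mK C (ig K KO cK))).
    apply/measurable_EFinP; apply: measurable_funM.
      exact: measurable_funS mg.
    exact: measurable_funTS.
  move=> x Kx /=; rewrite lee_fin normrM [leRHS]normrM mulrC ler_wpM2r//.
  by rewrite (le_trans (HC x (KO x Kx)))// ler_norm.
apply/(integrable_mkcond _ mO).
rewrite (_ : _ \_ Omega = (EFin \o (fun x => g x * phi x)) \_ K); last first.
  apply/funext => x; rewrite /patch.
  have [Kx|nKx] := pselect (K x); first by rewrite !mem_set//; exact: KO.
  have phi0 : phi x = 0.
    by apply/eqP; apply: contrapT => /negP px; apply: nKx; exact: subset_closure.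
  by rewrite (memNset nKx) /= phi0 mulr0; case: ifP.
exact/(integrable_mkcond _ mK).
Qed.

(** [g] and [g'] are only locally integrable, so the difference is multiplied by the cut-off
    [exhaust Omega n] before [integral_test_eq0] is applied. At each point of [Omega] some cut-off
    is nonzero. *)
Lemma wderive_unique a y g g' : is_wderive Omega a y g -> is_wderive Omega a y g' ->
  ae_in Omega [set x | g x = g' x].
Proof.
move=> [lg Hg] [lg' Hg'].
have H n : {ae mu, forall x, Omega x -> (g x - g' x) * exhaust Omega n x = 0}.
  have te := exhaust_test bO n.
  have ie := loc_integrable_test lg te; have ie' := loc_integrable_test lg' te.
  apply: (integral_test_eq0 oO bO).
    have := integrableB mO ie ie'; apply: eq_integrable => // x _.
    by rewrite /= -EFinB -mulrBl.
  move=> phi tphi; have tp := test_funM (test_fun_smooth te) tphi.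
  transitivity (\int[mu]_(x in Omega) (g x * (exhaust Omega n \* phi) x -
      g' x * (exhaust Omega n \* phi) x)).
    by apply: eq_Rintegral => x _; rewrite -mulrBl /= mulrA.
  rewrite RintegralB//; [|exact: loc_integrable_test|exact: loc_integrable_test].
  have := Hg _ tp; rewrite (Hg' _ tp) => /(congr1 (fun t => (-1) ^+ mlen a * t)).
  by rewrite !signrMK => ->; rewrite subrr.
have := ae_foralln H; apply: filterS => x Hx Ox /=.
have [n en] := exhaust_gt0 oO Ox; have /eqP := Hx n Ox.
by rewrite mulf_eq0 (gt_eqF en) orbF subr_eq0 => /eqP.
Qed.

Lemma is_wderive_lin a (c d : R) y z g h :
  loc_integrable Omega y -> loc_integrable Omega z ->
  is_wderive Omega a y g -> is_wderive Omega a z h ->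
  is_wderive Omega a (fun x => c * y x + d * z x) (fun x => c * g x + d * h x).
Proof.
move=> ly lz [lg Hg] [lh Hh]; split; first exact: loc_integrable_lin.
move=> phi tphi; have tm := test_fun_mderive a tphi.
have lin u v psi : loc_integrable Omega u -> loc_integrable Omega v ->
    test_fun Omega psi -> \int[mu]_(x in Omega) ((c * u x + d * v x) * psi x) =
    c * \int[mu]_(x in Omega) (u x * psi x) + d * \int[mu]_(x in Omega) (v x * psi x).
  move=> lu lv tpsi.
  have iu := loc_integrable_test lu tpsi; have iv := loc_integrable_test lv tpsi.
  transitivity (\int[mu]_(x in Omega) (c * (u x * psi x) + d * (v x * psi x))).
    by apply: eq_Rintegral => x _; rewrite mulrDl !mulrA.
  rewrite RintegralD//; last 2 first.
  - by apply: eq_integrable (integrableZl mO c iu) => // x _; rewrite /= EFinM.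
  - by apply: eq_integrable (integrableZl mO d iv) => // x _; rewrite /= EFinM.
  by rewrite !RintegralZl.
by rewrite !lin// Hg// Hh// mulrDr; congr (_ + _); rewrite mulrCA.
Qed.

Lemma is_wderive_ae a y y' g g' : is_wderive Omega a y g ->
  measurable_fun Omega y -> measurable_fun Omega y' -> measurable_fun Omega g' ->
  ae_in Omega [set x | y x = y' x] -> ae_in Omega [set x | g x = g' x] ->
  is_wderive Omega a y' g'.
Proof.
move=> [lg Hg] my my' mg' yy' gg'; have [mg lg'] := lg.
have me (u v phi : 'rV[R]_N -> R) : measurable_fun Omega u -> measurable_fun Omega v ->
    ae_in Omega [set x | u x = v x] -> test_fun Omega phi ->
    \int[mu]_(x in Omega) (u x * phi x) = \int[mu]_(x in Omega) (v x * phi x).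
  move=> mu_ mv uv tphi.
  have mphi : measurable_fun Omega phi.
    apply: measurable_funTS; exact: rV_continuous_measurable (test_fun_continuous tphi).
  apply: ae_eq_Rintegral => //; [exact: measurable_funM|exact: measurable_funM|].
  by move: uv; rewrite /ae_in; apply: filterS => x /[apply] /= ->.
split; last first.
  move=> phi tphi; rewrite -(me y y')//; last exact: test_fun_mderive.
  by rewrite -(me g g')//; exact: Hg.
split => // K KO cK; have mK := compact_measurable cK.
rewrite (_ : (\int[mu]_(x in K) _ = \int[mu]_(x in K) `|g x|%:E)%E); first exact: lg'.
apply: ge0_ae_eq_integral => //.
- by apply/measurable_EFinP/measurableT_comp => //; exact: measurable_funS mg'.
- by apply/measurable_EFinP/measurableT_comp => //; exact: measurable_funS mg.
- by move: gg'; rewrite /ae_in; apply: filterS => x gg' Kx; rewrite (gg' (KO x Kx)).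
Qed.

Lemma is_wderiveE a y g : is_wderive Omega a y g ->
  is_wderive Omega a y (wd a y) /\ ae_in Omega [set x | wd a y x = g x].
Proof.
move=> Hg; have Hw : is_wderive Omega a y (wd a y).
  by apply: (@xgetPex _ (fun=> 0) [set g | is_wderive Omega a y g]); exists g.
by split => //; exact: wderive_unique Hw Hg.
Qed.

Lemma mlen_munit (i : 'I_N) : mlen (munit i) = 1%N.
Proof.
rewrite /mlen (bigD1 i)//= /munit eqxx big1 ?addn0// => j ji.
by rewrite (negbTE ji).
Qed.

Lemma mlen_le1 a : (mlen a <= 1)%N -> a = (fun=> 0%N) \/ exists i, a = munit i.
Proof.
move=> a1; have [[i ai]|na] := pselect (exists i, a i != 0%N); last first.
  left; apply/funext => i; apply/eqP; apply: contrapT => /negP ai.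
  by apply: na; exists i.
right; exists i; apply/funext => j; rewrite /munit.
have H : (a i + \sum_(k < N | k != i) a k <= 1)%N.
  by move: a1; rewrite /mlen (bigD1 i).
have ai1 : a i = 1%N by move: ai H; case: (a i) => // -[|n].
have [->//|ji] := eqVneq j i.
move: H; rewrite ai1 -[leqRHS]addn0 leq_add2l (bigD1 j)//= leqn0 addn_eq0.
by move=> /andP[/eqP].
Qed.

Lemma mderive0 phi : mderive (fun=> 0%N) phi = phi.
Proof. by rewrite /mderive; elim: (enum _) => //= i s ->. Qed.

Lemma mderive_munit i phi : mderive (munit i) phi = partial i phi.
Proof.
rewrite /mderive.
have H s : uniq s -> foldr (fun j => iter (munit i j) (partial j)) phi s =
    if i \in s then partial i phi else phi.
  elim: s => [//|j s IHs] /= /andP[js us]; rewrite IHs// inE /munit.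
  by move: js; have [->|ji] := eqVneq j i => // /negbTE ->.
by rewrite H ?enum_uniq// mem_enum.
Qed.

Lemma continuous_loc_integrable phi : continuous phi -> loc_integrable Omega phi.
Proof. by move=> cphi; apply: (Lp_loc_integrable (lexx 1)); exact: continuous_Lp. Qed.

(** Integration by parts: the integral of a partial derivative of the test function [phi \* psi]
    vanishes. *)
Lemma is_wderive_smooth a phi : smooth phi -> (mlen a <= 1)%N ->
  is_wderive Omega a phi (mderive a phi).
Proof.
move=> sphi /mlen_le1[->|[i ->]].
  rewrite mderive0; split.
    by apply: continuous_loc_integrable; have /smoothP[] := sphi.
  move=> psi tpsi; rewrite mderive0 (_ : mlen _ = 0%N) ?expr0 ?mul1r//.
  by rewrite /mlen big1.
have cphi : continuous phi by have /smoothP[] := sphi.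
have cdphi : continuous (partial i phi).
  by have /smoothP[] := smooth_partial i sphi.
rewrite mderive_munit; split; first exact: continuous_loc_integrable.
move=> psi tpsi; rewrite mderive_munit mlen_munit expr1 mulN1r.
have := test_fun_integral_partial i (test_funM sphi tpsi).
rewrite partialM//; last exact: test_fun_smooth tpsi.
have i1 := loc_integrable_test (continuous_loc_integrable cphi) (test_fun_partial i tpsi).
have i2 := loc_integrable_test (continuous_loc_integrable cdphi) tpsi.
move=> H; have : \int[mu]_(x in Omega) (phi x * partial i psi x + partial i phi x * psi x) = 0.
  by rewrite -[RHS]H; apply: eq_Rintegral => x _ /=; rewrite (mulrC (psi x)).
by rewrite RintegralD// => /eqP; rewrite addr_eq0 => /eqP.
Qed.
End weak_derivatives.

(** * Poincare's inequality and the energy estimate *)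

Section sobolev_spaces.
Context {R : realType} {N : nat}.
Variable Omega : set 'rV[R]_N.
Hypotheses (oO : open Omega) (bO : bounded_set Omega).
Implicit Types (y z g h v w phi psi : 'rV[R]_N -> R) (a : 'I_N -> nat).

Local Notation mu := (lebesgue_rV R N).
Let mO : measurable Omega := domain_measurable oO.
Let fO : (mu Omega < +oo)%E := domain_finite oO bO.
Local Notation wd := (wderive Omega).
Local Notation nrm := (Lpn mu Omega).

Lemma Lp_lin p (c d : R) y z : 1 <= p -> Lp Omega p%:E y -> Lp Omega p%:E z ->
  Lp Omega p%:E (fun x => c * y x + d * z x) /\
  nrm p (fun x => c * y x + d * z x) <= `|c| * nrm p y + `|d| * nrm p z.
Proof.
move=> p1 yp zp; have p0 : 0 < p by exact: lt_le_trans p1.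
have [cy <-] := LpfunZ mO c p0 yp; have [dz <-] := LpfunZ mO d p0 zp.
exact: (LpfunD mO p1 cy dz).
Qed.

Lemma sobolev_wderive k p y a : 1 <= p -> sobolev Omega k p%:E y ->
  (mlen a <= k)%N -> is_wderive Omega a y (wd a y) /\ Lp Omega p%:E (wd a y).
Proof.
move=> p1 [_ Hy] ak; have [g yg gp] := Hy a ak.
have [yw wg] := is_wderiveE oO bO yg; split => //.
have mw : measurable_fun Omega (wd a y) by case: yw => -[].
have [|//] := @Lpn_ae _ _ _ mu Omega mO p g (wd a y) (lt_le_trans ltr01 p1) mw gp.
by move: wg; rewrite /ae_in; apply: filterS => x /[apply] /= ->.
Qed.

Lemma sobolev_loc_integrable k p y : 1 <= p -> sobolev Omega k p%:E y ->
  loc_integrable Omega y.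
Proof. by move=> p1 [yp _]; exact: (Lp_loc_integrable oO bO p1). Qed.

Lemma sobolev_lin k p (c d : R) y z : 1 <= p ->
  sobolev Omega k p%:E y -> sobolev Omega k p%:E z ->
  sobolev Omega k p%:E (fun x => c * y x + d * z x) /\
  forall a, (mlen a <= k)%N -> ae_in Omega
    [set x | wd a (fun x => c * y x + d * z x) x = c * wd a y x + d * wd a z x].
Proof.
move=> p1 sy sz.
have H a : (mlen a <= k)%N -> is_wderive Omega a (fun x => c * y x + d * z x)
      (fun x => c * wd a y x + d * wd a z x).
  move=> ak; have [dy _] := sobolev_wderive p1 sy ak.
  have [dz _] := sobolev_wderive p1 sz ak.
  exact: (is_wderive_lin oO bO c d (sobolev_loc_integrable p1 sy)
    (sobolev_loc_integrable p1 sz) dy dz).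
split; last by move=> a ak; have [] := is_wderiveE oO bO (H a ak).
split; first by have [] := Lp_lin c d p1 sy.1 sz.1.
move=> a ak; exists (fun x => c * wd a y x + d * wd a z x); first exact: H.
have [_ yp] := sobolev_wderive p1 sy ak; have [_ zp] := sobolev_wderive p1 sz ak.
by have [] := Lp_lin c d p1 yp zp.
Qed.

Lemma sobolev_ae k p y y' : 1 <= p -> measurable_fun Omega y' ->
  ae_in Omega [set x | y x = y' x] -> sobolev Omega k p%:E y ->
  sobolev Omega k p%:E y' /\
  forall a, (mlen a <= k)%N -> ae_in Omega [set x | wd a y x = wd a y' x].
Proof.
move=> p1 my' yy' sy; have my : measurable_fun Omega y by case: sy => -[].
have H a : (mlen a <= k)%N -> is_wderive Omega a y' (wd a y).
  move=> ak; have [yw _] := sobolev_wderive p1 sy ak.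
  have mw : measurable_fun Omega (wd a y) by case: yw => -[].
  by apply: (is_wderive_ae oO yw) => //; apply: aeW.
split; last first.
  move=> a ak; have [_] := is_wderiveE oO bO (H a ak).
  by rewrite /ae_in; apply: filterS => x /[apply] /= ->.
split.
  have [] := @Lpn_ae _ _ _ mu Omega mO p y y' (lt_le_trans ltr01 p1) my' sy.1 => //.
move=> a ak; exists (wd a y); first exact: H.
by have [] := sobolev_wderive p1 sy ak.
Qed.

Lemma sobolev_norm_le k p c y : 0 <= c ->
  (forall a, (mlen a <= k)%N -> Lp Omega p%:E (wd a y) /\ nrm p (wd a y) <= c) ->
  (sobolev_norm Omega k p%:E y <= (c *+ #|{ffun 'I_N -> 'I_k.+1}|)%:E)%E.
Proof.
move=> c0 H; rewrite /sobolev_norm.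
apply: (@le_trans _ _ (\sum_(a : {ffun 'I_N -> 'I_k.+1} | (mlen (fun i => a i) <= k)%N) c%:E)%E).
  apply: lee_sum => a ak; have [wp wc] := H _ ak.
  by rewrite /Lp_norm (Lpn_fineK wp) lee_fin.
by rewrite sumEFin lee_fin sumr_const ler_wpMn2l// max_card.
Qed.

Lemma Lp_norm_le_sobolev_norm k p y a : (mlen a <= k)%N ->
  (Lp_norm Omega p (wd a y) <= sobolev_norm Omega k p y)%E.
Proof.
move=> ak; pose f : {ffun 'I_N -> 'I_k.+1} := [ffun i => inord (a i)].
have fE : (fun i => f i : nat) = a.
  apply/funext => i; rewrite ffunE inordK// ltnS (leq_trans _ ak)//.
  by rewrite /mlen (bigD1 i)//= leq_addr.
rewrite /sobolev_norm (bigD1 f) /= fE//.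
rewrite leeDl// sume_ge0// => b _; exact: Lnorm_ge0.
Qed.

Lemma smooth_partial_lin (c d : R) i phi psi : smooth phi -> smooth psi ->
  partial i (fun x => c * phi x + d * psi x) =
  (fun x => c * partial i phi x + d * partial i psi x).
Proof.
move=> sphi spsi; apply/funext => x.
have [_ //] := is_deriveD (is_deriveZ c (smooth_is_derive i x sphi))
  (is_deriveZ d (smooth_is_derive i x spsi)).
Qed.

Lemma mderive_lin (c d : R) a phi psi : (mlen a <= 1)%N -> smooth phi -> smooth psi ->
  mderive a (fun x => c * phi x + d * psi x) =
  (fun x => c * mderive a phi x + d * mderive a psi x).
Proof.
move=> /mlen_le1[->|[i ->]] sphi spsi; first by rewrite !mderive0.
by rewrite !mderive_munit smooth_partial_lin.
Qed.

Lemma mderive_smooth a phi : (mlen a <= 1)%N -> smooth phi -> smooth (mderive a phi).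
Proof.
move=> /mlen_le1[->|[i ->]] sphi; first by rewrite mderive0; exact: sphi.
by rewrite mderive_munit; exact: smooth_partial.
Qed.

Lemma smooth_sobolev1 p phi : 1 <= p -> smooth phi -> sobolev Omega 1 p%:E phi.
Proof.
move=> p1 sphi; have p0 : 0 < p by exact: lt_le_trans p1.
have cp psi : smooth psi -> Lp Omega p%:E psi.
  by move=> /smoothP[cpsi _]; exact: continuous_Lp.
split; first exact: cp.
move=> a ak; exists (mderive a phi); first exact: is_wderive_smooth.
by apply: cp; exact: mderive_smooth.
Qed.

(** Replaces the weak derivatives of [phi], known only almost everywhere, by the classical ones, and
    the sum in [sobolev_norm] by one condition per multi-index. *)
Lemma H10P y : H10 Omega y <-> sobolev Omega 1 2%:E y /\
  forall e, 0 < e -> exists2 phi, test_fun Omega phi &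
    forall a, (mlen a <= 1)%N -> nrm 2 (wd a y \- mderive a phi) < e.
Proof.
have p1 : 1 <= 2 :> R by rewrite ler1n.
have p0 : 0 < 2 :> R by [].
have key phi a : sobolev Omega 1 2%:E y -> test_fun Omega phi -> (mlen a <= 1)%N ->
    Lp Omega 2%:E (wd a (y \- phi)) /\
    nrm 2 (wd a y \- mderive a phi) = nrm 2 (wd a (y \- phi)).
  move=> sy tphi ak; have sphi := smooth_sobolev1 p1 (test_fun_smooth tphi).
  have [syp /(_ a ak) wE] := sobolev_lin 1 (-1) p1 sy sphi.
  have E : (fun x => 1 * y x + -1 * phi x) = y \- phi.
    by apply/funext => x /=; rewrite mul1r mulN1r.
  rewrite E in syp wE.
  have [_ wp] := sobolev_wderive p1 syp ak; split => //.
  have [_ wy] := sobolev_wderive p1 sy ak.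
  have [_ wphiE] := is_wderiveE oO bO (is_wderive_smooth oO bO (test_fun_smooth tphi) ak).
  have mphi : Lp Omega 2%:E (mderive a phi).
    exact: (test_fun_Lp oO bO p0 (test_fun_mderive a tphi)).
  have [mm _] := LpfunB mO p1 wy mphi.
  apply: (proj2 (Lpn_ae mO p0 (proj1 mm) wp _)).
  move: wE wphiE; rewrite /ae_in; apply: filterS2 => x H1 H2 Ox.
  by rewrite (H1 Ox) (H2 Ox) mul1r mulN1r.
split=> -[sy Hy]; split => // e e0.
  have [phi tphi Hphi] := Hy e e0; exists phi => // a ak.
  have [wp ->] := key phi a sy tphi ak.
  rewrite -lte_fin -(Lpn_fineK wp).
  exact: le_lt_trans (Lp_norm_le_sobolev_norm _ _ ak) Hphi.
(* At most [K] terms occur in the norm; dividing by [K.+1] keeps the inequality strict. *)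
pose K := #|{ffun 'I_N -> 'I_2}|.
have e1 : 0 < e / K.+1%:R by rewrite divr_gt0.
have [phi tphi Hphi] := Hy _ e1; exists phi => //.
apply: (@le_lt_trans _ _ ((e / K.+1%:R) *+ K)%:E).
  apply: sobolev_norm_le; first exact: ltW.
  move=> a ak; have [wp <-] := key phi a sy tphi ak; split => //.
  by apply: ltW; exact: Hphi.
rewrite lte_fin -mulr_natr mulrAC ltr_pdivrMr// ltr_pM2l// ltr_nat.
exact: ltnSn.
Qed.

Lemma H10_sobolev y : H10 Omega y -> sobolev Omega 1 2%:E y.
Proof. by case. Qed.

Lemma H10_Lp y : H10 Omega y -> Lp Omega 2%:E y.
Proof. by case=> -[]. Qed.

Let p1 : 1 <= 2 :> R. Proof. by rewrite ler1n. Qed.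
Let p0 : 0 < 2 :> R. Proof. by []. Qed.

Lemma H10_wderive y a : (mlen a <= 1)%N -> H10 Omega y -> Lp Omega 2%:E (wd a y).
Proof. by move=> ak [sy _]; have [] := sobolev_wderive p1 sy ak. Qed.

Lemma H10_lin (c d : R) y z : H10 Omega y -> H10 Omega z ->
  H10 Omega (fun x => c * y x + d * z x).
Proof.
move=> Hy Hz; have [sy ay] := (H10P y).1 Hy; have [sz az] := (H10P z).1 Hz.
have [syz wyz] := sobolev_lin c d p1 sy sz.
apply/H10P; split; first exact: syz.
move=> e e0; pose C := `|c| + `|d| + 1.
have C0 : 0 < C by rewrite ltr_wpDl// addr_ge0.
have eC : 0 < e / C by rewrite divr_gt0.
have [phi tphi Hphi] := ay _ eC; have [psi tpsi Hpsi] := az _ eC.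
exists (fun x => c * phi x + d * psi x).
  by apply: (test_funD (test_funZ c tphi) (test_funZ d tpsi)).
move=> a ak; rewrite mderive_lin//; [|exact: test_fun_smooth tphi|exact: test_fun_smooth tpsi].
have wy := H10_wderive ak Hy; have wz := H10_wderive ak Hz.
have mphi := test_fun_Lp oO bO p0 (test_fun_mderive a tphi).
have mpsi := test_fun_Lp oO bO p0 (test_fun_mderive a tpsi).
have [d1 _] := LpfunB mO p1 wy mphi; have [d2 _] := LpfunB mO p1 wz mpsi.
have [l1 l2] := Lp_lin c d p1 d1 d2.
have [ml _] := Lp_lin c d p1 mphi mpsi.
have [_ wp] := sobolev_wderive p1 syz ak.
have [wm _] := LpfunB mO p1 wp ml.
rewrite (proj2 (Lpn_ae mO p0 (proj1 wm) l1 _)); last first.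
  move: (wyz a ak); rewrite /ae_in; apply: filterS => x /[apply] /= ->.
  by rewrite !mulrBr opprD addrACA.
apply: le_lt_trans l2 _.
apply: (@le_lt_trans _ _ (`|c| * (e / C) + `|d| * (e / C))).
  by rewrite lerD// ler_wpM2l// ltW//; [exact: Hphi|exact: Hpsi].
rewrite -mulrDl mulrC mulrAC ltr_pdivrMr// ltr_pM2l// /C ltrDl//.
Qed.

Lemma Lpn2_sqr f : Lp Omega 2%:E f -> nrm 2 f ^+ 2 = \int[mu]_(x in Omega) (f x * f x).
Proof.
move=> fp; rewrite -powR_mulrn ?Lpn_ge0// (Lpn_powR mO p0 fp).
by apply: eq_Rintegral => x _; rewrite powR_mulrn// real_normK ?num_real// expr2.
Qed.

Lemma hoelder2_integral f g : Lp Omega 2%:E f -> Lp Omega 2%:E g ->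
  mu.-integrable Omega (EFin \o (fun x => f x * g x)) /\
  `|\int[mu]_(x in Omega) (f x * g x)| <= nrm 2 f * nrm 2 g.
Proof.
by move=> fp gp; apply: (Lpfun_hoelder mO p0 p0 _ fp gp); rewrite [RHS]splitr !div1r.
Qed.

(** The integral over Omega of d_i(x_i phi^2) = phi^2 + 2 x_i phi d_i phi is zero. The
    Cauchy-Schwarz inequality and |x_i| <= M bound the second term. *)
Lemma test_fun_poincare i M phi : (forall x, Omega x -> `|x 0 i| <= M) -> 0 <= M ->
  test_fun Omega phi -> nrm 2 phi <= 2 * M * nrm 2 (partial i phi).
Proof.
move=> OM M0 tphi; have sphi := test_fun_smooth tphi.
have sc := @smooth_coord R N i.
have pc : partial i (fun x : 'rV[R]_N => x 0 i) = cst 1.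
  by apply/funext => x; have [_] := is_derive_coord i i x; rewrite eqxx.
have tdphi := test_fun_partial i tphi.
have phip := test_fun_Lp oO bO p0 tphi.
have dphip := test_fun_Lp oO bO p0 tdphi.
have cdphip : Lp Omega 2%:E (fun x => x 0 i * partial i phi x).
  exact: (test_fun_Lp oO bO p0 (test_funM sc tdphi)).
have [i1 _] := hoelder2_integral phip phip.
have [i2 h2] := hoelder2_integral phip cdphip.
have := test_fun_integral_partial i (test_funM sc (test_funM sphi tphi)).
rewrite (partialM i sc (smoothM sphi sphi)) (partialM i sphi sphi) pc => H.
have {}H : \int[mu]_(x in Omega) (phi x * phi x +
    2 * (phi x * (x 0 i * partial i phi x))) = 0.
  by rewrite -[RHS]H; apply: eq_Rintegral => x _ /=; ring.
rewrite RintegralD// in H; last first.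
  by apply: eq_integrable (integrableZl mO 2 i2) => // x _; rewrite /= EFinM.
rewrite RintegralZl// -Lpn2_sqr// in H.
have le1 : nrm 2 (fun x => x 0 i * partial i phi x) <= M * nrm 2 (partial i phi).
  have [Mdp] := LpfunZ mO M p0 dphip; rewrite ger0_norm// => <-.
  apply: (proj2 (Lpn_le mO p0 (proj1 cdphip) Mdp (aeW _ _))) => x Ox.
  by rewrite !normrM ler_wpM2r// (ger0_norm M0) OM.
have n0 : 0 <= nrm 2 phi by exact: Lpn_ge0.
have : nrm 2 phi ^+ 2 <= 2 * (nrm 2 phi * (M * nrm 2 (partial i phi))).
  have -> : nrm 2 phi ^+ 2 = - (2 * \int[mu]_(x in Omega) (phi x * (x 0 i * partial i phi x))).
    by apply/eqP; rewrite -addr_eq0 H.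
  rewrite -mulrN ler_pM2l// (le_trans (ler_norm _))// normrN (le_trans h2)//.
  by rewrite ler_wpM2l.
have [->|np] := eqVneq (nrm 2 phi) 0.
  by rewrite !mulr_ge0// Lpn_ge0.
have np0 : 0 < nrm 2 phi by rewrite lt0r np.
by rewrite expr2 mulrCA ler_pM2l// mulrA.
Qed.

Lemma H10_poincare i : exists2 C, 0 <= C &
  forall y, H10 Omega y -> nrm 2 y <= C * nrm 2 (wd (munit i) y).
Proof.
have [M OM] := bounded_subset_cube bO.
have OM' x : Omega x -> `|x 0 i| <= Num.max 0 M.
  by move=> /OM /(_ i) /le_trans; apply; rewrite le_max lexx orbT.
have M0 : 0 <= Num.max 0 M by rewrite le_max lexx.
set C := Num.max 0 M in OM' M0.
exists (2 * C); first by rewrite mulr_ge0.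
move=> y Hy; have [sy ay] := (H10P y).1 Hy.
have yp := H10_Lp Hy.
have m1 : (mlen (munit i) <= 1)%N by rewrite mlen_munit.
have m0 : (@mlen N (fun=> 0%N) <= 1)%N by rewrite /mlen big1.
have wy := H10_wderive m1 Hy.
apply/ler_addgt0Pr => e e0.
(* The error of approximation enters once through [y \- phi] and [2 * C] times through the
   derivative. *)
pose e' := e / (1 + 2 * C).
have C1 : 0 < 1 + 2 * C by rewrite ltr_pwDl// mulr_ge0.
have e'0 : 0 < e' by rewrite divr_gt0.
have [phi tphi Hphi] := ay _ e'0.
have phip := test_fun_Lp oO bO p0 tphi.
have dphip := test_fun_Lp oO bO p0 (test_fun_partial i tphi).
have h1 := Hphi _ m1; rewrite mderive_munit in h1.
have h0 : nrm 2 (y \- phi) < e'.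
  have := Hphi (fun=> 0%N) m0; rewrite mderive0.
  have [yphi _] := LpfunB mO p1 yp phip.
  have [_ w0] : is_wderive Omega (fun=> 0%N) y (wd (fun=> 0%N) y) /\
      ae_in Omega [set x | wd (fun=> 0%N) y x = y x].
    apply: (is_wderiveE oO bO); split.
      exact: sobolev_loc_integrable p1 sy.
    by move=> psi _; rewrite mderive0 /mlen big1// expr0 mul1r.
  have [wp _] := LpfunB mO p1 (H10_wderive m0 Hy) phip.
  rewrite (proj2 (Lpn_ae mO p0 (proj1 wp) yphi _))//.
  by move: w0; rewrite /ae_in; apply: filterS => x /[apply] /= ->.
have h2 := Lpn_tri mO p1 yp phip.
have h3 := test_fun_poincare OM' M0 tphi.
have h4 := Lpn_tri mO p1 dphip wy; rewrite LpnC in h4.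
have h5 : nrm 2 (partial i phi) <= nrm 2 (wd (munit i) y) + e'.
  by rewrite (le_trans h4)// lerD2l ltW.
rewrite (le_trans h2)//.
apply: (@le_trans _ _ (2 * C * (nrm 2 (wd (munit i) y) + e') + e')).
  rewrite lerD// ?(ltW h0)// (le_trans h3)// ler_wpM2l// mulr_ge0//.
rewrite mulrDr -addrA lerD2l -[X in _ + X]mul1r -mulrDl addrC /e'.
by rewrite mulrC divfK ?gt_eqF.
Qed.

Lemma integral_grad_dot y v : H10 Omega y -> H10 Omega v ->
  \int[mu]_(x in Omega) grad_dot Omega y v x =
  \sum_(i < N) \int[mu]_(x in Omega) (wd (munit i) y x * wd (munit i) v x).
Proof.
move=> Hy Hv.
have I i : mu.-integrable Omega (EFin \o (fun x => wd (munit i) y x * wd (munit i) v x)).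
  have m1 : (mlen (munit i) <= 1)%N by rewrite mlen_munit.
  by have [] := hoelder2_integral (H10_wderive m1 Hy) (H10_wderive m1 Hv).
rewrite /Rintegral /grad_dot.
under eq_integral do rewrite -sumEFin.
rewrite integral_sum//= (eq_bigr (fun i => (\int[mu]_(x in Omega)
    (wd (munit i) y x * wd (munit i) v x))%:E)) ?sumEFin// => i _.
by rewrite /Rintegral fineK//; exact: integrable_fin_num (I i).
Qed.

Lemma integral_grad_dot_lin (c d : R) y z v : H10 Omega y -> H10 Omega z -> H10 Omega v ->
  \int[mu]_(x in Omega) grad_dot Omega (fun x => c * y x + d * z x) v x =
  c * \int[mu]_(x in Omega) grad_dot Omega y v x +
  d * \int[mu]_(x in Omega) grad_dot Omega z v x.
Proof.
move=> Hy Hz Hv; rewrite (integral_grad_dot (H10_lin c d Hy Hz) Hv).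
rewrite (integral_grad_dot Hy Hv) (integral_grad_dot Hz Hv).
rewrite !mulr_sumr -big_split; apply: eq_bigr => i _ /=.
have m1 : (mlen (munit i) <= 1)%N by rewrite mlen_munit.
have wy := H10_wderive m1 Hy; have wz := H10_wderive m1 Hz.
have wv := H10_wderive m1 Hv; have wyz := H10_wderive m1 (H10_lin c d Hy Hz).
have [i1 _] := hoelder2_integral wy wv; have [i2 _] := hoelder2_integral wz wv.
have [l _] := Lp_lin c d p1 wy wz.
have [_ /(_ _ m1) wE] := sobolev_lin c d p1 (H10_sobolev Hy) (H10_sobolev Hz).
transitivity (\int[mu]_(x in Omega) ((c * wd (munit i) y x + d * wd (munit i) z x) *
    wd (munit i) v x)).
  apply: (ae_eq_Rintegral mO).
  - by apply: measurable_funM; [exact: wyz.1|exact: wv.1].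
  - by apply: measurable_funM; [exact: l.1|exact: wv.1].
  - by move: wE; rewrite /ae_in; apply: filterS => x /[apply] /= ->.
transitivity (\int[mu]_(x in Omega) (c * (wd (munit i) y x * wd (munit i) v x) +
    d * (wd (munit i) z x * wd (munit i) v x))).
  by apply: eq_Rintegral => x _; rewrite mulrDl !mulrA.
rewrite RintegralD// ?RintegralZl//.
- by apply: eq_integrable (integrableZl mO c i1) => // x _; rewrite /= EFinM.
- by apply: eq_integrable (integrableZl mO d i2) => // x _; rewrite /= EFinM.
Qed.

Definition poisson_solution g w := H10 Omega w /\ forall v, H10 Omega v ->
  \int[mu]_(x in Omega) grad_dot Omega w v x = \int[mu]_(x in Omega) (g x * v x).

Lemma poisson_solution_lin (c d : R) g h w z : Lp Omega 2%:E g -> Lp Omega 2%:E h ->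
  poisson_solution g w -> poisson_solution h z ->
  poisson_solution (fun x => c * g x + d * h x) (fun x => c * w x + d * z x).
Proof.
move=> gp hp [Hw ew] [Hz ez]; split; first exact: H10_lin.
move=> v Hv; rewrite integral_grad_dot_lin// ew// ez//.
have vp := H10_Lp Hv.
have [i1 _] := hoelder2_integral gp vp; have [i2 _] := hoelder2_integral hp vp.
transitivity (\int[mu]_(x in Omega) (c * (g x * v x) + d * (h x * v x))).
  rewrite RintegralD// ?RintegralZl//.
  - by apply: eq_integrable (integrableZl mO c i1) => // x _; rewrite /= EFinM.
  - by apply: eq_integrable (integrableZl mO d i2) => // x _; rewrite /= EFinM.
by apply: eq_Rintegral => x _; rewrite mulrDl !mulrA.
Qed.

Lemma poisson_solution_ae g g' w : measurable_fun Omega g -> measurable_fun Omega g' ->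
  ae_in Omega [set x | g x = g' x] -> poisson_solution g w -> poisson_solution g' w.
Proof.
move=> mg mg' gg' [Hw ew]; split => // v Hv; rewrite ew//.
have mv := (H10_Lp Hv).1.
apply: (ae_eq_Rintegral mO); [exact: measurable_funM|exact: measurable_funM|].
by move: gg'; rewrite /ae_in; apply: filterS => x /[apply] /= ->.
Qed.

(** Testing with w itself gives ||d_i w||^2 <= int g w <= ||g|| ||w||, and Poincare's inequality in
    direction [i] turns this into ||w||^2 <= C^2 ||g|| ||w||. *)
Lemma poisson_energy (i : 'I_N) : exists2 C, 0 <= C & forall g w, Lp Omega 2%:E g ->
  poisson_solution g w -> nrm 2 w <= C * nrm 2 g.
Proof.
have [C C0 HC] := H10_poincare i.
exists (C ^+ 2) => [|g w gp [Hw ew]]; first exact: sqr_ge0.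
have m1 j : (mlen (@munit N j) <= 1)%N by rewrite mlen_munit.
have wp := H10_Lp Hw; have [_ gw] := hoelder2_integral gp wp.
have dw : nrm 2 (wd (munit i) w) ^+ 2 <= nrm 2 g * nrm 2 w.
  rewrite (le_trans _ gw)// (le_trans _ (ler_norm _))// -ew// integral_grad_dot//.
  rewrite (bigD1 i)//= -Lpn2_sqr; last exact: H10_wderive.
  by rewrite lerDl sumr_ge0// => j _; rewrite -Lpn2_sqr ?sqr_ge0//; exact: H10_wderive.
have : nrm 2 w ^+ 2 <= C ^+ 2 * nrm 2 g * nrm 2 w.
  apply: (@le_trans _ _ ((C * nrm 2 (wd (munit i) w)) ^+ 2)).
    by rewrite lerXn2r ?nnegrE ?mulr_ge0 ?Lpn_ge0// HC.
  by rewrite exprMn -mulrA ler_wpM2l// sqr_ge0.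
have [->|nw] := eqVneq (nrm 2 w) 0.
  by rewrite mulr_ge0 ?sqr_ge0 ?Lpn_ge0.
have nw0 : 0 < nrm 2 w by rewrite lt0r nw Lpn_ge0.
by rewrite expr2 ler_pM2r.
Qed.

Lemma poisson_unique (i : 'I_N) g w w' : Lp Omega 2%:E g ->
  poisson_solution g w -> poisson_solution g w' ->
  ae_in Omega [set x | w x = w' x].
Proof.
move=> gp sw sw'; have [C C0 HC] := poisson_energy i.
have [l l2] := Lp_lin 1 (-1) p1 gp gp.
have sd := poisson_solution_lin 1 (-1) gp gp sw sw'.
have := HC _ _ l sd.
have -> : (fun x => 1 * g x + -1 * g x) = cst 0.
  by apply/funext => x; rewrite mul1r mulN1r subrr.
rewrite (Lpfun0 mu Omega p0).2 mulr0 => n0.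
have dp := H10_Lp sd.1.
have /(Lpn_eq0 mO p0 dp) : nrm 2 (fun x => 1 * w x + -1 * w' x) = 0.
  by apply/eqP; rewrite eq_le n0 Lpn_ge0.
rewrite /ae_in; apply: filterS => x /[apply] /=.
by rewrite mul1r mulN1r => /eqP; rewrite subr_eq0 => /eqP.
Qed.

End sobolev_spaces.

(** * The Poisson problem *)

(** Written as f (f^2)^(-1), the inverse becomes a real power of a nonnegative function; where f = 0
    both sides are 0. *)
Lemma measurable_funV d (T : measurableType d) (R : realType) (D : set T) (f : T -> R) :
  measurable_fun D f -> measurable_fun D (fun x => (f x)^-1).
Proof.
move=> mf; rewrite (_ : (fun x => _) = (fun x => f x * (f x ^+ 2) `^ (-1))).
  apply: measurable_funM => //; apply: (@measurableT_comp _ _ _ _ _ _ (@powR R ^~ (-1))).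
    exact: measurable_powR.
  exact: measurable_funX.
apply/funext => x; rewrite powR_inv1 ?sqr_ge0// expr2 invfM mulrA.
by have [->|fx] := eqVneq (f x) 0; [rewrite invr0 mulr0|rewrite mulfV// mul1r].
Qed.

Section poisson_regularity.
Context {R : realType} {N : nat}.
Variable Omega : set 'rV[R]_N.
Hypotheses (oO : open Omega) (bO : bounded_set Omega).
Hypothesis hwp : kirchhoff_wellposed Omega.
Implicit Types (y z g h v w phi psi f u b : 'rV[R]_N -> R) (a : 'I_N -> nat).

Local Notation mu := (lebesgue_rV R N).
Let mO : measurable Omega := domain_measurable oO.
Let fO : (mu Omega < +oo)%E := domain_finite oO bO.
Local Notation wd := (wderive Omega).
Local Notation nrm := (Lpn mu Omega).
Let p1 : 1 <= 2 :> R. Proof. by rewrite ler1n. Qed.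
Let p0 : 0 < 2 :> R. Proof. by []. Qed.

Lemma Linfty_bounded f M : measurable_fun Omega f ->
  ae_in Omega [set x | `|f x| <= M] -> Lp Omega +oo%E f.
Proof.
move=> mf fM; split => //; rewrite /Lp_norm unlock /Lnorm.
case: ifPn => // _; apply: (@le_lt_trans _ _ (Num.max 0 M)%:E); last exact: ltry.
apply/ess_supP; move: fM; rewrite /ae_in; apply: filterS => x fM /=.
rewrite lee_fin /patch; have [Ox|nOx] := pselect (Omega x).
  by rewrite mem_set// le_max (fM Ox) orbT.
by rewrite memNset// normr0 le_max lexx.
Qed.

Lemma Linfty_ae f : Lp Omega +oo%E f ->
  measurable_fun Omega f /\ exists2 M, 0 < M & ae_in Omega [set x | `|f x| <= M].
Proof.
move=> [mf]; rewrite /Lp_norm unlock /Lnorm; case: ifPn => [_|mu0 _]; last first.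
  (* On a space of measure 0 the L^oo norm is 0 by definition, and any bound holds almost
     everywhere. *)
  split => //; exists 1 => //; have mu0' : mu setT = 0%E.
    by apply/eqP; rewrite eq_le measure_ge0 andbT leNgt.
  exists setT; split => //.
move=> fM; split => //.
have [M HM] : exists M, \forall x \ae mu, (`|(f \_ Omega) x| <= M).
  by apply: (@ess_supr_bounded _ _ _ mu (fun x => `|(f \_ Omega) x|)).
exists (Num.max 1 M); first by rewrite lt_max ltr01.
rewrite /ae_in; apply: filterS HM => x; rewrite /patch => HM Ox /=.
by rewrite mem_set// in HM; rewrite le_max HM orbT.
Qed.

Lemma smooth_sobolev1_infty phi : smooth phi -> sobolev Omega 1 +oo%E phi.
Proof.
move=> sphi; have cp psi : smooth psi -> Lp Omega +oo%E psi.
  move=> /smoothP[cpsi _]; have [C C0 HC] := continuous_bounded_domain bO cpsi.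
  apply: (@Linfty_bounded _ C); last exact: aeW.
  by apply: measurable_funTS; exact: rV_continuous_measurable.
split; first exact: cp.
move=> a ak; exists (mderive a phi); first exact: is_wderive_smooth.
by apply: cp; exact: mderive_smooth.
Qed.

Lemma weak_solution_poisson f b u y : weak_solution Omega f b u y <->
  poisson_solution Omega (fun x => f x / (u x + b x * grad_sqnorm Omega y)) y.
Proof.
split=> -[Hy ey]; split => // v Hv; rewrite ey//;
  by apply: eq_Rintegral => x _; rewrite mulrAC.
Qed.

Lemma grad_sqnorm_ge0 y : H10 Omega y -> 0 <= grad_sqnorm Omega y.
Proof.
move=> Hy; rewrite /grad_sqnorm; apply: Rintegral_ge0 => x _.
by apply: sumr_ge0 => i _; rewrite -expr2 sqr_ge0.
Qed.

(* For [u = b = 1] and [f = g] the Kirchhoff equation is the Poisson equation for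
   [g / (1 + s)] with the constant [s = grad_sqnorm Omega y]. *)
Lemma poisson_exists_ge1 g M : measurable_fun Omega g ->
  (forall x, Omega x -> 1 <= g x <= M) ->
  exists w, poisson_solution Omega g w /\
    forall p : R, 1 <= p -> sobolev Omega 2 p%:E w.
Proof.
move=> mg gM.
have inf1 : Lp Omega +oo%E (cst 1).
  by apply: (@Linfty_bounded _ 1); [exact: measurable_cst|apply: aeW => x _ /=; rewrite normr1].
have adm : admissible_data Omega g (cst 1) (cst 1) (cst 1).
  split.
  - split; last by exists 1 => //; apply: aeW => x /gM/andP[].
    apply: (@Linfty_bounded _ M) => //; apply: aeW => x /gM/andP[g1 gM'] /=.
    by rewrite ger0_norm// (le_trans ler01).
  - exact/continuous_subspaceT/cst_continuous.
  - exact/continuous_subspaceT/cst_continuous.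
  - by exists 1 => // x _; rewrite lexx.
  - split; first exact/smooth_sobolev1_infty/smooth_cst.
    by exists 1 => //; apply: aeW => x _ /=.
have uad : Uad Omega (cst 1) (cst 1) (cst 1).
  by split => //; apply: aeW => x _ /=; rewrite lexx.
have [y [wy _ sy]] := hwp adm uad.
have Hy := wy.1; have /weak_solution_poisson py := wy.
set s := grad_sqnorm Omega y in py.
have s1 : 0 < 1 + s by rewrite ltr_pwDl// grad_sqnorm_ge0.
have gp : Lp Omega 2%:E (fun x => g x / (1 + s)).
  apply: (Lpfun_bounded mO fO (M := M) p0); first exact: measurable_funM.
  apply: aeW => x /gM/andP[g1 gM']; have M0 := le_trans (le_trans ler01 g1) gM'.
  rewrite normrM normfV (gtr0_norm s1) (ger0_norm (le_trans ler01 g1)).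
  by rewrite ler_pdivrMr// (le_trans gM')// ler_peMr// lerDl grad_sqnorm_ge0.
have py' : poisson_solution Omega (fun x => g x / (1 + s)) y.
  move: py; congr poisson_solution; apply/funext => x /=.
  by rewrite mul1r.
have := poisson_solution_lin oO bO (1 + s) 0 gp gp py' py'.
have -> : (fun x => (1 + s) * (g x / (1 + s)) + 0 * (g x / (1 + s))) = g.
  by apply/funext => x; rewrite mul0r addr0 mulrC divfK// gt_eqF.
move=> pg; exists (fun x => (1 + s) * y x + 0 * y x); split => // p pp1.
by have [] := sobolev_lin oO bO (1 + s) 0 pp1 (sy p pp1) (sy p pp1).
Qed.

(** Well-posedness requires a right-hand side with a positive lower bound. So [g] is the difference
    of g + (M + 1) >= 1 and a multiple of the constant [M'], which is at least 1 whatever the sign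
    of [M]. *)
Lemma poisson_exists g M : measurable_fun Omega g ->
  (forall x, Omega x -> `|g x| <= M) ->
  exists w, poisson_solution Omega g w /\
    forall p : R, 1 <= p -> sobolev Omega 2 p%:E w.
Proof.
move=> mg gM.
have m1 : measurable_fun Omega (fun x => g x + (M + 1)).
  by apply: measurable_funD => //; exact: measurable_cst.
have [|w1 [pw1 sw1]] := @poisson_exists_ge1 (fun x => g x + (M + 1)) (M + (M + 1)) m1.
  by move=> x /gM; rewrite ler_norml => /andP[a b]; apply/andP; split; lra.
pose M' := `|M| + 1.
have [|w2 [pw2 sw2]] := @poisson_exists_ge1 (cst M') M' (measurable_cst _).
  by move=> x _; rewrite lexx andbT lerDr.
have M'0 : M' != 0 by rewrite gt_eqF// ltr_wpDl.
have bd c : Lp Omega 2%:E (cst c) by exact: Lpfun_cst.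
have g1p : Lp Omega 2%:E (fun x => g x + (M + 1)).
  apply: (Lpfun_bounded mO fO (M := M + `|M + 1|) p0) => //; apply: aeW => x /gM gx.
  by rewrite (le_trans (ler_normD _ _))// lerD2r.
have := poisson_solution_lin oO bO 1 (- (M + 1) / M') g1p (bd _) pw1 pw2.
have -> : (fun x => 1 * (g x + (M + 1)) + - (M + 1) / M' * cst M' x) = g.
  by apply/funext => x /=; rewrite mul1r divfK// addrK.
move=> pg; exists (fun x => 1 * w1 x + - (M + 1) / M' * w2 x); split => // p pp1.
by have [] := sobolev_lin oO bO 1 (- (M + 1) / M') pp1 (sw1 p pp1) (sw2 p pp1).
Qed.

(** On bounded functions L^1 smallness forces L^2 smallness, which links the metric of the ball to
    the energy estimate. *)
Lemma unit_ball_Lpn2 (g : 'rV[R]_N -> R) C : 0 <= C -> measurable_fun Omega g ->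
  (forall x, Omega x -> `|g x| <= C) -> nrm 2 g ^+ 2 <= C * nrm 1 g.
Proof.
move=> C0 mg gC.
have g2 : Lp Omega 2%:E g by exact: (Lpfun_bounded mO fO p0 mg (aeW _ gC)).
have g1 : Lp Omega 1%:E g by exact: (Lpfun_bounded mO fO ltr01 mg (aeW _ gC)).
have i1 : mu.-integrable Omega (EFin \o (fun x => `|g x|)).
  exact: integrable_abse ((Lp1_integrable mu mO g).1 g1).
have [i2 _] := hoelder2_integral oO g2 g2.
rewrite Lpn2_sqr// Lpn1E// -RintegralZl//.
apply: le_Rintegral => //.
  by apply: eq_integrable (integrableZl mO C i1) => // x _; rewrite /= EFinM.
move=> x Ox; rewrite -expr2 -real_normK ?num_real// expr2.
by rewrite ler_wpM2r// gC.
Qed.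

Hypothesis i0 : 'I_N.

(** A solution is chosen for each [g] separately, so [T] is linear only up to equality almost
    everywhere. *)
Let poisson_map : exists T : ('rV[R]_N -> R) -> 'rV[R]_N -> R,
  forall g, unit_ball Omega g -> poisson_solution Omega g (T g) /\
    forall p : R, 1 <= p -> sobolev Omega 2 p%:E (T g).
Proof.
exists (fun g => xget (cst 0) [set w | poisson_solution Omega g w /\
    forall p : R, 1 <= p -> sobolev Omega 2 p%:E w]) => g [mg g1].
exact: (@xgetPex _ (cst 0) _ (poisson_exists mg g1)).
Qed.

Lemma bounded_subset_rbox : exists c, Omega `<=` rbox c.
Proof.
have [M OM] := bounded_subset_cube bO.
have [|q] := @rat_in_itvoo R M (M + 1); first by rewrite ltrDl.
rewrite in_itv/= => /andP[Mq _]; exists [ffun=> (- q, q)] => x /OM Mx i.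
rewrite ffunE /= rmorphN -ltr_norml; exact: le_lt_trans (Mx i) Mq.
Qed.

(** The hypotheses of the closed graph argument are checked in the form int D^a(T g) phi = (-1)^|a|
    int (T g) D^a phi, where only the L^2 bound on [T] and uniqueness are used. *)
Lemma poisson_unit_ball_continuous a (p : R) : (mlen a <= 2)%N -> 1 < p ->
  exists2 T : ('rV[R]_N -> R) -> 'rV[R]_N -> R,
    forall g, unit_ball Omega g -> poisson_solution Omega g (T g) /\
      forall p : R, 1 <= p -> sobolev Omega 2 p%:E (T g) &
    forall e, 0 < e -> exists2 r, 0 < r &
      forall h, unit_ball Omega h -> nrm 1 h < r -> nrm p (wd a (T h)) <= e.
Proof.
move=> ak pgt1; have [T TP] := poisson_map; exists T => //.
have pge1 := ltW pgt1; have pp0 : 0 < p by exact: lt_trans pgt1.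
pose q := (1 - p^-1)^-1.
have pV1 : p^-1 < 1 by rewrite invf_lt1.
have q0 : 0 < q by rewrite invr_gt0 subr_gt0.
have pq : p^-1 + q^-1 = 1 by rewrite invrK subrKC.
have q1 : 1 <= q.
  by rewrite /q invf_ge1 ?subr_gt0// lerBlDr lerDl invr_ge0 ltW.
have [z [zp zd]] := @Lp_separable _ _ R mu Omega mO fO _ (@rbox R N) p pge1
  rV_measurable_generated rbox_setI_closed bounded_subset_rbox.
have T2 g : unit_ball Omega g -> Lp Omega 2%:E g by exact: unit_ball_Lpfun.
have Twd g : unit_ball Omega g -> is_wderive Omega a (T g) (wd a (T g)) /\
    Lp Omega p%:E (wd a (T g)).
  by move=> /TP[_ /(_ p pge1)] sT; exact: (sobolev_wderive oO bO pge1 sT ak).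
have weak g phi : unit_ball Omega g -> test_fun Omega phi ->
    \int[mu]_(x in Omega) (wd a (T g) x * phi x) =
    (-1) ^+ mlen a * \int[mu]_(x in Omega) (T g x * mderive a phi x).
  by move=> gX tphi; have [[_ ->//] _] := Twd g gX; rewrite signrMK.
have TLp g : unit_ball Omega g -> Lp Omega 2%:E (T g).
  by move=> /TP[[HT _] _]; exact: H10_Lp.
have mdp phi : test_fun Omega phi -> Lp Omega 2%:E (mderive a phi).
  by move=> tphi; exact: (test_fun_Lp oO bO p0 (test_fun_mderive a tphi)).
have diff g1 g2 phi : unit_ball Omega g1 -> unit_ball Omega g2 -> test_fun Omega phi ->
    \int[mu]_(x in Omega) (wd a (T g1) x * phi x) - \int[mu]_(x in Omega) (wd a (T g2) x * phi x)
    = (-1) ^+ mlen a * \int[mu]_(x in Omega) ((1 * T g1 x + -1 * T g2 x) * mderive a phi x).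
  move=> g1X g2X tphi; rewrite (weak g1)// (weak g2)// -mulrBr; congr (_ * _).
  have [i1 _] := hoelder2_integral oO (TLp g1 g1X) (mdp phi tphi).
  have [i2 _] := hoelder2_integral oO (TLp g2 g2X) (mdp phi tphi).
  by rewrite -RintegralB//; apply: eq_Rintegral => x _; rewrite mul1r mulN1r mulrBl.
have [K K0 HK] := poisson_energy oO bO i0.
apply: (@closed_graph_unit_ball _ _ R mu Omega mO fO (fun g => wd a (T g))
  (test_fun Omega) p q z pgt1 q0 pq zp zd).
- by move=> phi; exact: test_fun_Lp.
- by move=> w; exact: test_fun_dense.
- by move=> g /Twd[].
- move=> g1 g2 g1X g2X g12X phi tphi; rewrite diff// weak//; congr (_ * _).
  have E : (fun x => 1 * g1 x + -1 * g2 x) = g1 \- g2.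
    by apply/funext => x /=; rewrite mul1r mulN1r.
  have pd := poisson_solution_lin oO bO 1 (-1) (T2 _ g1X) (T2 _ g2X) (TP _ g1X).1 (TP _ g2X).1.
  rewrite E in pd.
  have TE := poisson_unique oO bO i0 (T2 _ g12X) (TP _ g12X).1 pd.
  have [l _] := Lp_lin oO 1 (-1) p1 (TLp g1 g1X) (TLp g2 g2X).
  have mm := (mdp phi tphi).1.
  apply: (ae_eq_Rintegral mO).
  + by apply: measurable_funM => //; exact: (TLp _ g12X).1.
  + by apply: measurable_funM => //; exact: l.1.
  + by move: TE; rewrite /ae_in; apply: filterS => x /[apply] /= ->.
- move=> phi tphi g gX e e0.
  pose c := nrm 2 (mderive a phi).
  have c0 : 0 <= c by exact: Lpn_ge0.
  pose t := e / (K * c + 1).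
  have Kc : 0 < K * c + 1 by rewrite ltr_wpDl// mulr_ge0.
  have t0 : 0 < t by rewrite divr_gt0.
  (* In the ball |g' - g| <= 2, so ||g' - g||_2^2 <= 2 ||g' - g||_1 <= t^2. *)
  exists (t ^+ 2 / 2); first by rewrite divr_gt0// exprn_gt0.
  move=> g' g'X gg'; rewrite diff// normrM normrX normrN1 expr1n mul1r.
  have [l _] := Lp_lin oO 1 (-1) p1 (TLp g' g'X) (TLp g gX).
  have [_ h2] := hoelder2_integral oO l (mdp phi tphi).
  rewrite (le_trans h2)//.
  have [lg _] := Lp_lin oO 1 (-1) p1 (T2 _ g'X) (T2 _ gX).
  have pd := poisson_solution_lin oO bO 1 (-1) (T2 _ g'X) (T2 _ gX) (TP _ g'X).1 (TP _ gX).1.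
  have h3 := HK _ _ lg pd.
  have E : (fun x => 1 * g' x + -1 * g x) = g' \- g.
    by apply/funext => x /=; rewrite mul1r mulN1r.
  rewrite {}E in lg h3.
  have h4 : nrm 2 (g' \- g) <= t.
    rewrite -(@ler_pXn2r _ 2) ?nnegrE ?Lpn_ge0// ?(ltW t0)//.
    apply: (le_trans (@unit_ball_Lpn2 (g' \- g) 2 _ _ _)) => //.
    - exact: lg.1.
    - move=> x Ox; rewrite (le_trans (ler_normB _ _))//.
      by rewrite (_ : 2 = 1 + 1) ?lerD// ?(g'X.2 x Ox) ?(gX.2 x Ox).
    - by rewrite mulrC -ler_pdivlMr// ltW.
  apply: (@le_trans _ _ (K * t * c)).
    by rewrite ler_wpM2r// (le_trans h3)// ler_wpM2l.
  by rewrite mulrAC /t mulrA ler_pdivrMr// mulrC ler_wpM2l ?(ltW e0)// lerDl.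
Qed.

(** Scaling by [M] reduces to the unit ball; the closed graph result is used for the exponent p + 1,
    which exceeds 1 also when p = 1. *)
Lemma poisson_W2p_continuous a (p M : R) : (mlen a <= 2)%N -> 1 <= p -> 0 < M ->
  forall e, 0 < e -> exists2 r, 0 < r & forall g w, measurable_fun Omega g ->
    ae_in Omega [set x | `|g x| <= M] -> poisson_solution Omega g w -> nrm 1 g < r ->
    Lp Omega p%:E (wd a w) /\ nrm p (wd a w) <= e.
Proof.
move=> ak pp1 M0 e e0.
have p1' : p < p + 1 by rewrite ltrDl.
have [C C0 HC] := Lpn_embed mO fO pp1 p1'.
have C1 : 0 < C + 1 by rewrite ltr_wpDl.
have [T TP HT] := poisson_unit_ball_continuous ak (le_lt_trans pp1 p1').
(* [M] undoes the scaling, and [C + 1] pays for the embedding of L^(p+1) into L^p, also when [C] is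
   0. *)
have [r r0 Hr] := HT _ (divr_gt0 e0 (mulr_gt0 M0 C1)).
exists (M * r); first by rewrite mulr_gt0.
move=> g w mg gM pw gr.
(* [g / M] is bounded by 1 only almost everywhere, while [unit_ball] asks for it on all of
   [Omega]. *)
pose h x := Num.max (-1) (Num.min 1 (g x / M)).
have hE : ae_in Omega [set x | M^-1 * g x + 0 * g x = h x].
  move: gM; rewrite /ae_in; apply: filterS => x /[apply] /= gM.
  rewrite mul0r addr0 /h mulrC.
  have : `|g x / M| <= 1 by rewrite normrM normfV (gtr0_norm M0) ler_pdivrMr// mul1r.
  rewrite ler_norml => /andP[l1 l2].
  by rewrite (min_idPr l2) (max_idPr l1).
have hX : unit_ball Omega h.
  split.
    apply: measurable_maxr; first exact: measurable_cst.
    by apply: measurable_minr; [exact: measurable_cst|exact: measurable_funM].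
  move=> x Ox; rewrite ler_norml /h le_max lexx/= ge_max.
  by rewrite ge_min lexx/= andbT; lra.
have g1 : Lp Omega 1%:E g by exact: (Lpfun_bounded mO fO ltr01 mg gM).
have g2 : Lp Omega 2%:E g by exact: (Lpfun_bounded mO fO p0 mg gM).
have [lg1 lg1n] := Lp_lin oO M^-1 0 (lexx 1) g1 g1.
have [lg2 _] := Lp_lin oO M^-1 0 p1 g2 g2.
have hr : nrm 1 h < r.
  have [_ ->] := Lpn_ae mO ltr01 hX.1 lg1 hE.
  rewrite (le_lt_trans lg1n)// normr0 mul0r addr0 gtr0_norm ?invr_gt0//.
  by rewrite ltr_pdivrMl.
have ph := poisson_solution_lin oO bO M^-1 0 g2 g2 pw pw.
have {}ph := poisson_solution_ae oO lg2.1 hX.1 hE ph.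
have [pT sT] := TP _ hX.
have h2 : Lp Omega 2%:E h by exact: unit_ball_Lpfun.
have TE := poisson_unique oO bO i0 h2 pT ph.
have wE : ae_in Omega [set x | M * T h x + 0 * T h x = w x].
  move: TE; rewrite /ae_in; apply: filterS => x /[apply] /= ->.
  by rewrite !mul0r !addr0 mulrA mulfV ?mul1r// gt_eqF.
have q1 : 1 <= p + 1 by exact: ltW (le_lt_trans pp1 p1').
have sq := sT _ q1.
have [sM wM] := sobolev_lin oO bO M 0 q1 sq sq.
have [sw wwE] := sobolev_ae oO bO q1 (H10_Lp pw.1).1 wE sM.
have [_ wq] := sobolev_wderive oO bO q1 sw ak.
have [wp wpn] := HC _ wq; split => //.
rewrite (le_trans wpn)//.
have [_ Tq] := sobolev_wderive oO bO q1 sq ak.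
have [lT lTn] := Lp_lin oO M 0 q1 Tq Tq.
have q0 : 0 < p + 1 by exact: lt_le_trans q1.
have -> : nrm (p + 1) (wd a w) = nrm (p + 1) (fun x => M * wd a (T h) x + 0 * wd a (T h) x).
  apply: (proj2 (Lpn_ae mO q0 wq.1 lT _)).
  move: (wM a ak) (wwE a ak); rewrite /ae_in; apply: filterS2 => x H1 H2 Ox.
  by rewrite -(H2 Ox) (H1 Ox).
apply: (@le_trans _ _ (C * (M * (e / (M * (C + 1)))))).
  rewrite ler_wpM2l// (le_trans lTn)// normr0 mul0r addr0 gtr0_norm// ler_pM2l//.
  exact: Hr.
have -> : C * (M * (e / (M * (C + 1)))) = e * (C / (C + 1)).
  by field; rewrite !gt_eqF.
by rewrite ler_piMr ?(ltW e0)// ler_pdivrMr// mul1r lerDl.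
Qed.

End poisson_regularity.

(** * Continuity of the control-to-state map *)

Section state_stability.
Context {R : realType} {N : nat}.
Variable Omega : set 'rV[R]_N.
Hypotheses (oO : open Omega) (bO : bounded_set Omega).
Hypothesis hwp : kirchhoff_wellposed Omega.
Variables (f ua ub b : 'rV[R]_N -> R).
Hypothesis hdata : admissible_data Omega f ua ub b.
Variable i0 : 'I_N.
Implicit Types (y z g h v w u : 'rV[R]_N -> R) (s : R).

Local Notation mu := (lebesgue_rV R N).
Let mO : measurable Omega := domain_measurable oO.
Let fO : (mu Omega < +oo)%E := domain_finite oO bO.
Local Notation wd := (wderive Omega).
Local Notation nrm := (Lpn mu Omega).
Let p1 : 1 <= 2 :> R. Proof. by rewrite ler1n. Qed.
Let p0 : 0 < 2 :> R. Proof. by []. Qed.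

Let G u s : 'rV[R]_N -> R := fun x => f x / (u x + b x * s).

Lemma Uad_lower_bound : exists2 u0 : R, 0 < u0 &
  forall u, Uad Omega ua ub u -> ae_in Omega [set x | u0 <= u x].
Proof.
have [_ _ _ [u0 u00 Hu0] _] := hdata; exists u0 => // u [_].
rewrite /ae_in; apply: filterS => x /[swap] Ox /(_ Ox)/= /andP[+ _].
apply: le_trans; have /andP[//] := Hu0 x (subset_closure Ox).
Qed.

Lemma Uad_Lp2 u : Uad Omega ua ub u -> Lp Omega 2%:E u.
Proof.
by move=> [/Linfty_ae[mu_ [M _ uM]] _]; exact: (Lpfun_bounded mO fO p0 mu_ uM).
Qed.

Lemma rhs_measurable u s : Uad Omega ua ub u -> measurable_fun Omega (G u s).
Proof.
move=> Uu; have [[[mf _] _] _ _ _ [[[mb _] _] _]] := hdata.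
apply: measurable_funM => //; apply: measurable_funV; apply: measurable_funD.
  exact: (Uad_Lp2 Uu).1.
by apply: measurable_funM => //; exact: measurable_cst.
Qed.

(** The denominator is at least the lower bound [u0] of the controls, so the bound is uniform in [u]
    and in [s >= 0]. *)
Lemma rhs_bounded : exists2 M, 0 < M & forall u s, Uad Omega ua ub u -> 0 <= s ->
  ae_in Omega [set x | `|G u s x| <= M].
Proof.
have [u0 u00 Hu0] := Uad_lower_bound.
have [[/Linfty_ae[mf [F F0 fF]] _] _ _ _ [_ [b0 b00 bb]]] := hdata.
exists (F / u0); first by rewrite divr_gt0.
move=> u s Uu s0; move: fF bb (Hu0 u Uu); rewrite /ae_in.
apply: filterS3 => x fF bb uu Ox; have {fF}fF := fF Ox.
have {bb}bb : b0 <= b x := bb Ox; have {uu}uu : u0 <= u x := uu Ox.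
have A : u0 <= u x + b x * s.
  by rewrite (le_trans uu)// lerDl mulr_ge0// (le_trans (ltW b00)).
have A0 : 0 < u x + b x * s by exact: lt_le_trans A.
rewrite /= /G normrM normfV (gtr0_norm A0).
by apply: ler_pM => //; rewrite ?invr_ge0 ?(ltW A0)// lef_pV2.
Qed.

(** f/A' - f/A = f (A - A') / (A A') with A, A' >= u0, which gives the factor F / u0^2. The number
    s' - s acts as a constant function, whence the L^2 norm [c1] of 1. *)
Lemma rhs_lipschitz : exists2 C, 0 <= C & forall u u' s s', Uad Omega ua ub u ->
  Uad Omega ua ub u' -> 0 <= s -> 0 <= s' ->
  nrm 2 (G u' s' \- G u s) <= C * (nrm 2 (u' \- u) + `|s' - s|).
Proof.
have [u0 u00 Hu0] := Uad_lower_bound.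
have [[/Linfty_ae[mf [F F0 fF]] _] _ _ _ [[/Linfty_ae[mb [B B0 bB]] _] [b0 b00 bb]]] := hdata.
pose K := F / (u0 * u0).
have K0 : 0 < K by rewrite divr_gt0// mulr_gt0.
pose c1 := nrm 2 (cst 1).
have c10 : 0 <= c1 by exact: Lpn_ge0.
exists (K * (1 + B * c1)).
  by rewrite mulr_ge0 ?(ltW K0)// addr_ge0// mulr_ge0// ltW.
move=> u u' s s' Uu Uu' s0 s'0.
have [dup _] := LpfunB mO p1 (Uad_Lp2 Uu') (Uad_Lp2 Uu).
have [adup adupE] : Lp Omega 2%:E (fun x => `|(u' \- u) x|) /\
    nrm 2 (fun x => `|(u' \- u) x|) <= nrm 2 (u' \- u).
  apply: (Lpn_le mO p0 _ dup); first exact: measurableT_comp dup.1.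
  by apply: aeW => x _; rewrite normr_id.
have one := Lpfun_cst mO fO 1 p0.
have [lp ln] := Lp_lin oO K (K * B * `|s' - s|) p1 adup one.
have md : measurable_fun Omega (G u' s' \- G u s).
  by apply: measurable_funB; exact: rhs_measurable.
have dom : {ae mu, forall x, Omega x -> `|(G u' s' \- G u s) x| <=
    `|K * `|(u' \- u) x| + K * B * `|s' - s| * cst 1 x|}.
  have ub0 : {ae mu, forall x, Omega x -> u0 <= u x /\ u0 <= u' x}.
    move: (Hu0 u Uu) (Hu0 u' Uu'); rewrite /ae_in.
    by apply: filterS2 => x H1 H2 Ox; split; [exact: H1|exact: H2].
  have bb0 : {ae mu, forall x, Omega x -> b0 <= b x /\ `|b x| <= B}.
    move: bb bB; rewrite /ae_in.
    by apply: filterS2 => x H1 H2 Ox; split; [exact: H1|exact: H2].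
  move: fF ub0 bb0; rewrite /ae_in; apply: filterS3 => x H1 H2 H3 Ox.
  have {H1}fF : `|f x| <= F := H1 Ox.
  have {H2}[uu uu'] := H2 Ox; have {H3}[bb1 bB1] := H3 Ox.
  have bx0 : 0 <= b x by exact: le_trans (ltW b00) bb1.
  have A : u0 <= u x + b x * s by rewrite (le_trans uu)// lerDl mulr_ge0.
  have A' : u0 <= u' x + b x * s' by rewrite (le_trans uu')// lerDl mulr_ge0.
  have A0 := lt_le_trans u00 A; have A'0 := lt_le_trans u00 A'.
  have -> : (G u' s' \- G u s) x =
      f x * ((u x + b x * s) - (u' x + b x * s')) /
      ((u x + b x * s) * (u' x + b x * s')).
    by rewrite /G /=; field; rewrite !gt_eqF.
  have P0 := mulr_gt0 A0 A'0.
  have num : `|u x + b x * s - (u' x + b x * s')| <= `|u' x - u x| + B * `|s' - s|.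
    rewrite distrC (_ : _ - _ = (u' x - u x) + b x * (s' - s)); last by ring.
    rewrite (le_trans (ler_normD _ _))// lerD2l normrM.
    by apply: (ler_wpM2r (normr_ge0 _)).
  have den : (u x + b x * s)^-1 * (u' x + b x * s')^-1 <= (u0 * u0)^-1.
    by rewrite invfM ler_pM ?invr_ge0 ?(ltW A0) ?(ltW A'0)// lef_pV2.
  rewrite [leRHS]ger0_norm; last first.
    apply: addr_ge0; first exact: mulr_ge0 (ltW K0) _.
    by rewrite mulr1; exact: mulr_ge0 (mulr_ge0 (ltW K0) (ltW B0)) _.
  rewrite normrM normfV (gtr0_norm P0) normrM invfM.
  rewrite (_ : K * _ + _ = F * (`|u' x - u x| + B * `|s' - s|) * (u0 * u0)^-1); last first.
    by rewrite /K /=; ring.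
  apply: ler_pM den; rewrite ?mulr_ge0 ?invr_ge0 ?(ltW A0) ?(ltW A'0)//.
  exact: ler_pM.
apply: (le_trans (proj2 (Lpn_le mO p0 md lp dom))).
apply: (le_trans ln); rewrite (gtr0_norm K0) ger0_norm; last first.
  exact: mulr_ge0 (mulr_ge0 (ltW K0) (ltW B0)) _.
rewrite -/c1; set d := nrm 2 (u' \- u) in adupE *.
have d0 : 0 <= d by exact: Lpn_ge0.
have Bc : 0 <= B * c1 by exact: mulr_ge0 (ltW B0) c10.
rewrite mulrDr; apply: lerD.
  rewrite -mulrA; apply: (ler_wpM2l (ltW K0)).
  by apply: (le_trans adupE); rewrite ler_peMl// lerDl.
rewrite (_ : K * B * `|s' - s| * c1 = K * (B * c1 * `|s' - s|)); last by ring.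
by rewrite -[leRHS]mulrA; apply: (ler_wpM2l (ltW K0)); rewrite ler_wpM2r// lerDr.
Qed.

Lemma rhs_Lp2 u s : Uad Omega ua ub u -> 0 <= s -> Lp Omega 2%:E (G u s).
Proof.
move=> Uu s0; have [M _ HM] := rhs_bounded.
exact: (Lpfun_bounded mO fO p0 (rhs_measurable s Uu) (HM u s Uu s0)).
Qed.

Lemma rhs_Lpn2_bounded : exists2 M, 0 <= M & forall u s, Uad Omega ua ub u ->
  0 <= s -> nrm 2 (G u s) <= M.
Proof.
have [M M0 HM] := rhs_bounded; exists (nrm 2 (cst M)); first exact: Lpn_ge0.
move=> u s Uu s0; apply: (proj2 (Lpn_le mO p0 (rhs_measurable s Uu) (Lpfun_cst mO fO M p0) _)).
by move: (HM u s Uu s0); rewrite /ae_in; apply: filterS => x /[apply] /= H; rewrite (gtr0_norm M0).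
Qed.

Lemma grad_sqnorm_ae y y' : H10 Omega y -> H10 Omega y' ->
  ae_in Omega [set x | y x = y' x] -> grad_sqnorm Omega y = grad_sqnorm Omega y'.
Proof.
move=> Hy Hy' yy'; rewrite /grad_sqnorm (integral_grad_dot oO bO Hy Hy) (integral_grad_dot oO bO Hy' Hy').
apply: eq_bigr => i _; have m1 : (mlen (munit i) <= 1)%N by rewrite mlen_munit.
have wy := H10_wderive oO bO m1 Hy; have wy' := H10_wderive oO bO m1 Hy'.
have [_ /(_ _ m1) wE] := sobolev_ae oO bO p1 (H10_Lp Hy').1 yy' (H10_sobolev Hy).
apply: (ae_eq_Rintegral mO).
- exact: measurable_funM wy.1 wy.1.
- exact: measurable_funM wy'.1 wy'.1.
- by move: wE; rewrite /ae_in; apply: filterS => x /[apply] /= ->.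
Qed.

(** The energy identity: it expresses the gradient norm without derivatives, so that L^2 convergence
    of the solutions suffices to pass to the limit. *)
Lemma poisson_grad_sqnorm g y : poisson_solution Omega g y ->
  grad_sqnorm Omega y = \int[mu]_(x in Omega) (g x * y x).
Proof. by move=> [Hy ey]; rewrite /grad_sqnorm ey. Qed.

Lemma poisson_exists_ae g M : measurable_fun Omega g ->
  ae_in Omega [set x | `|g x| <= M] -> exists w, poisson_solution Omega g w.
Proof.
move=> mg gM.
pose h x := Num.max (- `|M|) (Num.min `|M| (g x)).
have mh : measurable_fun Omega h.
  apply: measurable_maxr; first exact: measurable_cst.
  by apply: measurable_minr => //; exact: measurable_cst.
have hM x : Omega x -> `|h x| <= `|M|.
  move=> _; rewrite ler_norml /h le_max lexx/= ge_max ge_min lexx/= andbT.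
  by have := normr_ge0 M; lra.
have [w [pw _]] := poisson_exists oO bO hwp mh hM.
exists w; apply: (poisson_solution_ae oO mh mg _ pw).
move: gM; rewrite /ae_in; apply: filterS => x /[apply] /= gM.
have := le_trans gM (ler_norm M); rewrite ler_norml => /andP[l1 l2].
by rewrite /h (min_idPr l2) (max_idPr l1).
Qed.

Variable S : ('rV[R]_N -> R) -> 'rV[R]_N -> R.
Hypothesis hS : control_to_state Omega f ua ub b S.

Local Notation sq u := (grad_sqnorm Omega (S u)).

Lemma state_poisson u : Uad Omega ua ub u ->
  0 <= sq u /\ poisson_solution Omega (G u (sq u)) (S u).
Proof.
move=> Uu; have wS := hS Uu; split; first exact: grad_sqnorm_ge0 wS.1.
exact/weak_solution_poisson.
Qed.

Lemma state_unique u s y : Uad Omega ua ub u -> poisson_solution Omega (G u s) y ->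
  grad_sqnorm Omega y = s -> sq u = s.
Proof.
move=> Uu py ys.
have wy : weak_solution Omega f b u y by apply/weak_solution_poisson; rewrite ys.
have [y0 [_ uniq0 _]] := hwp hdata Uu.
have yS : ae_in Omega [set x | y x = S u x].
  move: (uniq0 _ wy) (uniq0 _ (hS Uu)); rewrite /ae_in.
  by apply: filterS2 => x H1 H2 Ox; rewrite /= (H1 Ox) (H2 Ox).
by rewrite -ys; apply/esym; exact: grad_sqnorm_ae wy.1 (hS Uu).1 yS.
Qed.

(** The number s(u) is given implicitly and uniqueness comes without an estimate, so compactness is
    used: a sequence of controls violating continuity has bounded s, hence a cluster value. *)
Lemma grad_sqnorm_continuous u : Uad Omega ua ub u -> forall e, 0 < e ->
  exists2 r, 0 < r & forall u', Uad Omega ua ub u' -> nrm 2 (u' \- u) < r ->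
    `|sq u' - sq u| < e.
Proof.
move=> Uu e e0; apply: contrapT => nH.
have [K K0 HK] := poisson_energy oO bO i0.
have [M M0 HM] := rhs_Lpn2_bounded.
have [L L0 HL] := rhs_lipschitz.
have energy_bound u' s y : Uad Omega ua ub u' -> 0 <= s ->
    poisson_solution Omega (G u' s) y -> nrm 2 y <= K * M.
  move=> Uu' s0 py; rewrite (le_trans (HK _ _ (rhs_Lp2 Uu' s0) py))//.
  by rewrite ler_wpM2l// HM.
have sqC u' : Uad Omega ua ub u' -> 0 <= sq u' <= M * (K * M).
  move=> Uu'; have [s0 py] := state_poisson Uu'; rewrite s0/=.
  rewrite (poisson_grad_sqnorm py) (le_trans (ler_norm _))//.
  have [_ h] := hoelder2_integral oO (rhs_Lp2 Uu' s0) (H10_Lp py.1).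
  rewrite (le_trans h)// ler_pM ?Lpn_ge0//; first exact: HM.
  exact: energy_bound Uu' s0 py.
have Hn n : exists u', [/\ Uad Omega ua ub u', nrm 2 (u' \- u) < n.+1%:R^-1
    & e <= `|sq u' - sq u|].
  apply: contrapT => nn; apply: nH.
  exists n.+1%:R^-1; first by rewrite invr_gt0.
  move=> u' Uu' uu'; rewrite ltNge; apply/negP => eu; apply: nn.
  by exists u'.
pose us n := projT1 (cid (Hn n)).
have Hus n : [/\ Uad Omega ua ub (us n), nrm 2 (us n \- u) < n.+1%:R^-1
    & e <= `|sq (us n) - sq u|] := projT2 (cid (Hn n)).
pose sn n : R := sq (us n).
have [ss [ssC ssF]] : `[0, M * (K * M)]%classic `&` cluster (sn @ \oo) !=set0.
  have pf : ProperFilter (sn @ \oo) by exact: fmap_proper_filter.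
  apply: (@segment_compact R 0 (M * (K * M)) _ pf).
  by exists 0%N => // n _ /=; rewrite in_itv/=; apply: sqC; have [] := Hus n.
have ss0 : 0 <= ss by move: ssC; rewrite /= in_itv/= => /andP[].
(* A cluster value suffices instead of a subsequence: each precision [r] requires only one index of
   the sequence. *)
have near r : 0 < r -> exists u', [/\ Uad Omega ua ub u', nrm 2 (u' \- u) < r,
    `|sq u' - ss| < r & e <= `|sq u' - sq u|].
  move=> r0.
  have A : (sn @ \oo) [set t | exists u', [/\ Uad Omega ua ub u', nrm 2 (u' \- u) < r,
      sq u' = t & e <= `|sq u' - sq u|]].
    have : \forall n \near \oo, r^-1 <= n%:R by exact: nbhs_infty_ger.
    apply: filterS => n rn; have [U1 U2 U3] := Hus n; exists (us n); split => //.
    rewrite (lt_le_trans U2)// -[r]invrK lef_pV2 ?posrE ?invr_gt0//.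
    by rewrite (le_trans rn)// ler_nat.
  have [t [[u' [U1 U2 U3 U4]] tb]] := ssF _ _ A (nbhsx_ballx ss r r0).
  by exists u'; split => //; rewrite U3 distrC.
have [M' M'0 HM'] := rhs_bounded.
have [y py] := poisson_exists_ae (rhs_measurable ss Uu) (HM' u ss Uu ss0).
have yss : grad_sqnorm Omega y = ss.
  apply/eqP; rewrite -subr_eq0 -normr_le0; apply/ler_addgt0Pr => t t0.
  (* The 1 accounts for |sq u' - ss|, the product for the bound [dn] on the difference of the
     gradient norms. *)
  pose C := 1 + (L * 2) * (2 * K * M).
  have C0 : 0 < C by rewrite ltr_pwDl// !mulr_ge0.
  have [u' [Uu' uu' ss' _]] := near (t / C) (divr_gt0 t0 C0).
  have [s'0 py'] := state_poisson Uu'.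
  have g1 := rhs_Lp2 Uu ss0; have g2 := rhs_Lp2 Uu' s'0.
  have [dg _] := LpfunB mO p1 g2 g1.
  have y1 := H10_Lp py.1; have y2 := H10_Lp py'.1.
  have [dy _] := LpfunB mO p1 y2 y1.
  have dgn : nrm 2 (G u' (sq u') \- G u ss) <= L * (2 * (t / C)).
    rewrite (le_trans (HL _ _ _ _ Uu Uu' ss0 s'0))// ler_wpM2l//.
    by rewrite mulr_natl mulr2n lerD// ltW.
  have dyn : nrm 2 (S u' \- y) <= K * (L * (2 * (t / C))).
    have := HK _ _ _ (poisson_solution_lin oO bO 1 (-1) g2 g1 py' py).
    have E h k : (fun x => 1 * h x + -1 * k x) = h \- k :> ('rV[R]_N -> R).
      by apply/funext => x; rewrite mul1r mulN1r.
    rewrite !E => /(_ dg) /le_trans; apply.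
    by rewrite ler_wpM2l.
  have [i1 h1] := hoelder2_integral oO dg y2.
  have [i2 h2] := hoelder2_integral oO g1 dy.
  have [i3 _] := hoelder2_integral oO g2 y2.
  have [i4 _] := hoelder2_integral oO g1 y1.
  (* Energy identities, with g' y' - g y = (g' - g) y' + g (y' - y). *)
  have dE : sq u' - grad_sqnorm Omega y =
      \int[mu]_(x in Omega) ((G u' (sq u') \- G u ss) x * S u' x) +
      \int[mu]_(x in Omega) (G u ss x * (S u' \- y) x).
    rewrite [in LHS](poisson_grad_sqnorm py') [in LHS](poisson_grad_sqnorm py).
    apply: (etrans (esym (RintegralB mO i3 i4))).
    apply: (etrans _ (RintegralD mO i1 i2)).
    by apply: eq_Rintegral => x _ /=; ring.
  have dn : `|sq u' - grad_sqnorm Omega y| <= L * (2 * (t / C)) * (2 * K * M).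
    rewrite dE (le_trans (ler_normD _ _))//.
    apply: (@le_trans _ _ (L * (2 * (t / C)) * (K * M) + M * (K * (L * (2 * (t / C)))))).
      apply: lerD.
        apply: (le_trans h1); apply: ler_pM; rewrite ?Lpn_ge0//.
        exact: energy_bound Uu' s'0 py'.
      apply: (le_trans h2); apply: ler_pM; rewrite ?Lpn_ge0//.
      exact: HM.
    by rewrite le_eqVlt; apply/orP; left; apply/eqP; ring.
  rewrite add0r; move: ss' dn; set q := grad_sqnorm Omega y; set q' := sq u'.
  move=> ss' dn; have -> : q - ss = (q' - ss) - (q' - q) by ring.
  apply: (le_trans (ler_normB _ _)); apply: (le_trans (lerD (ltW ss') dn)).
  have -> : t / C + L * (2 * (t / C)) * (2 * K * M) = C * (t / C) by rewrite /C; ring.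
  by rewrite mulrC divfK// gt_eqF.
have sus := state_unique Uu py yss.
(* Since [ss] is [sq u], this [u'] is both closer than [e] and at least [e] away. *)
have [u' [_ _ H1 H2]] := near e e0.
by move: H2; rewrite sus leNgt H1.
Qed.

(** S u' - S u solves the Poisson problem for the difference of the right-hand sides, which is
    bounded by 2 M and small in L^2, hence in L^1. *)
Lemma state_continuous u : Uad Omega ua ub u -> forall (a : 'I_N -> nat) (p : R),
  (mlen a <= 2)%N -> 1 <= p -> forall e, 0 < e ->
  exists2 r, 0 < r & forall u', Uad Omega ua ub u' -> nrm 2 (u' \- u) < r ->
    Lp Omega p%:E (wd a (S u' \- S u)) /\ nrm p (wd a (S u' \- S u)) <= e.
Proof.
move=> Uu a p a2 pp1 e e0.
have [M M0 HM] := rhs_bounded; have [L L0 HL] := rhs_lipschitz.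
have M20 : 0 < M + M by rewrite addr_gt0.
have [t t0 Ht] := poisson_W2p_continuous oO bO hwp i0 a2 pp1 M20 e0.
have [C C0 HC] := Lpn_embed mO fO (lexx 1) (ltr1n R 2).
(* Both |u' - u| and |s' - s| contribute t / D, in total C L 2 t / D; the added 1 makes this
   strictly less than [t]. *)
pose D := C * L * 2 + 1.
have D0 : 0 < D by rewrite ltr_wpDl// !mulr_ge0.
have tD : 0 < t / D by rewrite divr_gt0.
have [r r0 Hr] := grad_sqnorm_continuous Uu tD.
exists (Num.min r (t / D)); first by rewrite lt_min r0.
move=> u' Uu'; rewrite lt_min => /andP[u'r u't].
have {Hr u'r}Hs := Hr u' Uu' u'r.
have [s0 py] := state_poisson Uu; have [s'0 py'] := state_poisson Uu'.
have g1 := rhs_Lp2 Uu s0; have g2 := rhs_Lp2 Uu' s'0.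
have [dg _] := LpfunB mO p1 g2 g1.
have := poisson_solution_lin oO bO 1 (-1) g2 g1 py' py.
have E h k : (fun x => 1 * h x + -1 * k x) = h \- k :> ('rV[R]_N -> R).
  by apply/funext => x; rewrite mul1r mulN1r.
rewrite !E => pd; apply: (Ht _ _ dg.1 _ pd).
  move: (HM u' _ Uu' s'0) (HM u _ Uu s0); rewrite /ae_in.
  apply: filterS2 => x H1 H2 Ox; rewrite /= (le_trans (ler_normB _ _))//.
  by apply: lerD; [exact: H1 Ox|exact: H2 Ox].
have [_ dgC] := HC _ dg.
rewrite (le_lt_trans dgC)// (@le_lt_trans _ _ (C * (L * (t / D + t / D))))//.
  rewrite ler_wpM2l// (le_trans (HL _ _ _ _ Uu Uu' s0 s'0))// ler_wpM2l//.
  by rewrite lerD// ltW.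
have -> : C * (L * (t / D + t / D)) = t * ((C * L * 2) / D) by ring.
by rewrite gtr_pMr// ltr_pdivrMr// mul1r /D ltrDl.
Qed.

End state_stability.

Lemma finite_uniform_bound (R : realType) (I : finType) (P : I -> R -> Prop) :
  (forall i r r', r' <= r -> P i r -> P i r') ->
  (forall i, exists2 r, 0 < r & P i r) -> exists2 r, 0 < r & forall i, P i r.
Proof.
move=> Pmono HP.
pose r i := s2val (cid2 (HP i)).
have Hr i : 0 < r i /\ P i (r i).
  by exact: conj (s2valP (cid2 (HP i))) (s2valP' (cid2 (HP i))).
exists (\big[Num.min/1]_i r i).
  by apply: lt_bigmin => // i _; have [] := Hr i.
by move=> i; apply: Pmono (Hr i).2; exact: bigmin_le.
Qed.

Theorem theorem2p6 (R : realType) (N : nat) (hN : (1 <= N <= 3)%N)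
    (Omega : set 'rV[R]_N) (hOmega : bounded_C11_domain Omega)
    (f ua ub b : 'rV[R]_N -> R) (hdata : admissible_data Omega f ua ub b)
    (hwp : kirchhoff_wellposed Omega)
    (S : ('rV[R]_N -> R) -> 'rV[R]_N -> R)
    (hS : control_to_state Omega f ua ub b S)
    (p : R) (hp : 1 <= p) :
  (forall u, Uad Omega ua ub u ->
     H10 Omega (S u) /\ sobolev Omega 2 p%:E (S u)) /\
  (forall u, Uad Omega ua ub u -> forall e : R, 0 < e ->
     exists2 delta : R, 0 < delta &
       forall u', Uad Omega ua ub u' ->
         (Lp_norm Omega 2%:E (u' \- u)%R < delta%:E)%E ->
         (sobolev_norm Omega 1 2%:E (S u' \- S u)%R < e%:E)%E /\
         (sobolev_norm Omega 2 p%:E (S u' \- S u)%R < e%:E)%E).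
Proof.
have [oO _ _ bO _] := hOmega.
have N0 : (0 < N)%N by case/andP: hN.
(* A coordinate direction for Poincare's inequality; it exists because N >= 1. *)
pose i0 : 'I_N := Ordinal N0.
have p21 : 1 <= 2 :> R by rewrite ler1n.
split=> [u Uu|u Uu e e0].
  have wS := hS u Uu; have HS := wS.1; split => //.
  (* The regularity is known for one solution [y]; uniqueness transfers it to the representative
     chosen by [S]. *)
  have [y [_ uniq sy]] := hwp _ _ _ _ hdata _ Uu.
  have yS : ae_in Omega [set x | y x = S u x].
    by move: (uniq _ wS); rewrite /ae_in; apply: filterS => x /[apply] /= ->.
  by have [] := sobolev_ae oO bO hp (H10_Lp HS).1 yS (sy p hp).
(* Treats both target norms at once: k = 1, q = 2 for H^1_0 and k = 2, q = p for W^{2,p}. *)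
have norm_small k (q : R) : 1 <= q -> (k <= 2)%N -> exists2 r, 0 < r &
    forall u', Uad Omega ua ub u' -> Lpn (lebesgue_rV R N) Omega 2 (u' \- u) < r ->
      (sobolev_norm Omega k q%:E (S u' \- S u)%R < e%:E)%E.
  move=> q1 k2; pose n := #|{ffun 'I_N -> 'I_k.+1}|.
  have c0 : 0 < e / n.+1%:R by rewrite divr_gt0.
  (* The restriction on the order is put inside the predicate, so that the minimum of the radii is
     taken over the whole finite type of multi-indices. *)
  have [] := @finite_uniform_bound R {ffun 'I_N -> 'I_k.+1} (fun a r =>
    forall u', Uad Omega ua ub u' -> Lpn (lebesgue_rV R N) Omega 2 (u' \- u) < r ->
      (mlen (fun i => a i) <= k)%N ->
      Lp Omega q%:E (wderive Omega (fun i => a i) (S u' \- S u)) /\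
      Lpn (lebesgue_rV R N) Omega q (wderive Omega (fun i => a i) (S u' \- S u))
        <= e / n.+1%:R).
  - by move=> a r r' rr' H u' Uu' u'r; apply: H => //; exact: lt_le_trans rr'.
  - move=> a; have [ak|ak] := leqP (mlen (fun i => a i)) k; last first.
      by exists 1 => // u' _ _; rewrite leqNgt ak.
    have [r r0 Hr] := state_continuous oO bO hwp hdata i0 hS Uu (leq_trans ak k2) q1 c0.
    by exists r => // u' Uu' u'r _; exact: Hr.
  move=> r r0 Hr; exists r => // u' Uu' u'r.
  apply: (@le_lt_trans _ _ ((e / n.+1%:R) *+ n)%:E).
    apply: sobolev_norm_le; first exact: ltW.
    move=> a ak; pose a' : {ffun 'I_N -> 'I_k.+1} := [ffun i => inord (a i)].
    have aE : (fun i => a' i : nat) = a.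
      apply/funext => i; rewrite ffunE inordK// ltnS (leq_trans _ ak)//.
      by rewrite /mlen (bigD1 i)//= leq_addr.
    by have := Hr a' u' Uu' u'r; rewrite aE; apply.
  by rewrite lte_fin -mulr_natr mulrAC ltr_pdivrMr// ltr_pM2l// ltr_nat.
have [r1 r10 H1] := norm_small 1%N 2 p21 isT.
have [r2 r20 H2] := norm_small 2%N p hp isT.
exists (Num.min r1 r2); first by rewrite lt_min r10.
move=> u' Uu' uu'.
have [dup _] := LpfunB (domain_measurable oO) p21 (Uad_Lp2 oO bO Uu') (Uad_Lp2 oO bO Uu).
move: uu'; rewrite /Lp_norm (Lpn_fineK dup) lte_fin lt_min => /andP[h1 h2].
by split; [exact: H1|exact: H2].
Qed.
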